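(* Let $(E,r)$ be a complete separable metric space and let $A\subset C_b(E)\times C_b(E)$. For $\mu\in\mathcal P(E)$ let $\Pi_\mu\subset\mathcal P(D_E[0,\infty))$ be the set of distributions of solutions of the martingale problem for $(A,\mu)$ in $D_E[0,\infty)$. Assume: (a) $\mathcal D(A)$ is dense in $C_b(E)$ in the topology of uniform convergence on compact sets; (b) for each $\mu\in\mathcal P(E)$, $\Pi_\mu\neq\emptyset$; (c) if $\mathcal K\subset\mathcal P(E)$ is compact, then $\bigcup_{\mu\in\mathcal K}\Pi_\mu$ is compact in $\mathcal P(D_E[0,\infty))$. For $\lambda>0$, let $M_\lambda$ be the set of $h\in C_b(E)$ such that the comparison principle holds for the equation $\lambda u-g=h$, $(u,g)\in A$ (i.e. $\lambda u-Au=h$). If for each $\lambda>0$ the set $M_\lambda$ is separating, then uniqueness holds for the martingale problem for $A$ in $D_E[0,\infty)$.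
   Context: $C_b(E)$ is the space of bounded continuous functions on $E$, $B(E)$ the bounded measurable functions, $\mathcal P(E)$ the Borel probability measures with the weak topology, $D_E[0,\infty)$ the space of cadlag $E$-valued functions with the Skorohod topology, and $\mathcal P(D_E[0,\infty))$ carries the corresponding weak topology. The operator $A$ is identified with a set of pairs (it may be multivalued); $\mathcal D(A)=\{f:(f,g)\in A \text{ for some } g\}$. Martingale problem: a process $X$ with sample paths in $D_E[0,\infty)$ on a probability space is a solution of the martingale problem for $A$ in $D_E[0,\infty)$ if there is a filtration $\{\mathcal F_t\}$ such that $X$ is $\{\mathcal F_t\}$-adapted and $f(X(t))-f(X(0))-\int_0^t g(X(s))\,ds$ is an $\{\mathcal F_t\}$-martingale for each $(f,g)\in A$; it is a solution for $(A,\mu)$ if moreover $X(0)$ has distribution $\mu$. Uniqueness holds for the martingale problem for $A$ in $D_E[0,\infty)$ if, for every $\mu\in\mathcal P(E)$, any two solutions for $(A,\mu)$ in $D_E[0,\infty)$ have the same distribution on $D_E[0,\infty)$. Viscosity semisolutions: let $\lambda>0$, $h\in C_b(E)$. A function $u\in B(E)$ is a viscosity subsolution of $\lambda u-Au=h$ if $u$ is upper semicontinuous and whenever $(f,g)\in A$ and $x_0\in E$ satisfy $\sup_x(u-f)(x)=(u-f)(x_0)$, then $\lambda u(x_0)-g(x_0)\le h(x_0)$. A function $u\in B(E)$ is a viscosity supersolution if $u$ is lower semicontinuous and whenever $(f,g)\in A$ and $x_0\in E$ satisfy $\inf_x(u-f)(x)=(u-f)(x_0)$, then $\lambda u(x_0)-g(x_0)\ge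 h(x_0)$. The comparison principle holds for the equation if every viscosity subsolution is pointwise less than or equal to every viscosity supersolution. A set $M\subset C_b(E)$ is separating if, for $\mu,\nu\in\mathcal P(E)$, $\int f\,d\mu=\int f\,d\nu$ for all $f\in M$ implies $\mu=\nu$. *)

(* Defs.v *)
From HB Require Import structures.
From mathcomp Require Import all_boot all_order all_algebra.
From mathcomp Require Import all_classical all_reals all_analysis.

Set Implicit Arguments.
Unset Strict Implicit.
Unset Printing Implicit Defensive.

Import Order.TTheory GRing.Theory Num.Theory.
Import numFieldNormedType.Exports.

Local Open Scope classical_set_scope.
Local Open Scope ring_scope.

(* Measurable types are pointed in the library, so the empty space, on which
   there is no probability measure, is excluded. *)
#[short(type="completeMetricType")]
HB.structure Definition CompleteMetric (R : numDomainType) :=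
  {E of Metric R E & Complete E & Pointed E}.

Definition separable (T : topologicalType) :=
  exists2 S : set T, countable S & dense S.

Notation borel T := (g_sigma_algebraType (@open T)).

Definition Cb (R : realType) (T : topologicalType) : set (T -> R) :=
  [set f | continuous f /\ bounded_fun f].

Arguments Cb R T : clear implicits.

Definition upper_semicontinuous (R : realType) (T : topologicalType)
    (u : T -> R) :=
  forall x a, u x < a -> \forall y \near x, u y < a.

Section BorelProbability.
Context (R : realType) (T : ptopologicalType).

(* The values of a [probability] outside the sigma-algebra are irrelevant:
   equality in P(T) is agreement on Borel sets, not Leibniz equality.  The
   weak topology below does not see those values either. *)
Definition borel_probability : Type := probability (borel T) R.

HB.instance Definition _ := gen_eqMixin borel_probability.
HB.instance Definition _ := gen_choiceMixin borel_probability.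

Definition Cb_integral (mu : borel_probability) : {ptws Cb R T -> R} :=
  fun f => (\int[mu]_x (val f x))%R.

HB.instance Definition _ :=
  Topological.copy borel_probability (initial_topology Cb_integral).

Definition separating (M : set (T -> R)) :=
  forall mu nu : borel_probability,
    (forall f, M f -> (\int[mu]_x f x)%R = (\int[nu]_x f x)%R) ->
    forall B : set (borel T), measurable B -> mu B = nu B.

End BorelProbability.

Section Skorohod.
Context (R : realType) (E : completeMetricType R).

(* A path is indexed by all of R but frozen at negative times, so that two
   elements are equal as soon as they agree on [0, +oo[. *)
Record skorohod : Type := Skorohod {
  skorohod_path :> R -> E ;
  skorohod_right_continuous :
    forall t, 0 <= t -> skorohod_path s @[s --> t^'+] --> skorohod_path t ;
  skorohod_left_limit :
    forall t, 0 < t -> cvg (skorohod_path s @[s --> t^'-]) ;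
  skorohod_neg : forall t, t < 0 -> skorohod_path t = skorohod_path 0
}.

HB.instance Definition _ := gen_eqMixin skorohod.
HB.instance Definition _ := gen_choiceMixin skorohod.

Definition skorohod_cst (a : E) : skorohod :=
  @Skorohod (fun=> a) (fun _ _ => cvg_cst _) (fun _ _ => is_cvg_cst _)
    (fun _ _ => erefl).

HB.instance Definition _ := isPointed.Build skorohod (skorohod_cst point).

Definition time_change (lam : R -> R) :=
  (forall s t, 0 <= s -> s < t -> lam s < lam t) /\
  lam @` [set t | 0 <= t] = [set t | 0 <= t].

Definition skorohod_nbhd (x : skorohod) (T e : R) : set skorohod :=
  [set y | exists2 lam, time_change lam &
    forall t, 0 <= t <= T ->
      `|lam t - t| < e /\ mdist (y t) (x (lam t)) < e].

(* The J1 topology: y_n --> x iff for every T there are time changes lam_n with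
   lam_n t - t --> 0 and d(y_n t, x (lam_n t)) --> 0 uniformly on [0, T], i.e.
   iff y_n is eventually in each [skorohod_nbhd x T e]. *)
Definition skorohod_open : set_system skorohod :=
  [set U | forall x, U x ->
    exists T, exists2 e, 0 < e & skorohod_nbhd x T e `<=` U].

Lemma skorohod_openT : skorohod_open setT.
Proof. by move=> x _; exists 0, 1. Qed.

Lemma skorohod_nbhdS x (T T' e e' : R) : T' <= T -> e <= e' ->
  skorohod_nbhd x T e `<=` skorohod_nbhd x T' e'.
Proof.
move=> TT ee y [lam clam H]; exists lam => // t /andP[t0 tT].
have [|h1 h2] := H t; first by rewrite t0 (le_trans tT).
by split; [exact: lt_le_trans h1 ee | exact: lt_le_trans h2 ee].
Qed.

Lemma skorohod_openI : setI_closed skorohod_open.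
Proof.
move=> U V oU oV x [/oU[T [e e0 TU]] /oV[T' [e' e'0 TV]]].
exists (Num.max T T'), (Num.min e e'); first by rewrite lt_min e0.
move=> y H; split; [apply: TU|apply: TV]; move: y H; apply: skorohod_nbhdS;
  by rewrite ?le_max ?ge_min lexx ?orbT.
Qed.

Lemma skorohod_open_bigU (I : Type) (f : I -> set skorohod) :
  (forall i, skorohod_open (f i)) -> skorohod_open (\bigcup_i f i).
Proof.
move=> oF x [i _ /oF[T [e e0 H]]]; exists T, e => // y /H; by exists i.
Qed.

HB.instance Definition _ := isOpenTopological.Build skorohod
  skorohod_openT skorohod_openI skorohod_open_bigU.

End Skorohod.

Section Martingale.
Context (R : realType) d (Om : measurableType d) (P : probability Om R).
Implicit Type F : R -> set (set Om).

Definition filtration F :=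
  [/\ forall t, 0 <= t -> sigma_algebra setT (F t),
      forall t, 0 <= t -> F t `<=` measurable
    & forall s t, 0 <= s -> s <= t -> F s `<=` F t].

Definition adapted d' (S : measurableType d') F (Y : R -> Om -> S) :=
  forall t, 0 <= t -> forall B, measurable B -> F t (Y t @^-1` B).

Definition martingale F (M : R -> Om -> R) :=
  [/\ adapted F M,
      forall t, 0 <= t -> P.-integrable setT (EFin \o M t)
    & forall s t, 0 <= s -> s <= t -> forall B, F s B ->
        (\int[P]_(w in B) (M t w)%:E = \int[P]_(w in B) (M s w)%:E)%E].

End Martingale.

Section MartingaleProblem.
Context (R : realType) (E : completeMetricType R).
Variable A : set ((E -> R) * (E -> R)).

Definition op_domain : set (E -> R) := [set f | exists g, A (f, g)].

Section Solution.
Context d (Om : measurableType d) (P : probability Om R).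

(* Measurability of X for the Borel sets of the Skorohod space is not required:
   it follows from that of the coordinates X t. *)
Variable X : Om -> borel (skorohod E).

Definition solution :=
  exists F : R -> set (set Om),
    [/\ filtration F,
        adapted F (fun t w => X w t : borel E)
      & forall f g, A (f, g) ->
          martingale P F (fun t w =>
            f (X w t) - f (X w 0)
            - (\int[lebesgue_measure]_(s in `[0, t]) g (X w s))%R)].

Definition solution_for (mu : borel_probability R E) :=
  solution /\
  forall B : set (borel E), measurable B ->
    P [set w | B (X w 0)] = mu B.

End Solution.

Definition solution_laws (mu : borel_probability R E) :
    set (borel_probability R (skorohod E)) :=
  [set Q | exists d (Om : measurableType d) (P : probability Om R)
      (X : Om -> borel (skorohod E)),
    solution_for P X mu /\
    forall B, measurable B -> Q B = pushforward P X B].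

Definition martingale_uniqueness :=
  forall (mu : borel_probability R E)
    d1 (Om1 : measurableType d1) (P1 : probability Om1 R)
    (X1 : Om1 -> borel (skorohod E))
    d2 (Om2 : measurableType d2) (P2 : probability Om2 R)
    (X2 : Om2 -> borel (skorohod E)),
    solution_for P1 X1 mu -> solution_for P2 X2 mu ->
    forall B, measurable B -> pushforward P1 X1 B = pushforward P2 X2 B.

Definition bounded_measurable (u : E -> R) :=
  measurable_fun [set: borel E] (u : borel E -> R) /\ bounded_fun u.

Definition viscosity_subsolution (lam : R) (h u : E -> R) :=
  [/\ bounded_measurable u, upper_semicontinuous u
    & forall f g x0, A (f, g) ->
        sup (range (fun x => u x - f x)) = u x0 - f x0 ->
        lam * u x0 - g x0 <= h x0].

Definition viscosity_supersolution (lam : R) (h u : E -> R) :=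
  [/\ bounded_measurable u, lower_semicontinuous (EFin \o u)
    & forall f g x0, A (f, g) ->
        inf (range (fun x => u x - f x)) = u x0 - f x0 ->
        lam * u x0 - g x0 >= h x0].

Definition comparison_principle (lam : R) (h : E -> R) :=
  forall u v, viscosity_subsolution lam h u -> viscosity_supersolution lam h v ->
    forall x, u x <= v x.

Definition comparison_set (lam : R) : set (E -> R) :=
  [set h | Cb R E h /\ comparison_principle lam h].

End MartingaleProblem.

(* Main.v *)
Require Import Defs.
From HB Require Import structures.
From mathcomp Require Import all_boot all_order all_algebra.
From mathcomp Require Import all_classical all_reals all_analysis.
From mathcomp Require Import measurable_realfun ring lra.

(** Write D for the path space and F x for the integral over t >= 0 of
    exp (- lam t) h (x t), where x is in D.

    The expectation of F under the law of a solution started at x is the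
    resolvent of h, if solutions are unique.  Without uniqueness there are two
    candidates, the supremum and the infimum of these expectations over all
    solutions started at x.  The supremum is attained and upper semicontinuous,
    because compact sets of initial laws have compact sets of solutions
    ([solution_laws_max], [upper_value_usc]), and dynamic programming over a short
    time makes it a viscosity subsolution ([upper_value_touching],
    [upper_value_subsolution]).  By a change of signs, the infimum is a
    viscosity supersolution.  When the comparison principle holds, the two agree
    with one continuous function u, and every solution with initial law mu
    satisfies E (F X) = int u dmu ([comparison_discounted]).

    Both the dynamic programming and the last step compare a solution having an
    arbitrary initial law with solutions started at points.  The comparison is
    [domination]: a bounded continuous functional on D with nonpositive mean under
    all solutions started at points has nonpositive mean under all solutions.
    It follows from conditioning on small sets of initial positions and from
    compactness, without disintegration.

    Thus two solutions with the same initial law have, for each lam, the same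
    mean of F whenever h is in the comparison set.  Such means are the
    integrals of h with respect to the law of the process at an independent
    exponential time ([exponential_time_law]), so the separating hypothesis extends
    the equality to all bounded continuous h.  Inverting the Laplace transform
    gives the equality of the marginals ([mean_marginal_eq], [marginal_unique]).
    Conditioning a solution on an event of the past and restarting it yields
    another solution ([solution_conditional_restart]); by induction on the number
    of times, the finite-dimensional laws agree ([cylinder_unique]).

    The finite-dimensional laws determine the law on D since the coordinates
    generate the Borel sets of the Skorohod topology ([measurable_path]).  This
    rests on approximating a path by step paths on a grid, with time changes that
    move the large jumps of the path to the grid ([approx_nbhd]).  The same
    cuttings of paths show that F is continuous on D ([discounted_continuous]). *)

Set Implicit Arguments.
Unset Strict Implicit.
Unset Printing Implicit Defensive.

Import Order.TTheory GRing.Theory Num.Theory.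
Import numFieldNormedType.Exports.

Local Open Scope classical_set_scope.
Local Open Scope ring_scope.

(** * Oscillation of cadlag paths *)

Section PathRegularity.
Context {R : realType} {E : completeMetricType R}.
Implicit Types (x y z : skorohod E) (t T e : R).

(** Paths are constant on negative times. *)
Lemma skorohod_eq x y : (forall t, 0 <= t -> x t = y t) -> x = y.
Proof.
move=> xy; have {xy} : skorohod_path x = skorohod_path y.
  apply/funext => t; have [t0|t0] := leP 0 t; first exact: xy.
  by rewrite !skorohod_neg// xy.
case: x => x xr xl xn; case: y => y yr yl yn /= xy.
by subst y; congr Skorohod; exact: Prop_irrelevance.
Qed.

Lemma path_right_cvg x t : x s @[s --> t^'+] --> x t.
Proof.
have [t0|t0] := leP 0 t; first exact: skorohod_right_continuous.
apply: cvg_near_cst; near=> s; rewrite !skorohod_neg//.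
Unshelve. all: by end_near. Qed.

Lemma path_right_close x t e : 0 < e ->
  exists2 d, 0 < d & forall s, t <= s -> s < t + d -> mdist (x t) (x s) < e.
Proof.
move=> e0; have /metricType_numDomainType.cvgrPdist_lt /(_ _ e0) := @path_right_cvg x t.
move=> [d /= d0 H]; exists d => // s; rewrite le_eqVlt => /predU1P[<- _|ts sd].
  by rewrite mdistxx.
by apply: H => //=; rewrite distrC gtr0_norm ?subr_gt0// ltrBlDl.
Qed.

Lemma path_left_close x t e : 0 < t -> 0 < e ->
  exists2 d, 0 < d & forall s s', t - d < s -> s < t -> t - d < s' -> s' < t ->
    mdist (x s) (x s') < e.
Proof.
move=> t0 e0; have /cvg_ex[l xl] := @skorohod_left_limit _ _ x t t0.
have e20 : 0 < e / 2 by rewrite divr_gt0.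
have /metricType_numDomainType.cvgrPdist_lt /(_ _ e20)[d /= d0 H] := xl.
exists d => // s s' sd st sd' st'; rewrite (splitr e).
apply: (le_lt_trans (metric_triangle _ l _)); rewrite ltrD//.
  rewrite metric_sym; apply: H => //=.
  by rewrite gtr0_norm ?subr_gt0// ltrBlDl -ltrBlDr.
by apply: H => //=; rewrite gtr0_norm ?subr_gt0// ltrBlDl -ltrBlDr.
Qed.

(** A cutting of [0, T] for the oscillation e.  It is phrased through pairs of
    times that no point of s separates, so that s needs neither be sorted nor be
    inside [0, T]. *)
Definition cuts x T e (s : seq R) := forall u v, 0 <= u -> u <= v -> v <= T ->
  (forall p, p \in s -> ~~ (u < p <= v)) -> mdist (x u) (x v) < e.

(** Real induction on T: right continuity extends a cutting beyond T, and the
    left limit at T lets cuttings of the intervals [0, T''] with T'' < T reach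
    T. *)
Lemma cuts_exist x T e : 0 < e -> exists s : seq R, cuts x T e s.
Proof.
move=> e0; pose P := [set T | 0 <= T /\ exists s, cuts x T e s].
have P0 : P 0.
  split=> //; exists [::] => u v u0 uv v0 _.
  have -> : u = v by apply: le_anti; rewrite uv (le_trans v0).
  by rewrite mdistxx.
have Pdown T' T'' : 0 <= T' -> T' <= T'' -> P T'' -> P T'.
  move=> T'0 TT [_ [s sP]]; split => //; exists s => u v u0 uv vT.
  by apply: sP => //; exact: le_trans vT _.
have Pright T' : P T' -> exists2 d, 0 < d & P (T' + d).
  move=> [T0 [s sP]].
  have e20 : 0 < e / 2 by rewrite divr_gt0.
  have [d d0 xd] := path_right_close x T' e20.
  exists (d / 2); first by rewrite divr_gt0.
  split; first by rewrite addr_ge0// divr_ge0// ltW.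
  exists (T' :: s) => u v u0 uv vT H.
  have dd : d / 2 < d by rewrite ltr_pdivrMr// ltr_pMr// ltr1n.
  have [vT'|T'v] := ltP v T'.
    by apply: sP => // [|p ps]; [exact: ltW|apply: H; rewrite in_cons ps orbT].
  have := H T'; rewrite mem_head T'v andbT -leNgt => /(_ isT) T'u.
  rewrite (splitr e) (le_lt_trans (metric_triangle _ (x T') _))// ltrD//.
    rewrite metric_sym xd// (le_lt_trans uv)// (le_lt_trans vT)//.
    by rewrite ltrD2l.
  by rewrite xd// (le_lt_trans vT)// ltrD2l.
have Pleft T' : 0 < T' -> (forall T'', 0 <= T'' < T' -> P T'') -> P T'.
  move=> T0 H; split; first exact: ltW.
  have [d d0 xd] := path_left_close x T0 e0.
  pose T1 := Num.max 0 (T' - d / 2).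
  have d20 : 0 < d / 2 by rewrite divr_gt0.
  have T1T : 0 <= T1 < T'.
    by rewrite le_max lexx/= gt_max T0/= gtrBl.
  have [_ [s sP]] := H _ T1T.
  exists [:: T1, T' & s] => u v u0 uv vT Hs.
  have [vT1|T1v] := ltP v T1.
    apply: sP => // [|p ps]; [exact: ltW|apply: Hs].
    by rewrite !in_cons ps !orbT.
  have := Hs T1; rewrite mem_head T1v andbT -leNgt => /(_ isT) T1u.
  have [vT'|T'v] := ltP v T'.
    have dT1 : T' - d < T1.
      rewrite lt_max; apply/orP; right; rewrite ltrD2l ltrN2.
      by rewrite ltr_pdivrMr// ltr_pMr// ltr1n.
    apply: xd => //; [exact: lt_le_trans T1u|exact: le_lt_trans vT'|].
    exact: lt_le_trans T1v.
  have := Hs T'; rewrite in_cons mem_head orbT T'v andbT -leNgt => /(_ isT) T'u.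
  have -> : u = v.
    by apply: le_anti; rewrite uv (le_trans vT).
  by rewrite mdistxx.
suff H T' : 0 <= T' -> P T'.
  have [T0|T0] := leP 0 T; first by have [] := H _ T0.
  exists [::] => u v u0 uv vT; have := le_lt_trans (le_trans u0 uv) (le_lt_trans vT T0).
  by rewrite ltxx.
move=> T'0; apply: contrapT => nPT.
have supP : has_sup P.
  split; [by exists 0|exists T' => t Pt; rewrite leNgt; apply/negP => T't].
  by apply: nPT; apply: (Pdown _ t) => //; exact: ltW.
have S0 : 0 <= sup P by apply: sup_ubound => //; case: supP.
have PS : P (sup P).
  have [S00|S00] := eqVneq (sup P) 0; first by rewrite S00.
  apply: Pleft => [|T'' /andP[T''0 T''S]]; first by rewrite lt_neqAle eq_sym S00.
  have gap : 0 < sup P - T'' by rewrite subr_gt0.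
  have [t Pt T''t] := sup_adherent gap supP.
  apply: (Pdown _ t) => //; apply: ltW; move: T''t; by rewrite opprB addrC subrK.
have [d d0 PSd] := Pright _ PS.
have := @sup_ubound _ P (proj2 supP) _ PSd.
by rewrite leNgt ltrDl d0.
Qed.

End PathRegularity.

(** * Time changes and Skorohod neighbourhoods *)

Section TimeChange.
Context {R : realType}.
Implicit Types (t c e : R) (lam mu : R -> R).

Lemma time_change_comp lam mu :
  time_change lam -> time_change mu -> time_change (lam \o mu).
Proof.
move=> [lamI lamO] [muI muO]; split.
  move=> s t s0 st; apply: lamI; last exact: muI.
  by have : [set t | 0 <= t] (mu s) by rewrite -muO; exists s.
by rewrite -image_comp muO lamO.
Qed.

Lemma time_change_ge0 lam t : time_change lam -> 0 <= t -> 0 <= lam t.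
Proof.
by move=> [_ lamO] t0; have : [set t | 0 <= t] (lam t) by rewrite -lamO; exists t.
Qed.

Lemma time_change_le lam (s t : R) : time_change lam -> 0 <= s -> 0 <= t ->
  (lam s <= lam t) = (s <= t).
Proof.
move=> [lamI _] s0 t0; have [st|ts|->] := ltgtP s t; last exact: lexx.
- by rewrite ltW// lamI.
- by apply/negbTE; rewrite -ltNge lamI.
Qed.

Lemma time_change_inv lam : time_change lam ->
  exists mu, time_change mu /\ forall t, 0 <= t -> lam (mu t) = t.
Proof.
move=> tlam; have [lamI lamO] := tlam.
have /choice[mu muP] : forall t, exists s, 0 <= t -> 0 <= s /\ lam s = t.
  move=> t; have [t0|t0] := leP 0 t; last by exists 0.
  have : (lam @` [set t | 0 <= t]) t by rewrite lamO.
  by move=> [s s0 <-]; exists s.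
have mu0 t : 0 <= t -> 0 <= mu t by move=> /muP[].
have lmu t : 0 <= t -> lam (mu t) = t by move=> /muP[].
exists mu; split => //; split.
  move=> s t s0 st; have t0 := le_trans s0 (ltW st).
  by rewrite ltNge -(time_change_le tlam) ?mu0// !lmu// -ltNge.
apply/seteqP; split=> [_ [t t0 <-]|t t0]; first exact: mu0.
have lt0 := time_change_ge0 tlam t0.
exists (lam t) => //; apply/eqP.
have ml0 := mu0 _ lt0.
rewrite eq_le -(time_change_le tlam ml0 t0) -(time_change_le tlam t0 ml0).
by rewrite lmu// lexx.
Qed.

(** The identity plus a c-Lipschitz perturbation has slopes at least 1 - c, so
    it increases strictly to infinity; surjectivity is the intermediate value
    theorem. *)
Lemma time_change_perturb (phi : R -> R) c : 0 <= c -> c < 1 -> phi 0 = 0 ->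
  (forall s t, `|phi t - phi s| <= c * `|t - s|) ->
  time_change (fun t => t + phi t).
Proof.
move=> c0 c1 phi0 phic; split=> [s t s0 st|].
  have := phic s t; rewrite (gtr0_norm (_ : 0 < t - s)) ?subr_gt0// => h.
  have h2 : c * (t - s) < t - s by rewrite gtr_pMl// subr_gt0.
  have := le_lt_trans (ler_norm _) (le_lt_trans (_ : `|phi s - phi t| <= _) h2).
  by rewrite distrC => /(_ h); lra.
have cphi : continuous (fun t => t + phi t).
  move=> t; apply: cvgD; first exact: cvg_id.
  apply/cvgrPdist_lt => e e0; near=> u.
  rewrite (le_lt_trans (phic _ _))// (@le_lt_trans _ _ `|t - u|)//.
    by rewrite ler_piMl// ltW.
have lb t : 0 <= t -> (1 - c) * t <= t + phi t.
  move=> t0; have := phic 0 t; rewrite phi0 !subr0 (ger0_norm t0) => h.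
  have := le_trans (lerNnormlW h) (lexx _); nra.
have c10 : 0 < 1 - c by rewrite subr_gt0.
apply/seteqP; split=> [_ [t /= t0 <-]|y /= y0].
  by apply: le_trans (lb _ t0); rewrite mulr_ge0// ltW.
have b0 : 0 <= y / (1 - c) by rewrite divr_ge0// ltW.
have := @IVT _ (fun t => t + phi t) 0 (y / (1 - c)) y b0.
case.
- exact: continuous_subspaceT.
- rewrite phi0 addr0 ge_min y0/= le_max; apply/orP; right.
  by have := lb _ b0; rewrite mulrCA divff ?gt_eqF// mulr1.
- by move=> t; rewrite in_itv/= => /andP[t0 _] ty; exists t.
Unshelve. all: by end_near. Qed.

Lemma seq_gt0_lbound (s : seq R) : (forall p, p \in s -> 0 < p) ->
  exists2 d : R, 0 < d & forall p, p \in s -> d <= p.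
Proof.
elim: s => [_|p s IH sp]; first by exists 1.
have [|d d0 H] := IH; first by move=> q qs; apply: sp; rewrite in_cons qs orbT.
exists (Num.min d p); first by rewrite lt_min d0 sp ?mem_head.
move=> q; rewrite in_cons => /predU1P[->|/H]; first by rewrite ge_min lexx orbT.
by move=> dq; rewrite ge_min dq.
Qed.

Lemma norm_sum_le_size (I : eqType) (r : seq I) (F : I -> R) (K : R) :
  (forall i, i \in r -> `|F i| <= K) -> `|\sum_(i <- r) F i| <= K *+ size r.
Proof.
elim: r => [_|i r IH H]; first by rewrite big_nil normr0.
rewrite big_cons mulrS (le_trans (ler_normD _ _))// lerD//.
  by rewrite H// mem_head.
by apply: IH => j jr; rewrite H// in_cons jr orbT.
Qed.

(** The tent of height 1 and half-width r centred at p. *)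
Let bump (r p t : R) := Num.max 0 (1 - `|t - p| / r).

Let bump_le1 r p t : 0 < r -> 0 <= bump r p t <= 1.
Proof.
move=> r0; rewrite /bump le_max lexx/= ge_max ler01/=.
by rewrite gerBl// divr_ge0// ltW.
Qed.

Let bump_id r p : bump r p p = 1.
Proof. by rewrite /bump subrr normr0 mul0r subr0 max_r. Qed.

Let bump_far r p t : 0 < r -> r <= `|t - p| -> bump r p t = 0.
Proof.
move=> r0 tp; rewrite /bump max_l// subr_le0.
by rewrite ler_pdivlMr// mul1r.
Qed.

Let bump_lip r p s t : 0 < r -> `|bump r p t - bump r p s| <= `|t - s| / r.
Proof.
move=> r0; have max0 (a b : R) : `|Num.max 0 a - Num.max 0 b| <= `|a - b|.
  have h1 := ler_norm (a - b); have := ler_norm (b - a).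
  rewrite (distrC b a) ler_norml => h2.
  by case: (leP 0 a) => a0; case: (leP 0 b) => b0; apply/andP; split; lra.
rewrite (le_trans (max0 _ _))//.
rewrite (_ : _ - _ = (`|s - p| - `|t - p|) / r); last by ring.
rewrite normrM.
rewrite (@ger0_norm _ r^-1) ?invr_ge0 ?(ltW r0)//.
rewrite ler_pM2r ?invr_gt0//.
rewrite (le_trans (ler_dist_dist _ _))// opprB addrA subrK.
by rewrite distrC.
Qed.

(** Moving finitely many times by small amounts extends to a time change: add
    to the identity, at each of the given times, a tent function of the required
    height.  The tents have disjoint centres, none of which lies in the support
    of another tent, and their slopes add up to less than 1/2 when the heights
    are small compared with the gaps. *)
Lemma time_change_through (s : seq R) e : 0 < e -> (forall p, p \in s -> 0 < p) ->
  exists2 d : R, 0 < d & forall g : R -> R,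
    (forall p, p \in s -> `|g p - p| < d) ->
    exists2 lam, time_change lam &
      (forall t, `|lam t - t| < e) /\ (forall p, p \in s -> lam p = g p).
Proof.
move=> e0 s0.
pose gaps := [seq x <- [seq `|p - q| | p <- s, q <- s] | 0 < x].
have [p|r r0 rP] := @seq_gt0_lbound (s ++ gaps).
  by rewrite mem_cat => /orP[/s0//|]; rewrite mem_filter => /andP[].
have rs p : p \in s -> r <= p by move=> ps; apply: rP; rewrite mem_cat ps.
have rg p q : p \in s -> q \in s -> p != q -> r <= `|p - q|.
  move=> ps qs pq; apply: rP; rewrite mem_cat mem_filter normr_gt0 subr_eq0 pq/=.
  by apply/orP; right; apply/allpairsP; exists (p, q).
pose N : R := (size (undup s)).+1%:R.
have N0 : 0 < N by rewrite ltr0n.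
exists (Num.min (r / (2 * N)) (e / N)).
  by rewrite lt_min !divr_gt0// mulr_gt0.
set d := Num.min _ _ => g gd.
have d0 : 0 < d by rewrite lt_min !divr_gt0// mulr_gt0.
pose phi t := \sum_(p <- undup s) (g p - p) * bump r p t.
have phip p : p \in s -> phi p = g p - p.
  move=> ps; rewrite /phi (bigD1_seq p) ?mem_undup ?undup_uniq//=.
  rewrite bump_id mulr1 big_seq_cond big1 ?addr0// => q /andP[].
  rewrite mem_undup => qs qp.
  by rewrite bump_far ?mulr0// rg// eq_sym.
have phi_lip u t : `|phi t - phi u| <= 1/2 * `|t - u|.
  rewrite /phi -sumrB.
  apply: (le_trans (@norm_sum_le_size _ _ _ (d * (`|t - u| / r)) _)).
    move=> p; rewrite mem_undup => ps; rewrite -mulrBr normrM.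
    by rewrite ler_pM// ?bump_lip// ltW// gd.
  rewrite -[leLHS]mulr_natr [leLHS](_ : _ = d * (size (undup s))%:R / r * `|t - u|); last by ring.
  rewrite ler_wpM2r//.
  apply: (@le_trans _ _ ((r / (2 * N)) * N / r)).
    rewrite ler_pM2r ?invr_gt0// ler_pM// ?(ltW d0)//.
      by rewrite ge_min lexx.
    by rewrite ler_nat.
  rewrite le_eqVlt; apply/orP; left; apply/eqP; field.
  by rewrite !gt_eqF.
exists (fun t => t + phi t).
  apply: (@time_change_perturb phi (1/2)) => //; first lra.
  rewrite /phi big_seq big1// => p; rewrite mem_undup => ps.
  by rewrite bump_far ?mulr0// sub0r normrN gtr0_norm ?rs// s0.
split=> [t|p ps]; last by rewrite phip// addrC subrK.
rewrite addrC addKr.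
apply: (le_lt_trans (@norm_sum_le_size _ _ _ d _)).
  move=> p; rewrite mem_undup => ps; rewrite normrM -[leRHS]mulr1.
  have /andP[b0 b1] := bump_le1 p t r0.
  by rewrite ler_pM// ?(ltW (gd _ ps))// ger0_norm.
apply: (@lt_le_trans _ _ (d * N)).
  by rewrite -[ltLHS]mulr_natr ltr_pM2l// ltr_nat.
by rewrite -ler_pdivlMr// ge_min lexx orbT.
Qed.

End TimeChange.

Section SkorohodNbhd.
Context {R : realType} {E : completeMetricType R}.
Implicit Types (x y z : skorohod E) (t T e : R).

(** Inverting the time change loses at most e at the end of the time window. *)
Lemma skorohod_nbhd_sym x y T e : 0 < e -> skorohod_nbhd x (T + e) e y ->
  skorohod_nbhd y T e x.
Proof.
move=> e0 [lam tlam H]; have [mu [tmu lmu]] := time_change_inv tlam.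
exists mu => // u /andP[u0 uT].
have mu0 := time_change_ge0 tmu u0.
have muT : mu u <= T + e.
  have Te0 : 0 <= T + e by rewrite addr_ge0 ?(ltW e0)// (le_trans u0).
  rewrite -(time_change_le tlam)// lmu// (le_trans uT)//.
  have [|h _] := H (T + e); first by rewrite Te0 lexx.
  by move: h; rewrite ltr_norml => /andP[h _]; lra.
have [|h1 h2] := H (mu u); first by rewrite mu0.
rewrite lmu// in h1 h2.
by split; [rewrite distrC|rewrite metric_sym].
Qed.

Lemma skorohod_nbhd_trans x y z T e e' : skorohod_nbhd x (T + e') e y ->
  skorohod_nbhd y T e' z -> skorohod_nbhd x T (e + e') z.
Proof.
move=> [lam tlam H] [mu tmu K]; exists (lam \o mu).
  exact: time_change_comp.
move=> t tT; have [h1 h2] := K _ tT; move/andP : tT => [t0 tT].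
have [|h3 h4] := H (mu t).
  rewrite time_change_ge0//=; move: h1; rewrite ltr_norml => /andP[_ h]; lra.
split=> /=.
  rewrite -(subrK (mu t) (lam _)) -addrA (le_lt_trans (ler_normD _ _))// ltrD//.
by rewrite (le_lt_trans (metric_triangle _ (y (mu t)) _))// addrC ltrD.
Qed.

End SkorohodNbhd.

(** * Coordinates generate the Borel sets of the Skorohod space *)

Lemma open_mdist_ball (R : realType) (E : completeMetricType R) (a : E) (r : R) :
  open [set e | mdist a e < r].
Proof.
rewrite openE => e /= aer; apply/nbhs_ballP; exists (r - mdist a e) => /=.
  by rewrite subr_gt0.
move=> b; rewrite ballEmdist/= ltrBrDl; apply: le_lt_trans.
exact: metric_triangle.
Qed.

Lemma truncnS_gt_le (R : realType) (c : R) (m : nat) :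
  (Num.truncn c <= m)%N -> c < m.+1%:R.
Proof. by move=> cm; rewrite (lt_le_trans (truncnS_gt c))// ler_nat. Qed.

Section GridPath.
Context {R : realType} {E : completeMetricType R}.
Implicit Types (x y z : skorohod E) (t T e : R) (m n k : nat) (a : nat -> E).


Lemma truncn_near_right (c : R) : 0 <= c ->
  exists2 d : R, 0 < d & forall s, c <= s -> s < c + d -> Num.truncn s = Num.truncn c.
Proof.
move=> c0; have /andP[c1 c2] := truncn_itv c0.
exists ((Num.truncn c).+1%:R - c); first by rewrite subr_gt0.
move=> s cs; rewrite addrC subrK => sc; apply: truncn_def.
by rewrite sc (le_trans c1).
Qed.

Lemma truncn_near_left (c : R) : 0 < c ->
  exists2 d : R, 0 < d & exists k, forall s, c - d < s -> s < c -> Num.truncn s = k.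
Proof.
move=> c0; have /andP[c1 c2] := truncn_itv (ltW c0).
have [c3|c3] := ltP (Num.truncn c)%:R c.
  exists (c - (Num.truncn c)%:R); first by rewrite subr_gt0.
  exists (Num.truncn c) => s; rewrite opprB addrC subrK => cs sc.
  by apply: truncn_def; rewrite ltW//= (lt_trans sc).
have cE : c = (Num.truncn c)%:R by apply: le_anti; rewrite c1 c3.
exists 1 => //; exists (Num.truncn c).-1 => s cs sc.
have tc : (0 < Num.truncn c)%N by rewrite -(ltr_nat R) -cE.
apply: truncn_def; rewrite prednK// -cE sc andbT ltW// (le_lt_trans _ cs)//.
by rewrite {2}cE -subn1 natrB.
Qed.

(** The step path with mesh 1 / (m + 1) and values a, frozen after step n: it is
    determined by finitely many values. *)
Definition grid_path m n a t := a (minn (Num.truncn (m.+1%:R * t)) n).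

Lemma grid_path_right_continuous m n a t : 0 <= t ->
  grid_path m n a s @[s --> t^'+] --> grid_path m n a t.
Proof.
move=> t0; have [|d d0 H] := @truncn_near_right (m.+1%:R * t).
  by rewrite mulr_ge0.
apply: cvg_near_cst; near=> s; rewrite /grid_path H//.
  rewrite ler_pM2l//; near: s; exact: nbhs_right_ge.
rewrite -ltrBlDl -mulrBr mulrC -ltr_pdivlMr// ltrBlDl.
by near: s; apply: nbhs_right_lt; rewrite ltrDl divr_gt0.
Unshelve. all: by end_near. Qed.

Lemma grid_path_left_limit m n a t : 0 < t ->
  cvg (grid_path m n a s @[s --> t^'-]).
Proof.
move=> t0; have [|d d0 [k H]] := @truncn_near_left (m.+1%:R * t).
  by rewrite mulr_gt0.
apply: (cvgP (a (minn k n))).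
apply: cvg_near_cst; near=> s; rewrite /grid_path H//.
  rewrite ltrBlDr -ltrBlDl -mulrBr mulrC -ltr_pdivlMr// ltrBlDl -ltrBlDr.
  by near: s; apply: nbhs_left_gt; rewrite ltrBlDr ltrDl divr_gt0.
by rewrite ltr_pM2l//; near: s; exact: nbhs_left_lt.
Unshelve. all: by end_near. Qed.

Lemma grid_path_neg m n a t : t < 0 -> grid_path m n a t = grid_path m n a 0.
Proof.
move=> t0; rewrite /grid_path mulr0 truncn0.
suff -> : Num.truncn (m.+1%:R * t) = 0%N by [].
apply/truncn0Pn; rewrite -ltNge; apply: le_lt_trans ltr01.
by rewrite mulr_ge0_le0// ltW.
Qed.

Definition grid m n a : skorohod E :=
  Skorohod (@grid_path_right_continuous m n a) (@grid_path_left_limit m n a)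
    (@grid_path_neg m n a).

Variable dseq : nat -> E.
Hypothesis dseq_dense : forall (e : E) (r : R), 0 < r -> exists n, mdist (dseq n) e < r.

Let near_exists m (e : E) : exists n, mdist (dseq n) e < m.+1%:R^-1.
Proof. by apply: dseq_dense; rewrite invr_gt0. Qed.

Definition near_index m (e : E) : nat := ex_minn (near_exists m e).

Lemma near_indexP m (e : E) : mdist (dseq (near_index m e)) e < m.+1%:R^-1.
Proof. by rewrite /near_index; case: ex_minnP. Qed.

Lemma near_index_measurable m n :
  measurable ([set b | near_index m b = n] : set (borel E)).
Proof.
pose B k : set (borel E) := [set b | mdist (dseq k) b < m.+1%:R^-1].
have mB k : measurable (B k).
  by apply: sub_sigma_algebra; exact: open_mdist_ball.
suff -> : [set b | near_index m b = n] = B n `&` \bigcap_(k in `I_n) ~` B k.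
  apply: measurableI => //; apply: bigcap_measurableType => k _.
  exact: measurableC.
apply/seteqP; split=> e /=; rewrite /near_index; case: ex_minnP => k Bk kmin.
  move=> <-; split => // j /= jk Bj.
  by have := kmin _ Bj; rewrite leqNgt jk.
move=> [Bn nB]; apply/eqP; rewrite eqn_leq kmin//= leqNgt; apply/negP => kn.
exact: (nB k).
Qed.

(** The m-th approximation of a path reads its positions at the times
    k / (m + 1), up to the time m + 1, and rounds each of them to a nearby term of
    the dense sequence.  Coding it by the indices of these terms shows that it
    takes countably many values. *)
Definition approx_code m x : seq nat :=
  [seq near_index m (x (k%:R / m.+1%:R)) | k <- iota 0 (m.+1 ^ 2).+1].

Definition approx_decode m (s : seq nat) : skorohod E :=
  grid m (m.+1 ^ 2) (fun k => dseq (nth 0%N s k)).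

Definition approx m x := approx_decode m (approx_code m x).

Lemma approxE m x t : (Num.truncn (m.+1%:R * t) <= m.+1 ^ 2)%N ->
  approx m x t =
  dseq (near_index m (x ((Num.truncn (m.+1%:R * t))%:R / m.+1%:R))).
Proof.
move=> km; rewrite /approx /= /grid_path (minn_idPl km).
by rewrite (nth_map 0%N) ?size_iota ?ltnS// nth_iota.
Qed.

(** Cut [0, T + 1] so that x oscillates little between cutting times.  A time
    change that moves each cutting time to the next point of the grid makes the
    grid value read at time lam t come from the same piece as x t. *)
Lemma approx_nbhd x T e : 0 < e -> exists M, forall m, (M <= m)%N ->
  skorohod_nbhd (approx m x) T e x.
Proof.
move=> e0; have e20 : 0 < e / 2 by rewrite divr_gt0.
have [s sP] := cuts_exist x (T + 1) e20.
have [||d d0 dP] := @time_change_through _ [seq p <- s | 0 < p] (Num.min e 1).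
- by rewrite lt_min e0/=.
- by move=> p; rewrite mem_filter => /andP[].
pose L := Num.max (T + 1) (Num.max (2 / e) (1 / d)).
exists (Num.truncn L) => m /truncnS_gt_le.
rewrite gt_max gt_max => /andP[mT /andP[me md]].
have m0 : 0 < m.+1%:R :> R by rewrite ltr0n.
have minv_e : m.+1%:R^-1 < e / 2.
  by rewrite invf_plt ?posrE// invf_div.
have minv_d : m.+1%:R^-1 < d.
  by rewrite invf_plt ?posrE// -div1r.
have /choice[c cP] : forall p : R, exists n : nat, 0 <= p ->
    m.+1%:R * p <= n%:R /\ n%:R < m.+1%:R * p + 1.
  move=> p; have [p0|p0] := leP 0 p; last by exists 0%N.
  have /andP[q1 q2] : (Num.truncn (m.+1%:R * p))%:R <= m.+1%:R * p
       < (Num.truncn (m.+1%:R * p)).+1%:R.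
    by apply: truncn_itv; rewrite mulr_ge0// ltW.
  have [q3|q3] := leP (m.+1%:R * p) (Num.truncn (m.+1%:R * p))%:R.
    by exists (Num.truncn (m.+1%:R * p)) => _; split=> //; lra.
  exists (Num.truncn (m.+1%:R * p)).+1 => _; split; first exact: ltW.
  by rewrite -addn1 natrD ltrD2r.
have [p|lam tlam [lam1 lam2]] := dP (fun p => (c p)%:R / m.+1%:R).
  rewrite mem_filter => /andP[p0 _]; have [c1 c2] := cP _ (ltW p0).
  rewrite ger0_norm.
    rewrite (lt_le_trans _ (ltW minv_d))//.
    by rewrite ltrBlDl ltr_pdivrMr// mulrDl mulVf ?gt_eqF// mulrC.
  by rewrite subr_ge0 ler_pdivlMr// mulrC.
exists lam => // t /andP[t0 tT]; split.
  by rewrite (lt_le_trans (lam1 _))// ge_min lexx.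
have lt0 := time_change_ge0 tlam t0.
have ltT : lam t < T + 1.
  have := lam1 t; rewrite lt_min => /andP[_]; rewrite ltr_norml => /andP[_].
  by rewrite ltrBlDr => /lt_le_trans; apply; rewrite addrC lerD2r.
set k := Num.truncn (m.+1%:R * lam t).
have /andP[k1 k2] : k%:R <= m.+1%:R * lam t < k.+1%:R.
  by apply: truncn_itv; rewrite mulr_ge0// ltW.
have km : (k <= m.+1 ^ 2)%N.
  rewrite -(ler_nat R) (le_trans k1)// natrX expr2 ler_pM2l//.
  by rewrite ltW// (lt_trans ltT).
rewrite approxE// -/k (splitr e).
apply: (le_lt_trans (metric_triangle _ (x (k%:R / m.+1%:R)) _)).
rewrite ltrD//; last first.
  by rewrite metric_sym (lt_le_trans (near_indexP _ _))// ltW.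
have kv0 : 0 <= k%:R / m.+1%:R :> R by rewrite divr_ge0// ltW.
have kvT : k%:R / m.+1%:R < T + 1.
  by rewrite (le_lt_trans _ ltT)// ler_pdivrMr// mulrC.
have lamp p : 0 < p -> p \in s -> lam p = (c p)%:R / m.+1%:R.
  by move=> p0 ps; apply: lam2; rewrite mem_filter p0.
(* In both cases a cutting time between t and the grid point below lam t would
   contradict that lam maps it to the first grid point to its right. *)
have [tk|kt] := leP t (k%:R / m.+1%:R).
  apply: sP => // [|p ps]; first exact: ltW.
  apply/negP => /andP[tp pk]; have p0 := le_lt_trans t0 tp.
  have [_ c2] := cP p (ltW p0).
  have : lam t < lam p by case: tlam => + _; apply.
  rewrite (lamp p)// ltr_pdivlMr// mulrC => h.
  have : (k < c p)%N by rewrite -(ltr_nat R) (le_lt_trans k1).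
  rewrite -(ler_nat R) => h2; have := le_lt_trans h2 c2.
  rewrite -addn1 natrD ltrD2r mulrC -ltr_pdivrMr// ltNge.
  by rewrite pk.
rewrite metric_sym; apply: sP => // [||p ps]; first exact: ltW.
  by rewrite (le_trans tT)// lerDl.
apply/negP => /andP[kp pt]; have p0 := le_lt_trans kv0 kp.
have [c1 _] := cP p (ltW p0).
have : lam p <= lam t by rewrite (time_change_le tlam)// ltW.
rewrite (lamp p)// ler_pdivrMr// mulrC => h.
have : (c p <= k)%N by rewrite truncn_ge_nat// mulr_ge0// ltW.
rewrite -(ler_nat R) => h2; have := le_trans c1 h2.
by rewrite mulrC -ler_pdivlMr// leNgt kp.
Qed.

(** Membership in an open set is read off the approximations, with a margin: a
    path is in U when the neighbourhoods of fixed size of its late approximations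
    are inside U. *)
Lemma open_approx (U : set (skorohod E)) : open U ->
  U = \bigcup_n \bigcup_M \bigcap_(m in [set m | (M <= m)%N])
    [set x | skorohod_nbhd (approx m x) n%:R n.+1%:R^-1 `<=` U].
Proof.
move=> oU; apply/seteqP; split=> x.
  move=> /oU[T [e e0 TeU]].
  have e20 : 0 < e / 2 by rewrite divr_gt0.
  pose n := Num.truncn (Num.max T (2 / e)).
  have /truncnS_gt_le : (n <= n)%N by [].
  rewrite gt_max => /andP[nT ne].
  have en : n.+2%:R^-1 < e / 2.
    rewrite (@lt_trans _ _ n.+1%:R^-1)//.
      by rewrite ltf_pV2 ?posrE// ltr_nat.
    by rewrite invf_plt ?posrE// invf_div.
  have [M MP] := approx_nbhd x (n.+1%:R + n.+2%:R^-1 + e / 2) e20.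
  exists n.+1 => //; exists M => // m /= Mm z nz; apply: TeU.
  have := skorohod_nbhd_trans (skorohod_nbhd_sym e20 (MP _ Mm)) nz.
  by apply: skorohod_nbhdS; [exact: ltW|rewrite {2}(splitr e) lerD2l ltW].
move=> [n _ [M _ H]].
have [|N NP] := @approx_nbhd x n%:R n.+1%:R^-1; first by rewrite invr_gt0.
by apply: (H (maxn M N)) => /=; [exact: leq_maxl|apply: NP; exact: leq_maxr].
Qed.

Lemma map_eq_measurable d (Om : measurableType d) (I : Type) (f : I -> Om -> nat)
    (r : seq I) (s : seq nat) :
  (forall i n, measurable [set w | f i w = n]) ->
  measurable [set w | [seq f i w | i <- r] = s].
Proof.
move=> mf; elim: r s => [|i r IH] [|n s] /=.
- by rewrite (_ : [set _ | _] = setT)//; apply/seteqP; split.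
- by rewrite (_ : [set _ | _] = set0)//; apply/seteqP; split.
- by rewrite (_ : [set _ | _] = set0)//; apply/seteqP; split.
- rewrite (_ : [set _ | _] = [set w | f i w = n] `&`
      [set w | [seq f j w | j <- r] = s]); first exact: measurableI.
  by apply/seteqP; split => w /= [-> ->].
Qed.

(** By [open_approx], it is enough to measure the sets where an approximation
    satisfies a given property, and these are countable unions of sets that
    prescribe the codes, whatever the property is. *)
Lemma measurable_path_dense d (Om : measurableType d) (X : Om -> borel (skorohod E)) :
  (forall t, 0 <= t -> measurable_fun setT (fun w => X w t : borel E)) ->
  measurable_fun setT X.
Proof.
move=> mX; apply: (@measurability _ _ Om (borel (skorohod E)) setT X (@open (skorohod E))) => //.
move=> _ [U oU <-]; rewrite setTI (open_approx oU).
rewrite preimage_bigcup; apply: bigcupT_measurable => n.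
rewrite preimage_bigcup; apply: bigcupT_measurable => M.
rewrite preimage_bigcap; apply: bigcap_measurableType => m _.
set V := fun y => skorohod_nbhd y n%:R n.+1%:R^-1 `<=` U.
rewrite (_ : _ @^-1` _ = \bigcup_(s : seq nat)
    ([set w | approx_code m (X w) = s] `&` [set w | V (approx_decode m s)])).
  apply: countable_bigcupT_measurable => // s.
  have [Vs|Vs] := pselect (V (approx_decode m s)); last first.
    rewrite (_ : [set _ | V _] = set0) ?setI0//.
    by apply/seteqP; split.
  rewrite (_ : [set _ | V _] = setT) ?setIT//; last by apply/seteqP; split.
  apply: map_eq_measurable => k j.
  have := mX (k%:R / m.+1%:R); rewrite divr_ge0// => /(_ isT measurableT).
  by move=> /(_ _ (near_index_measurable m j)); rewrite setTI.
apply/seteqP; split => w /=.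
  by move=> h; exists (approx_code m (X w)).
by move=> [s _ [<-]].
Qed.

End GridPath.

Lemma separable_dense_seq (R : realType) (E : completeMetricType R) :
  separable E ->
  exists u : nat -> E, forall (e : E) (r : R), 0 < r -> exists n, mdist (u n) e < r.
Proof.
move=> [S /countable_injP[f finj] dS].
exists (fun n => xget point [set e | S e /\ f e = n]) => e r r0.
have [b [/= eb Sb]] : [set b | mdist e b < r] `&` S !=set0.
  apply: dS; first by exists e => /=; rewrite mdistxx.
  exact: open_mdist_ball.
exists (f b).
case: xgetP => [c _ [Sc fc]|/(_ b)[]//].
by rewrite (finj _ _ _ _ fc) ?inE// metric_sym.
Qed.

Lemma measurable_path (R : realType) (E : completeMetricType R) d
    (Om : measurableType d) (X : Om -> borel (skorohod E)) : separable E ->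
  (forall t, 0 <= t -> measurable_fun setT (fun w => X w t : borel E)) ->
  measurable_fun setT X.
Proof.
move=> /separable_dense_seq[u u_dense]; exact: (measurable_path_dense u_dense).
Qed.

(** * Borel measurability in metric spaces *)

Section BorelMeasurability.

Lemma open_borel (T : ptopologicalType) (U : set T) : open U ->
  measurable (U : set (borel T)).
Proof. by move=> oU; exact: sub_sigma_algebra. Qed.

Lemma closed_borel (T : ptopologicalType) (C : set T) : closed C ->
  measurable (C : set (borel T)).
Proof.
move=> cC; rewrite -(setCK C); apply: measurableC.
by apply: open_borel; exact: closed_openC.
Qed.

Lemma continuous_borel (R : realType) (T : ptopologicalType) (f : T -> R) :
  continuous f -> measurable_fun setT (f : borel T -> R).
Proof.
move=> /continuousP cf; apply: (measurability _ (measurable_realfun.RGenOpens.measurableE R)).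
by move=> _ [_ [a [b ->] <-]]; rewrite setTI; apply: open_borel; exact: cf.
Qed.

(** The limit is in an open set U exactly when, for some k, the sequence is
    eventually at distance at least 1 / (k + 1) from the complement of U. *)
Lemma measurable_limit (R : realType) (E : completeMetricType R) d
    (T : measurableType d) (f_ : nat -> T -> borel E) (f : T -> borel E) :
  (forall n, measurable_fun setT (f_ n)) ->
  (forall w (e : R), 0 < e -> exists N, forall n, (N <= n)%N ->
    mdist (f w : E) (f_ n w : E) < e) ->
  measurable_fun setT f.
Proof.
move=> mf_ f_f; apply: (@measurability _ _ T (borel E) setT f (@open E)) => //.
move=> _ [U oU <-]; rewrite setTI.
pose V k : set E := [set a | forall b, mdist a b < k.+1%:R^-1 -> U b].
have mV k : measurable (V k : set (borel E)).
  apply: closed_borel.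
  rewrite (_ : V k = ~` \bigcup_(b in ~` U) [set a | mdist b a < k.+1%:R^-1]).
    apply: open_closedC; apply: bigcup_open => b _; exact: open_mdist_ball.
  apply/seteqP; split=> a /=.
    by move=> Va [b Ub /= ba]; apply: Ub; apply: Va; rewrite metric_sym.
  move=> nVa b ab; apply: contrapT => Ub; apply: nVa.
  by exists b => //=; rewrite metric_sym.
rewrite (_ : f @^-1` U = \bigcup_k \bigcup_N \bigcap_(n in [set n | (N <= n)%N])
    (f_ n @^-1` V k)).
  apply: bigcupT_measurable => k; apply: bigcupT_measurable => N.
  apply: bigcap_measurableType => n _; rewrite -[X in measurable X]setTI.
  exact: mf_.
apply/seteqP; split=> w /=; last first.
  move=> [k _ [N _ H]]; have [|M MP] := f_f w k.+1%:R^-1.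
    by rewrite invr_gt0.
  apply: (H (maxn N M)) => /=; first exact: leq_maxl.
  by rewrite metric_sym MP// leq_maxr.
move=> Uf; have /nbhs_ballP[e /= e0] : nbhs (f w : E) U by apply: open_nbhs_nbhs.
rewrite ballEmdist => eU.
have e20 : 0 < e / 2 by rewrite divr_gt0.
have [N NP] := f_f w _ e20.
exists (Num.truncn (2 / e)) => //; exists N => // n /NP fn b fb; apply: eU => /=.
apply: le_lt_trans (metric_triangle _ (f_ n w) _) _.
rewrite (splitr e) ltrD// (lt_trans fb)//.
by rewrite invf_plt ?posrE// invf_div truncnS_gt.
Qed.

(** Right continuity makes (w, t) |-> X w t the limit of X w at the next point
    of finer and finer grids, which is measurable piece by piece. *)
Lemma measurable_joint (R : realType) (E : completeMetricType R) d
    (Om : measurableType d) (X : Om -> skorohod E) :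
  (forall t, 0 <= t -> measurable_fun setT (fun w => X w t : borel E)) ->
  measurable_fun [set: Om * measurableTypeR R] (fun z => X z.1 z.2 : borel E).
Proof.
move=> mX.
pose s (n : nat) (t : R) : R := (Num.truncn (n.+1%:R * t)).+1%:R / n.+1%:R.
apply: (@measurable_limit R E _ (Om * measurableTypeR R)%type
  (fun n z => X z.1 (s n z.2)) (fun z => X z.1 z.2)).
  move=> n _ B mB; rewrite setTI.
  rewrite (_ : _ @^-1` B = \bigcup_k
     ((fun w => X w (k.+1%:R / n.+1%:R)) @^-1` B `*`
      [set t : R | Num.truncn (n.+1%:R * t) = k])).
    apply: bigcupT_measurable => k; apply: measurableX.
      by rewrite -[X in measurable X]setTI; apply: mX => //; rewrite divr_ge0.
    have -> : [set t : R | Num.truncn (n.+1%:R * t) = k] =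
        if k is 0 then `]-oo, n.+1%:R^-1[%classic
        else `[k%:R / n.+1%:R, k.+1%:R / n.+1%:R[%classic.
      apply/seteqP; split=> t /=.
        move=> tk; have [t0|t0] := leP 0 (n.+1%:R * t).
          have /andP[] := truncn_itv t0; rewrite tk.
          case: k tk => [|k] tk h1 h2 /=; rewrite in_itv/=.
            by rewrite -div1r ltr_pdivlMr// mulrC.
          by rewrite ler_pdivrMr// ltr_pdivlMr// mulrC h1.
        have k0 : k = 0%N.
          rewrite -tk; apply/truncn0Pn; rewrite -ltNge.
          exact: lt_trans t0 ltr01.
        rewrite k0/= in_itv/= (@lt_trans _ _ 0)//.
        by move: t0; rewrite pmulr_rlt0.
      case: k => [|k] /=; rewrite in_itv/=.
        rewrite -div1r ltr_pdivlMr// mulrC => t1.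
        by apply/truncn0Pn; rewrite -ltNge.
      rewrite ler_pdivrMr// ltr_pdivlMr// mulrC => h.
      exact: truncn_def.
    by case: k => [|k]; exact: measurable_itv.
  apply/seteqP; split => -[w t] /=; first by exists (Num.truncn (n.+1%:R * t)).
  by move=> [k _ [/= Bw tk]]; rewrite /s tk.
move=> [w t] e e0 /=.
wlog t0 : t / 0 <= t.
  have [|t0 H] := leP 0 t; first by move=> t0; apply.
  have [N NP] := H 0 (lexx _); exists N => n /NP.
  rewrite (skorohod_neg _ t0); suff -> : s n t = s n 0 by [].
  rewrite /s mulr0 truncn0 (_ : Num.truncn _ = 0%N)//.
  apply/truncn0Pn; rewrite -ltNge (le_lt_trans _ ltr01)//.
  by rewrite mulr_ge0_le0// ltW.
have [d0 d00 H] := path_right_close (X w) t e0.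
exists (Num.truncn d0^-1) => n /truncnS_gt_le nd.
have n0 : 0 < n.+1%:R :> R by [].
have /andP[h1 h2] := truncn_itv (mulr_ge0 (ltW n0) t0).
apply: H.
  by rewrite ltW// ltr_pdivlMr// mulrC.
rewrite ltr_pdivrMr// mulrDl (mulrC t) -addn1 natrD ler_ltD//.
by rewrite mulrC -ltr_pdivrMr// div1r.
Qed.

Lemma measurable_trajectory (R : realType) (E : completeMetricType R)
    (x : skorohod E) :
  measurable_fun [set: measurableTypeR R] (x : _ -> borel E).
Proof.
have mx := @measurable_joint R E _ unit (fun=> x) (fun _ _ => measurable_cst _).
exact: (measurableT_comp mx (pair1_measurable tt)).
Qed.

End BorelMeasurability.

(** * Bounded integrands, image laws, translations *)

Section BoundedIntegrals.
Context {R : realType}.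

Lemma bounded_fun_leP (T : Type) (f : T -> R) :
  bounded_fun f <-> exists2 M, 0 <= M & forall x, `|f x| <= M.
Proof.
split=> [[M [_ H]]|[M M0 H]].
  exists (`|M| + 1) => [|x]; first by rewrite addr_ge0.
  by apply: H => //; rewrite (le_lt_trans (ler_norm _))// ltrDl.
exists M; split; first exact: num_real.
by move=> N MN x _ /=; rewrite (le_trans (H x))// ltW.
Qed.

Context d (T : measurableType d).
Implicit Types (P : probability T R) (f : T -> R).

Lemma bounded_integrable P f M D : measurable D -> measurable_fun setT f ->
  (forall w, `|f w| <= M) -> P.-integrable D (EFin \o f).
Proof.
move=> mD mf fM; apply: measurable_bounded_integrable => //.
- by rewrite (le_lt_trans (probability_le1 P mD))// ltry.
- exact: measurable_funTS.
- exists M; split; first exact: num_real.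
  by move=> N MN w _ /=; rewrite (le_trans (fM w))// ltW.
Qed.

Lemma Rintegral_dominated (mu : {measure set T -> \bar R}) (D : set T)
    (f_ : nat -> T -> R) (f g : T -> R) :
  measurable D -> (forall n, measurable_fun D (f_ n)) -> measurable_fun D f ->
  {ae mu, forall w, D w -> f_ n w @[n --> \oo] --> f w} ->
  mu.-integrable D (EFin \o g) ->
  (forall n w, D w -> `|f_ n w| <= g w) ->
  (\int[mu]_(w in D) f_ n w)%R @[n --> \oo] --> (\int[mu]_(w in D) f w)%R.
Proof.
move=> mD mf_ mf f_f ig f_g.
have [//|||||intf _ H] := @dominated_convergence _ T R mu D mD
  (fun n => EFin \o f_ n) (EFin \o f) (EFin \o g).
- by move=> n; apply/measurable_EFinP.
- exact/measurable_EFinP.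
- apply: filterS f_f => w H /H fw; apply/fine_cvgP; split => //; exact: nearW.
- by [].
- by apply: aeW => w n Dw; rewrite /= lee_fin; exact: f_g.
apply: fine_cvg; rewrite fineK//; exact: integrable_fin_num.
Qed.

Lemma Rintegral_bounded_cvg P (f_ : nat -> T -> R) f M :
  (forall n, measurable_fun setT (f_ n)) -> measurable_fun setT f ->
  (forall w, f_ n w @[n --> \oo] --> f w) ->
  (forall n w, `|f_ n w| <= M) ->
  (\int[P]_w f_ n w)%R @[n --> \oo] --> (\int[P]_w f w)%R.
Proof.
move=> mf_ mf f_f f_M; apply: (@Rintegral_dominated P setT f_ f (fun=> M)) => //.
- by apply: aeW => w _.
- by apply: (@bounded_integrable _ _ `|M|).
Qed.

Lemma prob_Rintegral_cst P c : (\int[P]_w c)%R = c.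
Proof. by rewrite Rintegral_cst//= probability_setT mulr1. Qed.

Lemma norm_Rintegral_le P f M : measurable_fun setT f ->
  (forall w, `|f w| <= M) -> `|\int[P]_w f w|%R <= M.
Proof.
move=> mf fM.
have mP : P.-integrable setT (EFin \o f) by apply: bounded_integrable fM.
rewrite (le_trans (le_normr_Rintegral measurableT mP))//.
rewrite -[leRHS](prob_Rintegral_cst P) le_Rintegral//.
- apply: (@bounded_integrable _ _ M) => //; first exact: measurableT_comp.
  by move=> w; rewrite normr_id.
- by apply: (@bounded_integrable _ _ `|M|).
Qed.

End BoundedIntegrals.


Section ImageLaw.
Context {R : realType} d d' (Om : measurableType d) (T : measurableType d').
Variables (m : {measure set Om -> \bar R}) (X : Om -> T).
Hypothesis mX : measurable_fun setT X.

(** A pushforward that carries the proof of measurability, so that the measure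
    structure can be inferred. *)
Definition image_measure of measurable_fun setT X := pushforward m X.

Let im0 : image_measure mX set0 = 0%E.
Proof. by rewrite /image_measure /pushforward preimage_set0 measure0. Qed.

Let im_ge0 B : (0 <= image_measure mX B)%E.
Proof. exact: measure_ge0. Qed.

Let im_sigma_additive : semi_sigma_additive (image_measure mX).
Proof.
move=> F mF tF mUF; rewrite /image_measure /pushforward preimage_bigcup.
apply: measure_semi_sigma_additive.
- by move=> n; rewrite -[X in measurable X]setTI; exact: mX.
- apply/trivIsetP => /= i j _ _ ij; rewrite -preimage_setI.
  by move/trivIsetP : tF => /(_ _ _ _ _ ij) ->//; rewrite preimage_set0.
- by rewrite -preimage_bigcup -[X in measurable X]setTI; exact: mX.
Qed.

HB.instance Definition _ := isMeasure.Build _ _ _ (image_measure mX)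
  im0 im_ge0 im_sigma_additive.
End ImageLaw.

Section Law.
Context {R : realType} d d' (Om : measurableType d) (T : measurableType d').
Variables (P : probability Om R) (X : Om -> T).

Definition law (mX : measurable_fun setT X) := image_measure P mX.

Hypothesis mX : measurable_fun setT X.

HB.instance Definition _ := Measure.on (law mX).

Let law_setT : law mX setT = 1%E.
Proof.
rewrite /law /image_measure /pushforward/= preimage_setT.
exact: probability_setT.
Qed.

HB.instance Definition _ :=
  @Measure_isProbability.Build _ _ R (law mX) law_setT.

Lemma Rintegral_law (f : T -> R) : measurable_fun setT f ->
  P.-integrable setT (EFin \o (f \o X)) ->
  (\int[law mX]_x f x)%R = (\int[P]_w f (X w))%R.
Proof.
move=> mf intf; rewrite /Rintegral.
rewrite (integral_pushforward mX) => //; exact/measurable_EFinP.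
Qed.

End Law.

Section LebesgueShift.
Context {R : realType}.
Local Notation leb := (@lebesgue_measure R).

Lemma lebesgue_shift (e : R) (A : set (measurableTypeR R)) : measurable A ->
  pushforward leb (fun t : measurableTypeR R => e + t : measurableTypeR R) A
  = leb A.
Proof.
move=> mA; have me : measurable_fun [set: measurableTypeR R]
    (fun t : measurableTypeR R => e + t : measurableTypeR R).
  exact: measurable_funD.
rewrite -[LHS]/(image_measure leb me A); apply/esym.
apply: lebesgue_measure_unique => // _ [[a b] _ <-].
rewrite /image_measure /pushforward/=.
rewrite (_ : _ @^-1` _ = `]a - e, b - e]%classic).
  rewrite !lebesgue_measure_itv/= !lte_fin ltrD2r.
  by case: ifPn => // _; rewrite -!EFinB opprB addrA subrK.
by apply/seteqP; split => t /=; rewrite !in_itv/= ltrBlDl lerBrDl.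
Qed.

Lemma Rintegral_shift (e : R) (D : set R) (f : R -> R) :
  measurable D -> measurable_fun setT f ->
  leb.-integrable ((fun t => e + t) @^-1` D) (EFin \o (fun t => f (e + t))) ->
  (\int[leb]_(t in D) f t)%R =
  (\int[leb]_(t in (fun t => e + t)%R @^-1` D) f (e + t))%R.
Proof.
move=> mD mf intf; have me : measurable_fun [set: measurableTypeR R]
    (fun t : measurableTypeR R => e + t : measurableTypeR R).
  exact: measurable_funD.
rewrite /Rintegral; congr fine.
transitivity (\int[image_measure leb me]_(t in D) (f t)%:E)%E.
  apply: eq_measure_integral => A mA _; exact: (esym (lebesgue_shift e mA)).
rewrite (integral_pushforward me)//.
exact/measurable_EFinP.
Qed.

End LebesgueShift.

(** * Restarted paths and discounted functionals *)

Section SkorohodRestart.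
Context {R : realType} {E : completeMetricType R}.
Implicit Types (x y z : skorohod E) (t T e : R).

Lemma path_left_cvg x t : cvg (x s @[s --> t^'-]).
Proof.
have [t0|t0] := ltP 0 t; first exact: skorohod_left_limit.
apply: (cvgP (x 0)); apply: cvg_near_cst; near=> s.
rewrite skorohod_neg//; apply: lt_le_trans t0.
by near: s; exact: nbhs_left_lt.
Unshelve. all: by end_near. Qed.

Definition restart_path e x t := x (e + Num.max t 0).

Lemma restart_path_right_continuous e x t : 0 <= t ->
  restart_path e x s @[s --> t^'+] --> restart_path e x t.
Proof.
move=> t0; apply/metricType_numDomainType.cvgrPdist_lt => r r0.
have [d d0 H] := path_right_close x (e + t) r0.
near=> s.
have ts : t <= s by near: s; exact: nbhs_right_ge.
rewrite /restart_path (max_l t0) (max_l (le_trans t0 ts)).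
apply: H; first by rewrite lerD2l.
by rewrite -addrA ltrD2l; near: s; apply: nbhs_right_lt; rewrite ltrDl.
Unshelve. all: by end_near. Qed.

Lemma restart_path_left_limit e x t : 0 < t -> cvg (restart_path e x s @[s --> t^'-]).
Proof.
move=> t0; have /cvg_ex[l xl] := @path_left_cvg x (e + t).
apply: (cvgP l); apply/metricType_numDomainType.cvgrPdist_lt => r r0.
have [d /= d0 H] := (metricType_numDomainType.cvgrPdist_lt _ _).1 xl r r0.
near=> s.
have s0 : 0 < s by near: s; exact: nbhs_left_gt.
have st : s < t by near: s; exact: nbhs_left_lt.
rewrite /restart_path (max_l (ltW s0)); apply: H => /=; last by rewrite ltrD2l.
rewrite opprD addrACA subrr add0r gtr0_norm ?subr_gt0//.
by rewrite ltrBlDl -ltrBlDr; near: s; apply: nbhs_left_gt; rewrite ltrBlDr ltrDl.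
Unshelve. all: by end_near. Qed.

Lemma restart_path_neg e x t : t < 0 -> restart_path e x t = restart_path e x 0.
Proof. by move=> t0; rewrite /restart_path max_r ?maxxx// ltW. Qed.

Definition restart e x : skorohod E :=
  Skorohod (@restart_path_right_continuous e x) (@restart_path_left_limit e x)
    (@restart_path_neg e x).

Lemma restartE e x t : 0 <= t -> restart e x t = x (e + t).
Proof. by move=> t0; rewrite /= /restart_path max_l. Qed.

Lemma restart_restart e e' x : 0 <= e -> restart e (restart e' x) = restart (e' + e) x.
Proof.
move=> e0; apply: skorohod_eq => t t0.
by rewrite !restartE ?addr_ge0// addrA.
Qed.

(** The sets [skorohod_nbhd] are what defines the open sets, so that continuity may
    be tested on them although they need not be open. *)
Lemma continuous_skorohod (f : skorohod E -> R) :
  (forall x e, 0 < e -> exists T, exists2 d, 0 < d &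
    forall y, skorohod_nbhd x T d y -> `|f x - f y| < e) -> continuous f.
Proof.
move=> H; apply/continuousP => U oU; rewrite -[open _]/(skorohod_open _) => x Ux.
have /nbhs_ballP[e /= e0 eU] : nbhs (f x) U by apply: open_nbhs_nbhs.
have [T [d d0 Td]] := H x e e0.
by exists T, d => // y /Td xy; apply: eU.
Qed.

(** A time change fixes 0, so closeness of paths entails closeness of their
    initial positions. *)
Lemma continuous_initial_value (f : E -> R) : continuous f ->
  continuous (fun x : skorohod E => f (x 0)).
Proof.
move=> cf; apply: continuous_skorohod => x e e0.
have /cvgrPdist_lt/(_ _ e0)/nbhs_ballP[d /= d0 H] := cf (x 0).
exists 0, d => // y [lam tlam /(_ 0)[]]; first by rewrite lexx.
have -> : lam 0 = 0.
  have [lamI lamO] := tlam; have : [set t | 0 <= t] (0 : R) by rewrite /=.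
  rewrite -lamO => -[s /= s0 ls]; apply: le_anti; rewrite (time_change_ge0 tlam)//.
  by rewrite andbT -{2}ls (time_change_le tlam).
by move=> _ yx; apply: H; rewrite ballEmdist/= metric_sym.
Qed.

(** The exceptional times are the points of a cutting of [0, k] for the
    oscillation 1 / (k + 1), for every k. *)
Lemma path_continuous_off_countable x : exists2 N : set R, countable N &
  forall t, 0 <= t -> ~ N t -> forall e, 0 < e -> exists2 d, 0 < d &
    forall s, 0 <= s -> `|s - t| < d -> mdist (x s) (x t) < e.
Proof.
have /choice[c cP] : forall k : nat, exists s : seq R, cuts x k%:R k.+1%:R^-1 s.
  by move=> k; apply: cuts_exist; rewrite invr_gt0.
exists (\bigcup_k [set` c k]).
  by apply: bigcup_countable => // k _; exact/finite_set_countable/finite_seq.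
move=> t t0 Nt e e0.
pose k := (Num.truncn (Num.max t e^-1)).+1.
have /truncnS_gt_le : (Num.truncn (Num.max t e^-1) <= k)%N by rewrite /k.
rewrite gt_max => /andP[_ ek].
have tk : t < k%:R.
  by rewrite (le_lt_trans _ (truncnS_gt _))// le_max lexx.
have ke : k.+1%:R^-1 < e by rewrite invf_plt ?posrE.
have tc p : p \in c k -> p != t.
  by move=> pc; apply/eqP => pt; apply: Nt; exists k => //=; rewrite -pt.
have [p|r r0 rP] := @seq_gt0_lbound R [seq `|p - t| | p <- c k].
  by move=> /mapP[q qc ->]; rewrite normr_gt0 subr_eq0 tc.
exists (Num.min r (k%:R - t)); first by rewrite lt_min r0 subr_gt0.
move=> s s0; rewrite lt_min => /andP[sr sk].
have far p : p \in c k -> r <= `|p - t|.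
  by move=> pc; apply: rP; apply/mapP; exists p.
have skk : s <= k%:R.
  by move: sk; rewrite ltr_norml => /andP[_]; rewrite ltrD2r => /ltW.
apply: lt_trans ke; have [st|ts] := leP s t.
  apply: cP => // [|p /far pr]; first exact: ltW.
  apply/negP => /andP[sp pt]; move: pr; rewrite leNgt => /negP; apply.
  apply: le_lt_trans sr; rewrite !ler0_norm ?subr_le0//.
  by rewrite !opprB lerD2l lerN2 ltW.
rewrite metric_sym; apply: cP => // [|p /far pr]; first exact: ltW.
apply/negP => /andP[tp ps]; move: pr; rewrite leNgt => /negP; apply.
apply: le_lt_trans sr; rewrite !ger0_norm ?subr_ge0 ?lerD2r//; exact: ltW.
Qed.

Lemma skorohod_cvg_off_countable x : exists2 N : set R, countable N &
  forall y : nat -> skorohod E,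
    (forall n, skorohod_nbhd x n%:R n.+1%:R^-1 (y n)) ->
    forall t, 0 <= t -> ~ N t -> y n t @[n --> \oo] --> x t.
Proof.
have [N cN NP] := path_continuous_off_countable x.
exists N => // y yx t t0 Nt; apply/metricType_numDomainType.cvgrPdist_lt => e e0.
have e20 : 0 < e / 2 by rewrite divr_gt0.
have [d d0 H] := NP _ t0 Nt _ e20.
pose L := Num.max t (Num.max d^-1 (2 / e)).
exists (Num.truncn L).+1 => // n /= Ln.
have : L < n%:R by rewrite (lt_le_trans (truncnS_gt _))// ler_nat.
rewrite gt_max gt_max => /andP[tn /andP[dn en]].
have nn : n%:R < n.+1%:R :> R by rewrite ltr_nat.
have [lam tlam K] := yx n; have [|h1 h2] := K t; first by rewrite t0 ltW.
have l0 := time_change_ge0 tlam t0.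
rewrite metric_sym (splitr e).
apply: le_lt_trans (metric_triangle _ (x (lam t)) _) _.
rewrite ltrD//.
  rewrite (lt_trans h2)// invf_plt ?posrE// ?invf_div; exact: lt_trans nn.
apply: H => //; rewrite (lt_trans h1)// invf_plt ?posrE//; exact: lt_trans nn.
Qed.

End SkorohodRestart.

Section Discounted.
Context {R : realType} {E : completeMetricType R}.
Local Notation leb := (@lebesgue_measure R).
Implicit Types (x y z : skorohod E) (t T e lam : R) (h : E -> R).

Let ray : set (measurableTypeR R) := `[0%R, +oo[%classic.

Lemma integrable_expdecay lam : 0 < lam ->
  leb.-integrable ray (EFin \o (fun t => expR (- lam * t))).
Proof.
move=> lam0; have mray : measurable ray by exact: measurable_itv.
have := integrableZl mray lam^-1
  (integrableS measurableT mray (@subsetT _ ray) (integrable_exponential_pdf lam0)).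
apply: eq_integrable => // t; rewrite inE /ray/= in_itv/= andbT => t0.
by rewrite exponential_pdfE// -EFinM mulrA mulVf ?mul1r// gt_eqF.
Qed.

Lemma measurable_expdecay lam :
  measurable_fun [set: measurableTypeR R] (fun t => expR (- lam * t)).
Proof. by apply: measurableT_comp => //; exact: measurable_funM. Qed.

Lemma integrable_discount lam (a : R -> R) M : 0 < lam ->
  measurable_fun [set: measurableTypeR R] a -> (forall t, `|a t| <= M) ->
  leb.-integrable ray (EFin \o (fun t => expR (- lam * t) * a t)).
Proof.
move=> lam0 ma aM.
have mray : measurable ray by exact: measurable_itv.
apply: (@le_integrable _ _ R leb ray mray _
  (fun t => `|M|%:E * (expR (- lam * t))%:E)%E).
- apply/measurable_EFinP/measurable_funTS; apply: measurable_funM => //.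
  exact: measurable_expdecay.
- move=> t _ /=; rewrite lee_fin !normrM normr_id mulrC ler_wpM2r//.
  by rewrite (le_trans (aM _))// ler_norm.
- exact/integrableZl/integrable_expdecay.
Qed.

(** For the canonical process this is the random variable whose expectation is
    the resolvent applied to h. *)
Definition discounted lam h x : R :=
  (\int[leb]_(t in ray) (expR (- lam * t) * h (x t)))%R.

Lemma measurable_along_path h x : continuous h ->
  measurable_fun [set: measurableTypeR R] (fun t => h (x t)).
Proof.
move=> ch; have := measurableT_comp (continuous_borel ch) (measurable_trajectory x).
exact.
Qed.

Lemma discounted_bounded lam h : 0 < lam -> Cb R E h ->
  exists2 C, 0 <= C & forall x, `|discounted lam h x| <= C.
Proof.
move=> lam0 [ch /bounded_fun_leP[M M0 hM]].
have mray : measurable ray by exact: measurable_itv.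
exists (M * \int[leb]_(t in ray) expR (- lam * t))%R.
  by rewrite mulr_ge0// Rintegral_ge0// => t _; exact: expR_ge0.
move=> x; have mhx := measurable_along_path x ch.
rewrite -RintegralZl//; last exact: integrable_expdecay.
rewrite (le_trans (le_normr_Rintegral _ _))//.
  exact: (integrable_discount lam0 mhx (fun t => hM (x t))).
apply: le_Rintegral => //.
- have := integrable_norm (integrable_discount lam0 mhx (fun t => hM (x t))).
  by apply: eq_integrable.
- have := integrableZl mray M (integrable_expdecay lam0).
  by apply: eq_integrable.
- by move=> t _; rewrite normrM ger0_norm ?expR_ge0// mulrC ler_wpM2r ?expR_ge0.
Qed.

(** Along a sequence tending to x, paths converge at almost every time, so that
    dominated convergence applies. *)
Lemma discounted_continuous lam h : 0 < lam -> Cb R E h ->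
  continuous (discounted lam h).
Proof.
move=> lam0 [ch /bounded_fun_leP[M M0 hM]].
have mray : measurable ray by exact: measurable_itv.
apply: continuous_skorohod => x e e0; apply: contrapT => nH.
have /choice[y yP] : forall n : nat, exists y, skorohod_nbhd x n%:R n.+1%:R^-1 y /\
    e <= `|discounted lam h x - discounted lam h y|.
  move=> n; apply: contrapT => ny; apply: nH.
  exists n%:R, n.+1%:R^-1; first by rewrite invr_gt0.
  by move=> y xy; rewrite ltNge; apply/negP => ey; apply: ny; exists y.
have [N cN NP] := skorohod_cvg_off_countable x.
have : (discounted lam h (y n)) @[n --> \oo] --> discounted lam h x.
  apply: (@Rintegral_dominated _ _ _ leb ray _ _ (fun t => M * expR (- lam * t))).
  - exact: mray.
  - move=> n; apply: measurable_funTS; apply: measurable_funM.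
      exact: measurable_expdecay.
    exact: measurable_along_path.
  - apply: measurable_funTS; apply: measurable_funM.
      exact: measurable_expdecay.
    exact: measurable_along_path.
  - exists N; split => [||t /=].
    + exact: countable_measurable.
    + exact: countable_lebesgue_measure0.
    + move=> H; apply: contrapT => Nt; apply: H.
      rewrite /ray/= in_itv/= andbT => t0.
      apply: cvgM; first exact: cvg_cst.
      apply: (cvg_comp (fun n => y n t) h (G := nbhs (x t))); last exact: ch.
      by apply: NP => // n; have [] := yP n.
  - have := integrableZl mray M (integrable_expdecay lam0).
    by apply: eq_integrable.
  - move=> n t _.
    by rewrite normrM ger0_norm ?expR_ge0// mulrC ler_wpM2r ?expR_ge0.
move=> /cvgrPdist_lt/(_ _ e0)[n _ /(_ n)]/= => /(_ (leqnn _)).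
by rewrite ltNge; have [_ ->] := yP n.
Qed.

Lemma discounted_tail lam h x e : 0 < lam -> Cb R E h -> 0 <= e ->
  (\int[leb]_(t in `[e, +oo[) (expR (- lam * t) * h (x t)))%R =
  expR (- lam * e) * discounted lam h (restart e x).
Proof.
move=> lam0 [ch /bounded_fun_leP[M M0 hM]] e0.
have mray : measurable ray by exact: measurable_itv.
have mtail : measurable (`[e, +oo[%classic : set (measurableTypeR R)).
  exact: measurable_itv.
have mf : measurable_fun [set: R] (fun t => expR (- lam * t) * h (x t)).
  by apply: measurable_funM; [exact: measurable_expdecay|exact: measurable_along_path].
have preE : (fun t => e + t) @^-1` `[e, +oo[%classic = ray.
  by rewrite /ray; apply/seteqP; split => t /=; rewrite !in_itv/= !andbT lerDl.
have eE t : 0 <= t -> expR (- lam * (e + t)) * h (x (e + t)) =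
     expR (- lam * e) * (expR (- lam * t) * h (restart e x t)).
  by move=> t0; rewrite mulrDr expRD mulrA restartE.
have is_ : leb.-integrable ray
    (EFin \o (fun t => expR (- lam * t) * h (restart e x t))).
  apply: integrable_discount => //; exact: measurable_along_path.
rewrite (@Rintegral_shift _ e)// preE.
  rewrite -RintegralZl//.
  by apply: eq_Rintegral => t; rewrite inE /ray/= in_itv/= andbT => /eE.
have := integrableZl mray (expR (- lam * e)) is_.
apply: eq_integrable => // t; rewrite inE /ray/= in_itv/= andbT => t0.
by rewrite /= eE.
Qed.

Lemma discounted_restart lam h x e : 0 < lam -> Cb R E h -> 0 <= e ->
  discounted lam h x =
  (\int[leb]_(t in `[0, e[) (expR (- lam * t) * h (x t)))%R
  + expR (- lam * e) * discounted lam h (restart e x).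
Proof.
move=> lam0 hCb e0; have [ch /bounded_fun_leP[M M0 hM]] := hCb.
have ix := integrable_discount lam0 (measurable_along_path x ch) (fun t => hM (x t)).
have rayE : ray = `[0, e[%classic `|` `[e, +oo[%classic.
  by rewrite -itv_bndbnd_setU// bnd_simp.
rewrite -discounted_tail// /discounted rayE Rintegral_setU//.
- by rewrite -rayE.
- apply/disj_set2P; apply/seteqP; split => // t [] /=.
  by rewrite !in_itv/= andbT => /andP[_ te]; rewrite leNgt te.
Qed.

End Discounted.

(** * Densities and conditioning *)

Section Density.
Local Open Scope ereal_scope.
Context {R : realType} d (T : measurableType d).
Variables (mu : {sigma_finite_measure set T -> \bar R}) (nu : probability T R).
Variable p : T -> R.
Hypotheses (mp : measurable_fun setT p)
  (nuE : forall A, measurable A -> nu A = \int[mu]_(x in A) (p x)%:E).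

(** p is the Radon-Nikodym derivative of nu, by uniqueness of the latter. *)
Lemma integral_density (U : set T) (f : T -> \bar R) : measurable U ->
  nu.-integrable U f ->
  \int[nu]_(x in U) f x = \int[mu]_(x in U) (f x * (p x)%:E).
Proof.
move=> mU intf.
have numu : nu `<< mu.
  apply/null_content_dominatesP => A mA muA0; rewrite nuE//.
  by apply: null_set_integral => //; exact/measurable_EFinP/measurable_funTS.
rewrite -(Radon_Nikodym_change_of_variables numu)//=.
apply: ae_eq_integral => //.
- apply: emeasurable_funM; first exact: measurable_int intf.
  apply: (measurable_int mu).
  apply: (integrableS _ _ (@subsetT _ _)) => //=.
  exact: Radon_Nikodym_integrable.
- apply: emeasurable_funM; first exact: measurable_int intf.
  exact/measurable_EFinP/measurable_funTS.
- apply: ae_eqe_mul2l => /=.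
  rewrite Radon_NikodymE//=.
  case: cid => /= h [h1 h2 h3].
  apply: integral_ae_eq => //=.
  + exact: integrableS h2.
  + exact/measurable_EFinP/measurable_funTS.
  + by move=> A AU mA; rewrite -h3// -nuE.
Qed.

End Density.

Section Conditioning.
Context {R : realType} d (Om : measurableType d).
Variables (P : probability Om R) (C : set Om).

Definition conditional (mC : measurable C) (PC : P C != 0%E) : set Om -> \bar R :=
  fun B => ((fine (P C))^-1%:E * P (B `&` C))%E.

Hypotheses (mC : measurable C) (PC : P C != 0%E).
Local Notation PrC := (conditional mC PC).

Let p := fine (P C).

Let pE : P C = p%:E.
Proof. by rewrite /p fineK// fin_num_measure. Qed.

Let p0 : 0 < p.
Proof. by rewrite -lte_fin -pE lt_neqAle eq_sym PC measure_ge0. Qed.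

Let cond0 : PrC set0 = 0%E.
Proof. by rewrite /conditional set0I measure0 mule0. Qed.

Let cond_ge0 B : (0 <= PrC B)%E.
Proof. by rewrite /conditional mule_ge0 ?measure_ge0// lee_fin invr_ge0 ltW. Qed.

Let cond_sigma_additive : semi_sigma_additive PrC.
Proof.
move=> F mF tF mUF; rewrite /conditional.
rewrite [X in X @ _ --> _](_ : _ = (fun n => (fine (P C))^-1%:E *
    \sum_(0 <= i < n) mrestr P mC (F i))%E); last first.
  by apply/funext => n; rewrite ge0_sume_distrr.
apply: cvgeZl => //.
exact: (@measure_semi_sigma_additive _ _ _ (mrestr P mC)).
Qed.

HB.instance Definition _ := isMeasure.Build _ _ _ PrC
  cond0 cond_ge0 cond_sigma_additive.

Let cond_setT : PrC setT = 1%E.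
Proof. by rewrite /conditional setTI pE/= -EFinM mulVf// gt_eqF. Qed.

HB.instance Definition _ :=
  @Measure_isProbability.Build _ _ R PrC cond_setT.

(** The conditional law has the density of the indicator of C divided by the
    probability of C. *)
Lemma Rintegral_conditional (f : Om -> R) (M : R) (B : set Om) :
  measurable B -> measurable_fun setT f -> (forall w, `|f w| <= M) ->
  (\int[PrC]_(w in B) f w)%R = (fine (P C))^-1 * (\int[P]_(w in B `&` C) f w)%R.
Proof.
move=> mB mf fM.
have nuE A : measurable A ->
    PrC A = (\int[P]_(w in A) ((fine (P C))^-1 * \1_C w)%:E)%E.
  move=> mA; rewrite /conditional.
  under eq_integral do rewrite EFinM.
  rewrite ge0_integralZl//; last 2 first.
    exact/measurable_EFinP/measurable_funTS/measurable_indic.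
    by rewrite lee_fin invr_ge0 ltW.
  by rewrite integral_indic// setIC.
rewrite /Rintegral (@integral_density _ _ _ P PrC
   (fun w => (fine (P C))^-1 * \1_C w)) => //.
- rewrite -/(Rintegral _ _ _) Rintegral_mkcondr -RintegralZl//.
  + apply: eq_Rintegral => w _; rewrite patchE indicE.
    by case: ifPn => _; rewrite ?mulr1 ?mulr0// mulrC.
  + apply: (@bounded_integrable _ _ _ _ _ M) => //.
      by apply/(measurable_restrictT _ mC); exact: measurable_funTS.
    move=> w; rewrite patchE; case: ifPn => // _.
    by rewrite normr0 (le_trans _ (fM w)).
- apply: measurable_funM => //; exact: measurable_indic.
- exact: bounded_integrable fM.
Qed.

End Conditioning.

(** * Conditioning and restarting solutions *)

Section PathIntegral.
Context {R : realType} {E : completeMetricType R}.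
Local Notation leb := (@lebesgue_measure R).
Implicit Types (x : skorohod E) (g : E -> R).

Lemma integrable_along_path g x (a b : R) : Cb R E g ->
  leb.-integrable `[a, b] (EFin \o (fun s => g (x s))).
Proof.
move=> [cg /bounded_fun_leP[M M0 gM]].
apply: measurable_bounded_integrable.
- exact: measurable_itv.
- by rewrite /= lebesgue_measure_itv/=; case: ifPn => _; rewrite ?ltry// -EFinB ltry.
- by apply: measurable_funTS; exact: measurable_along_path.
- exists M; split; first exact: num_real.
  by move=> N MN s _ /=; rewrite (le_trans (gM _))// ltW.
Qed.

Definition drift g x (t : R) : R := (\int[leb]_(s in `[0, t]) g (x s))%R.

Lemma drift0 g x : drift g x 0 = 0.
Proof. by rewrite /drift set_itv1 Rintegral_set1. Qed.

Lemma drift_bounded g x M (t : R) : Cb R E g -> (forall e, `|g e| <= M) -> 0 <= t ->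
  `|drift g x t| <= M * t.
Proof.
move=> gCb gM t0; have ig := integrable_along_path x 0 t gCb.
have mI : measurable (`[0, t] : set (measurableTypeR R)) by exact: measurable_itv.
rewrite (le_trans (le_normr_Rintegral mI ig))//.
have -> : M * t = (\int[leb]_(s in `[0%R, t]) M)%R.
  rewrite Rintegral_cst//= lebesgue_measure_itv/= lte_fin.
  by case: ltgtP t0 => //= [t0 _|<- _]; rewrite ?subr0// mulr0.
apply: le_Rintegral => //; first exact: integrable_norm ig.
apply: measurable_bounded_integrable => //.
  by rewrite /= lebesgue_measure_itv/=; case: ifPn => _; rewrite ?ltry// -EFinB ltry.
exists `|M|; split; first exact: num_real.
by move=> N MN s _ /=; exact: ltW.
Qed.

Lemma drift_restart g x (e t : R) : Cb R E g -> 0 <= e -> 0 <= t ->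
  drift g (restart e x) t = drift g x (e + t) - drift g x e.
Proof.
move=> gCb e0 t0; have [cg _] := gCb.
have mI : measurable (`[e, e + t] : set (measurableTypeR R)).
  exact: measurable_itv.
have preE : (fun s => e + s) @^-1` `[e, e + t]%classic = `[0, t]%classic.
  by apply/seteqP; split => s /=; rewrite !in_itv/= lerDl lerD2l.
have shE : {in `[0, t]%classic, (fun s => g (restart e x s)) =1 (fun s => g (x (e + s)))}.
  move=> s; rewrite inE => sI; rewrite restartE//.
  by move: sI; rewrite /= in_itv/= => /andP[].
have -> : drift g (restart e x) t = (\int[leb]_(s in `[0%R, t]) g (x (e + s)))%R.
  exact: eq_Rintegral.
rewrite /drift -preE -(@Rintegral_shift _ e _ (fun s => g (x s)))//; first last.
- rewrite preE; have := integrable_along_path (restart e x) 0 t gCb.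
  by apply: eq_integrable => // s /shE/= ->.
- exact: measurable_along_path.
rewrite -Rintegral_itv_obnd_cbnd; last first.
  apply: integrableS (integrable_along_path x e (e + t) gCb) => //.
  by apply: subset_itvr; rewrite bnd_simp.
apply/esym/Rintegral_itvB; first exact: integrable_along_path.
  by rewrite bnd_simp.
by rewrite bnd_simp lerDl.
Qed.

End PathIntegral.

Section Adapted.
Context {R : realType} d (Om : measurableType d).
Implicit Types (G : set (set Om)) (f g : Om -> R).

(** Seeing the sigma-algebra as that of a measurable type gives access to the
    measurability of differences. *)
Lemma adapted_subr G f g : sigma_algebra setT G ->
  (forall B : set R, measurable B -> G (f @^-1` B)) ->
  (forall B : set R, measurable B -> G (g @^-1` B)) ->
  forall B : set R, measurable B -> G ((f \- g) @^-1` B).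
Proof.
move=> sG fG gG B mB.
have GE : <<s G >> = G by exact: sigma_algebra_id.
have mfg : measurable_fun [set: g_sigma_algebraType G] (f \- g : _ -> R).
  by apply: measurable_funB => _ D mD; rewrite setTI -[measurable _]/(<<s G >> _) GE;
    [exact: fG|exact: gG].
by have := mfg measurableT B mB; rewrite setTI -[measurable _]/(<<s G >> _) GE.
Qed.

End Adapted.

Section Solutions.
Context {R : realType} {E : completeMetricType R}.
Variable A : set ((E -> R) * (E -> R)).
Context d (Om : measurableType d) (P : probability Om R).
Variable X : Om -> borel (skorohod E).

Lemma solution_coord_measurable : solution A P X ->
  forall t, 0 <= t -> measurable_fun setT (fun w => X w t : borel E).
Proof.
move=> [F [[_ Fm _] FX _]] t t0 _ B mB; rewrite setTI.
by apply: (Fm t) => //; exact: FX.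
Qed.

Lemma solution_measurable : separable E -> solution A P X ->
  measurable_fun setT X.
Proof. by move=> sE /solution_coord_measurable; exact: measurable_path. Qed.

(** The process that the martingale problem requires to be a martingale. *)
Definition increment (f g : E -> R) (x : skorohod E) t :=
  f (x t) - f (x 0) - drift g x t.

Lemma increment_bounded f g t : Cb R E f -> Cb R E g -> 0 <= t ->
  exists M, forall x, `|increment f g x t| <= M.
Proof.
move=> [_ /bounded_fun_leP[M M0 fM]] gCb t0.
have [_ /bounded_fun_leP[N N0 gN]] := gCb.
exists (M + M + N * t) => x.
rewrite (le_trans (ler_normB _ _))// lerD//; last exact: drift_bounded.
by rewrite (le_trans (ler_normB _ _))// lerD.
Qed.

Lemma increment_restart f g x t0 t : Cb R E g -> 0 <= t0 -> 0 <= t ->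
  increment f g (restart t0 x) t = increment f g x (t0 + t) - increment f g x t0.
Proof.
move=> gCb t00 tt0; rewrite /increment !restartE// drift_restart// addr0.
by ring.
Qed.

Lemma solution_increment_measurable : solution A P X ->
  forall f g, A (f, g) -> forall t, 0 <= t ->
  measurable_fun setT (fun w => increment f g (X w) t).
Proof.
move=> [F [[_ Fm _] _ FM]] f g Afg t t0 _ B mB; rewrite setTI.
have [FA _ _] := FM _ _ Afg.
by apply: (Fm t) => //; exact: FA.
Qed.

Lemma solution_increment_mean : solution A P X ->
  forall f g, A (f, g) -> forall t, 0 <= t ->
  (\int[P]_w increment f g (X w) t)%R = 0.
Proof.
move=> [F [[sF _ _] _ FM]] f g Afg t t0.
have [_ _ /(_ 0 t (lexx _) t0 setT)] := FM _ _ Afg.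
have FT : F 0 setT.
  by have [F0 FD _] := sF 0 (lexx _); rewrite -(setD0 setT); exact: FD.
rewrite /Rintegral => /(_ FT) ->.
rewrite (eq_integral (fun=> 0%E)) ?integral0// => w _.
by have := drift0 g (X w); rewrite /drift /Rintegral => ->; rewrite subrr subr0.
Qed.

End Solutions.

Section ConditionalRestart.
Context {R : realType} {E : completeMetricType R}.
Variable A : set ((E -> R) * (E -> R)).
Hypothesis A_Cb : A `<=` Cb R E `*` Cb R E.
Context d (Om : measurableType d) (P : probability Om R).
Variable X : Om -> borel (skorohod E).
Hypothesis solX : solution A P X.

(** The Markov-like property of the set of solutions: conditioning on an event
    of the past of t0 and restarting at t0 preserves the martingale problem.  The
    event belongs to every later sigma-algebra, so that the conditional integrals
    of increments over events of the past are, up to a factor, unconditional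
    ones. *)
Lemma solution_conditional_restart (t0 : R) (B : set (borel E))
    (mC : measurable [set w | B (X w t0)]) (PC : P [set w | B (X w t0)] != 0%E) :
  0 <= t0 -> measurable B ->
  solution A (conditional mC PC) (fun w => restart t0 (X w)).
Proof.
move=> t00 mB; have mInc := solution_increment_measurable solX.
have [F [[sF Fm Fle] FX FM]] := solX.
have FC : F t0 [set w | B (X w t0)] by exact: FX.
exists (fun t => F (t0 + t)); split.
- split=> [t tt0|t tt0|s t s0 st].
  + by apply: sF; rewrite addr_ge0.
  + by apply: Fm; rewrite addr_ge0.
  + by apply: Fle; rewrite ?addr_ge0// lerD2l.
- move=> t tt0 D mD.
  rewrite (_ : _ @^-1` D = (fun w => X w (t0 + t) : borel E) @^-1` D).
    by apply: FX => //; rewrite addr_ge0.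
  by apply/seteqP; split => w /=; rewrite /restart_path max_l.
move=> f g Afg; have [fCb gCb] := A_Cb Afg.
have [FA FI FE] := FM _ _ Afg.
have incE t w : 0 <= t -> increment f g (restart t0 (X w)) t =
    increment f g (X w) (t0 + t) - increment f g (X w) t0.
  by move=> ?; exact: increment_restart.
have mM t : 0 <= t -> measurable_fun setT
    (fun w => increment f g (restart t0 (X w)) t).
  move=> tt0; rewrite (_ : (fun w => _) = (fun w =>
    increment f g (X w) (t0 + t) - increment f g (X w) t0)); last first.
    by apply/funext => w; exact: incE.
  by apply: measurable_funB; apply: mInc => //; rewrite addr_ge0.
split.
- move=> t tt0 D mD.
  rewrite (_ : _ @^-1` D = ((fun w => increment f g (X w) (t0 + t)) \-
      (fun w => increment f g (X w) t0)) @^-1` D); last first.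
    by apply/seteqP; split => w /=; rewrite -incE.
  apply: adapted_subr mD; first by apply: sF; rewrite addr_ge0.
    by move=> D' mD'; apply: FA => //; rewrite addr_ge0.
  move=> D' mD'; apply: (Fle t0) => //; first by rewrite lerDl.
  exact: FA.
- move=> t tt0; have [M HM] := increment_bounded fCb gCb tt0.
  by apply: bounded_integrable (mM _ tt0) (fun w => HM _).
move=> s t s0 st D FD; have tt0 := le_trans s0 st.
have mD : measurable D by apply: Fm FD; rewrite addr_ge0.
pose C := [set w | B (X w t0)].
have FDC : F (t0 + s) (D `&` C).
  have [_ FC_ FU] := sF _ (addr_ge0 t00 s0).
  have FsC : F (t0 + s) C by apply: (Fle t0) => //; rewrite lerDl.
  rewrite -[D `&` C]setCK setCI -setTD; apply: (FC_).
  rewrite -bigcup2E; apply: FU => -[|[|n]] /=.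
  - by rewrite -setTD; exact: FC_.
  - by rewrite -setTD; exact: FC_.
  - by have [] := sF _ (addr_ge0 t00 s0).
have key u : 0 <= u ->
    (\int[conditional mC PC]_(w in D) (increment f g (restart t0 (X w)) u)%:E)%E =
    ((fine (P C))^-1 * ((\int[P]_(w in D `&` C) increment f g (X w) (t0 + u))%R
      - (\int[P]_(w in D `&` C) increment f g (X w) t0)%R))%:E.
  move=> u0; have [M HM] := increment_bounded fCb gCb u0.
  have mDC : measurable (D `&` C) by exact: measurableI.
  have int_inc v : 0 <= v ->
      P.-integrable (D `&` C) (EFin \o (fun w => increment f g (X w) v)).
    move=> v0; have [N HN] := increment_bounded fCb gCb v0.
    by apply: bounded_integrable (fun w => HN _) => //; exact: mInc.
  rewrite -[LHS]fineK; last first.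
    apply: integrable_fin_num => //.
    exact: (bounded_integrable _ _ (mM _ u0) (fun w => HM _)).
  congr EFin; rewrite -[LHS]/(Rintegral _ _ _).
  rewrite (Rintegral_conditional _ _ mD (mM _ u0) (fun w => HM _)).
  rewrite -RintegralB//; [|exact: int_inc (addr_ge0 t00 u0)|exact: int_inc].
  by congr (_ * _); apply: eq_Rintegral => w _; exact: incE.
have incr_eq : (\int[P]_(w in D `&` C) increment f g (X w) (t0 + t))%R =
         (\int[P]_(w in D `&` C) increment f g (X w) (t0 + s))%R.
  rewrite /Rintegral; congr fine.
  by apply: (FE (t0 + s)) => //; rewrite ?addr_ge0// lerD2l.
have kt := key t tt0; have ks := key s s0.
by rewrite incr_eq -ks in kt.
Qed.

End ConditionalRestart.

(** * Weak topology and initial laws *)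

Lemma ptws_cvgP (I : Type) (V : topologicalType)
    (F : set_system {ptws I -> V}) (f : {ptws I -> V}) : Filter F ->
  F --> f <-> forall i, (fun g : {ptws I -> V} => g i) @ F --> f i.
Proof.
move=> FF; have ev_surj i : (fun g : I -> V => g i) @` setT = setT.
  by rewrite eqEsubset; split=> v // _; exists (fun=> v).
split=> [/cvg_sup H i|H].
  have /(cvg_image _ FF (ev_surj i)) := H i; apply: cvg_trans.
  move=> W /= [W' FW' <-]; rewrite /fmap/=.
  by apply: (@filterS _ F _ W') FW' => g W'g /=; exists g.
apply/cvg_sup => i; apply/(cvg_image _ FF (ev_surj i)).
apply: cvg_trans (H i) => W /= FW; exists ((fun g : I -> V => g i) @^-1` W) => //.
by rewrite eqEsubset; split=> [v [g Wg <-]//|v Wv]; exists (fun=> v).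
Qed.

Section WeakTopology.
Context {R : realType} {T : ptopologicalType}.
Implicit Types (mu nu : borel_probability R T) (f : T -> R).

Lemma weak_integral_continuous f : Cb R T f ->
  continuous (fun mu => (\int[mu]_x f x)%R).
Proof.
move=> fCb mu; pose cf : Cb R T := exist _ f (mem_set fCb).
have cC : continuous (@Cb_integral R T : borel_probability R T -> _).
  exact: initial_continuous.
have FF : Filter (@Cb_integral R T @ nbhs mu) by exact: fmap_filter.
by have /(ptws_cvgP _ FF)/(_ cf) := cC mu.
Qed.

Lemma weak_cvg (mu_ : nat -> borel_probability R T) mu :
  (forall f, Cb R T f -> (\int[mu_ n]_x f x)%R @[n --> \oo] --> (\int[mu]_x f x)%R) ->
  mu_ n @[n --> \oo] --> mu.
Proof.
move=> H U; rewrite nbhsE => -[W [[V oV <-] Vmu] VU].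
have cvgV : (@Cb_integral R T \o mu_) n @[n --> \oo] --> Cb_integral mu.
  by apply/ptws_cvgP => -[f fCb]; apply: H; exact: set_mem fCb.
have : nbhs (Cb_integral mu) V by apply: open_nbhs_nbhs.
move=> /cvgV [N _ NV]; exists N => // n /= Nn; apply: VU; exact: NV.
Qed.

End WeakTopology.

(** An ultrafilter on such a set either contains a singleton or contains all the
    tails of the sequence. *)
Lemma compact_cvg_seq (T : topologicalType) (u : nat -> T) (l : T) :
  u n @[n --> \oo] --> l -> compact (range u `|` [set l]).
Proof.
move=> ul; rewrite compact_ultra => F UF FK.
have FF : ProperFilter F by exact: ultra_proper.
have [[n Fn]|nF] := pselect (exists n, F [set u n]).
  exists (u n); split; first by left; exists n.
  move=> U /= /nbhs_singleton Uu; apply: filterS Fn => _ -> //.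
have FC n : F (~` [set u n]).
  by have [Fn|//] := in_ultra_setVsetC [set u n] UF; exfalso; apply: nF; exists n.
have Ftail N : F (\bigcap_(n in `I_N) ~` [set u n]).
  elim: N => [|N IH]; first by rewrite II0 bigcap_set0; exact: filterT.
  rewrite IIS bigcap_setU bigcap_set1; exact: filterI.
exists l; split; first by right.
move=> U lU; have [N _ NU] := ul _ lU.
apply: filterS (filterI FK (Ftail N)) => x [[[n _ <-]|->] xN].
  apply: (NU n) => /=; rewrite leqNgt; apply/negP => nN.
  exact: (xN n nN).
exact: nbhs_singleton.
Qed.

Section InitialLaw.
Context {R : realType} {E : completeMetricType R}.
Variable A : set ((E -> R) * (E -> R)).
Hypothesis sepE : separable E.

Definition point_law (x : E) : borel_probability R E := @dirac _ (borel E) x R.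

Lemma Cb_borel (T : ptopologicalType) (f : T -> R) : Cb R T f ->
  measurable_fun setT (f : borel T -> R).
Proof. by move=> [cf _]; exact: continuous_borel. Qed.

Lemma Cb_integrable (T : ptopologicalType) (f : T -> R)
    (mu : borel_probability R T) : Cb R T f -> mu.-integrable setT (EFin \o f).
Proof.
move=> fCb; have [_ /bounded_fun_leP[M _ fM]] := fCb.
exact: (bounded_integrable _ measurableT (Cb_borel fCb) fM).
Qed.

Lemma Rintegral_pushforward d (Om : measurableType d) (P : probability Om R)
    d' (T : measurableType d') (X : Om -> T) (Q : probability T R) (f : T -> R) M :
  measurable_fun setT X ->
  (forall B, measurable B -> Q B = pushforward P X B) ->
  measurable_fun setT f -> (forall x, `|f x| <= M) ->
  (\int[Q]_x f x)%R = (\int[P]_w f (X w))%R.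
Proof.
move=> mX QE mf fM; rewrite -(Rintegral_law mX) => //.
  by rewrite /Rintegral; congr fine; apply: eq_measure_integral => B mB _; exact: QE.
apply: (bounded_integrable _ measurableT) => //; last by move=> w; exact: fM.
exact: measurableT_comp.
Qed.

Lemma eq_solution_laws (mu nu : borel_probability R E)
    (Q : borel_probability R (skorohod E)) :
  (forall B : set (borel E), measurable B -> mu B = nu B) ->
  solution_laws A mu Q -> solution_laws A nu Q.
Proof.
move=> munu [d [Om [P [X [[sX X0] QX]]]]]; exists d, Om, P, X; split=> //.
by split=> // B mB; rewrite X0// munu.
Qed.

Lemma solution_law_in d (Om : measurableType d) (P : probability Om R)
    (X : Om -> borel (skorohod E)) (mu : borel_probability R E)
    (mX : measurable_fun setT X) :
  solution_for A P X mu -> solution_laws A mu (law P mX).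
Proof. by move=> sX; exists d, Om, P, X; split. Qed.

Lemma Cb_initial_value (f : E -> R) : Cb R E f ->
  Cb R (skorohod E) (fun x : skorohod E => f (x 0)).
Proof.
move=> [cf /bounded_fun_leP[M M0 fM]]; split; first exact: continuous_initial_value.
by apply/bounded_fun_leP; exists M.
Qed.

Lemma initial_integral (mu : borel_probability R E)
    (Q : borel_probability R (skorohod E)) (f : E -> R) :
  solution_laws A mu Q -> Cb R E f ->
  (\int[Q]_x f (x 0))%R = (\int[mu]_e f e)%R.
Proof.
move=> [d [Om [P [X [[sX X0] QX]]]]] fCb.
have [cf /bounded_fun_leP[M M0 fM]] := fCb.
have mX := solution_measurable sepE sX.
rewrite (Rintegral_pushforward mX QX (Cb_borel (Cb_initial_value fCb)) (fun x => fM (x 0))).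
have muE (B : set (borel E)) : measurable B ->
    mu B = pushforward P (fun w => X w 0 : borel E) B.
  by move=> mB; rewrite -X0.
by rewrite (Rintegral_pushforward (solution_coord_measurable sX (lexx 0)) muE
  (Cb_borel fCb) fM).
Qed.


Lemma Cb_min_mdist (x : E) : Cb R E (fun e => Num.min 1 (mdist x e)).
Proof.
split.
  move=> e; apply/cvgrPdist_lt => r r0; apply/nbhs_ballP; exists r => //= b.
  rewrite ballEmdist/= => eb.
  have h1 := metric_triangle x e b; have h2 := metric_triangle x b e.
  rewrite (metric_sym b e) in h2.
  rewrite ltr_norml; case: (leP 1 (mdist x e)) => u; case: (leP 1 (mdist x b)) => v;
   apply/andP; split; lra.
apply/bounded_fun_leP; exists 1 => // e; rewrite ger0_norm ?ge_min ?lexx//.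
by rewrite le_min ler01 mdist_ge0.
Qed.

(** The integrand vanishes only at x, so nu gives no mass to the complement
    of x. *)
Lemma point_law_unique (nu : borel_probability R E) (x : E) :
  (\int[nu]_e Num.min 1 (mdist x e))%R = 0 ->
  forall B : set (borel E), measurable B -> nu B = point_law x B.
Proof.
move=> nu0; pose f (e : borel E) : R := Num.min 1 (mdist x (e : E)).
have f0 e : 0 <= f e by rewrite le_min ler01 mdist_ge0.
have mf : measurable_fun setT (f : borel E -> R) by exact: (Cb_borel (Cb_min_mdist x)).
have fint : nu.-integrable setT (EFin \o f) by exact: (Cb_integrable nu (Cb_min_mdist x)).
have /ae_eq_integral_abs : (\int[nu]_(e in setT) `|(f e)%:E| = 0)%E.
  rewrite (eq_integral (EFin \o f)); last first.
    by move=> e _; rewrite /= ger0_norm.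
  rewrite -(fineK (integrable_fin_num measurableT fint)).
  by rewrite -[fine _]/(Rintegral nu setT f) nu0.
move=> /(_ measurableT (proj1 (integrableP _ _ _ fint))) [N [mN N0 fN]].
have off (B : set (borel E)) : measurable B -> ~ B x -> nu B = 0%E.
  move=> mB Bx; apply/eqP; rewrite eq_le measure_ge0 andbT -N0.
  apply: le_measure; rewrite ?inE// => e Be; apply: fN => /= /(_ Logic.I) [] fe0.
  apply: Bx; have : mdist x e = 0.
    by move: fe0; rewrite /f; case: leP => // _ /eqP; rewrite oner_eq0.
  by move=> /mdist_positivity ->.
move=> B mB; rewrite /point_law/= diracE.
have [xB|xB] := boolP (x \in B); last first.
  by rewrite off//; move: xB; rewrite notin_setE.
have := @probability_setC _ _ _ nu _ mB.
rewrite (off (~` B)); [|exact: measurableC|by move: xB; rewrite inE => xB /(_ xB)].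
have : nu B \is a fin_num by exact: fin_num_measure.
by case: (nu B) => // r _ [] /esym/eqP; rewrite subr_eq0 => /eqP <-.
Qed.

End InitialLaw.

(** * Solutions started at points dominate all solutions *)

Lemma cluster_seq_limit (R : realType) (T : topologicalType) (u : nat -> T)
    (p : T) (H : T -> R) (l : R) :
  cluster (u n @[n --> \oo]) p -> continuous H ->
  H (u n) @[n --> \oo] --> l -> H p = l.
Proof.
move=> up cH Hl; apply/eqP; rewrite -subr_eq0 -normr_eq0 eq_le normr_ge0 andbT.
apply/ler_addgt0Pr => e e0; rewrite add0r.
have e20 : 0 < e / 2 by rewrite divr_gt0.
have [n [N1 N2]] : [set q | `|l - H q| < e / 2] `&`
    [set q | `|H p - H q| < e / 2] !=set0.
  apply: up; last by have /cvgrPdist_lt := cH p; apply.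
  by have /cvgrPdist_lt/(_ _ e20) := Hl.
rewrite (splitr e) -(subrKA (H n)) (le_trans (ler_normD _ _))// lerD//.
  exact: ltW.
by rewrite distrC ltW.
Qed.

Lemma prob_integrable_cst (R : realType) d (T : measurableType d)
    (P : probability T R) (D : set T) (c : R) : measurable D ->
  P.-integrable D (EFin \o (fun=> c)).
Proof. by move=> mD; apply: (@bounded_integrable _ _ _ _ _ `|c|). Qed.

Section Domination.
Context {R : realType} {E : completeMetricType R}.
Variable A : set ((E -> R) * (E -> R)).
Hypothesis A_Cb : A `<=` Cb R E `*` Cb R E.
Hypothesis sepE : separable E.
Hypothesis compactA : forall K : set (borel_probability R E), compact K ->
  compact (\bigcup_(mu in K) solution_laws A mu).
Implicit Types (Q : borel_probability R (skorohod E)) (mu : borel_probability R E).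

Lemma point_law_integral (x : E) (f : E -> R) : Cb R E f ->
  (\int[point_law x]_e f e)%R = f x.
Proof.
move=> fCb; rewrite /Rintegral /point_law integral_dirac//=.
  by rewrite indicT mul1r.
by apply/measurable_EFinP; exact: Cb_borel.
Qed.

(** Upper semicontinuity of the family of solutions at a point law: the initial
    laws together with their limit form a compact set, so that the laws of the
    solutions have a cluster point which is a solution, and its initial law is
    the limit because the initial position is continuous on the path space. *)
Lemma solution_laws_limit (mu_ : nat -> borel_probability R E) (x : E)
    (Q_ : nat -> borel_probability R (skorohod E)) (G : skorohod E -> R)
    (c_ : nat -> R) (c : R) :
  (forall n, solution_laws A (mu_ n) (Q_ n)) ->
  (forall f, Cb R E f -> (\int[mu_ n]_e f e)%R @[n --> \oo] --> f x) ->
  Cb R (skorohod E) G -> (forall n, c_ n <= (\int[Q_ n]_y G y)%R) ->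
  c_ n @[n --> \oo] --> c ->
  exists2 Q, solution_laws A (point_law x) Q & c <= (\int[Q]_y G y)%R.
Proof.
move=> muQ mux GCb cG c_c.
have mu_cvg : mu_ n @[n --> \oo] --> point_law x.
  by apply: weak_cvg => f fCb; rewrite point_law_integral//; exact: mux.
have := compactA (compact_cvg_seq mu_cvg) (F := Q_ n @[n --> \oo]).
case.
  exists 0%N => // n _; exists (mu_ n) => //; left; by exists n.
move=> Q [[nu _ nuQ] clQ]; exists Q.
  apply: (eq_solution_laws _ nuQ); apply: point_law_unique.
  have fCb := Cb_min_mdist x.
  rewrite -(initial_integral sepE nuQ fCb).
  apply: (cluster_seq_limit clQ (H := fun q : borel_probability R (skorohod E) =>
    (\int[q]_y Num.min 1 (mdist x (y 0)))%R)).
    exact: weak_integral_continuous (Cb_initial_value fCb).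
  have -> : (fun n => \int[Q_ n]_y Num.min 1 (mdist x (y 0)))%R =
      (fun n => \int[mu_ n]_e Num.min 1 (mdist x e))%R.
    by apply/funext => n; exact: (initial_integral sepE (muQ n) fCb).
  by have := mux _ fCb; rewrite mdistxx min_r.
rewrite leNgt; apply/negP => Qc.
have cont := weak_integral_continuous GCb.
pose r := (c - \int[Q]_y G y)%R / 2.
have r0 : 0 < r by rewrite divr_gt0// subr_gt0.
have [q [q1 q2]] : [set q : borel_probability R (skorohod E) | c - r < \int[q]_y G y]%R
    `&` [set q : borel_probability R (skorohod E) | `|\int[Q]_y G y - \int[q]_y G y|%R < r]
    !=set0.
  apply: clQ; last by have := cont Q; move/cvgrPdist_lt => /(_ _ r0).
  have /cvgrPdist_lt/(_ _ r0) := c_c; apply: filterS => n /=.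
  rewrite ltr_norml => /andP[_]; rewrite ltrBlDr addrC -ltrBlDr => h.
  exact: lt_le_trans h (cG n).
move: q1 q2; rewrite /= ltr_norml /r => q1 /andP[q2 _]; move: q1 q2.
set a := (\int[Q]_y G y)%R; set b := (\int[q]_y G y)%R; lra.
Qed.

Lemma solution_laws_max (x : E) (G : skorohod E -> R) : Cb R (skorohod E) G ->
  solution_laws A (point_law x) !=set0 ->
  exists2 Q, solution_laws A (point_law x) Q &
    forall Q', solution_laws A (point_law x) Q' -> (\int[Q']_y G y <= \int[Q]_y G y)%R.
Proof.
move=> GCb [Q0 xQ0].
pose S := [set r | exists2 Q, solution_laws A (point_law x) Q & r = (\int[Q]_y G y)%R].
have S0 : S !=set0 by exists (\int[Q0]_y G y)%R, Q0.
have [_ /bounded_fun_leP[M M0 GM]] := GCb.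
have SM : has_ubound S.
  exists M => _ [Q _ ->]; apply: le_trans (ler_norm _) _.
  exact: (norm_Rintegral_le Q (Cb_borel GCb)).
have /choice[Q_ QP] : forall n : nat, exists Q, solution_laws A (point_law x) Q /\
    sup S - n.+1%:R^-1 < (\int[Q]_y G y)%R.
  move=> n; have [|_ [Q xQ ->] QS] := @sup_adherent _ S n.+1%:R^-1 _ (conj S0 SM).
    by rewrite invr_gt0.
  by exists Q.
have [||Q xQ SQ] := @solution_laws_limit (fun=> point_law x) x Q_ G
    (fun n => sup S - n.+1%:R^-1) (sup S) (fun n => (QP n).1) _ GCb
    (fun n => ltW (QP n).2).
- by move=> f fCb; rewrite point_law_integral//; exact: cvg_cst.
- rewrite -[X in _ --> X]subr0; apply: cvgB; first exact: cvg_cst.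
  exact: cvg_harmonic.
exists Q => // Q' xQ'; apply: le_trans SQ; apply: sup_ubound => //.
by exists Q'.
Qed.

Lemma restart0 (x : skorohod E) : restart 0 x = x.
Proof. by apply: skorohod_eq => t t0; rewrite restartE// add0r. Qed.

Section LocalDomination.
Variables (G : skorohod E -> R).
Hypothesis GCb : Cb R (skorohod E) G.
Hypothesis G_point : forall x Q, solution_laws A (point_law x) Q ->
  (\int[Q]_y G y)%R <= 0.
Context d (Om : measurableType d) (P : probability Om R).
Variable X : Om -> borel (skorohod E).
Hypothesis solX : solution A P X.

Let start (B : set E) : set Om := [set w | B (X w 0)].

Let mX := solution_measurable sepE solX.
Let mX0 := solution_coord_measurable solX (lexx 0).

Let mstart (B : set (borel E)) : measurable B -> measurable (start B).
Proof. by move=> mB; rewrite -[X in measurable X]setTI; exact: mX0. Qed.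

Let mGX : measurable_fun setT (fun w => G (X w)).
Proof. exact: measurableT_comp (Cb_borel GCb) mX. Qed.

(** Otherwise, conditioning on smaller and smaller sets of initial positions
    around x gives solutions whose initial laws tend to the point mass at x and
    whose mean of G is at least e; their limit is started at x and contradicts
    [G_point]. *)
Lemma local_domination (e : R) (x : E) : 0 < e -> exists n,
  forall B : set (borel E), measurable B ->
    (forall b, B b -> mdist x b < n.+1%:R^-1) ->
    (\int[P]_(w in start B) (G (X w) - e))%R <= 0.
Proof.
move=> e0; apply: contrapT => nloc.
have [_ /bounded_fun_leP[M M0 GM]] := GCb.
have /choice[B BP] : forall n : nat, exists B : set (borel E), [/\ measurable B,
    forall b, B b -> mdist x b < n.+1%:R^-1 &
    0 < (\int[P]_(w in start B) (G (X w) - e))%R].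
  move=> n; apply: contrapT => nB; apply: nloc; exists n => B mB Bx.
  by rewrite leNgt; apply/negP => h; apply: nB; exists B.
have mGe : measurable_fun setT (fun w => G (X w) - e).
  exact: measurable_funB.
have GeM w : `|G (X w) - e| <= M + e.
  by rewrite (le_trans (ler_normB _ _))// lerD ?GM// gtr0_norm.
have PB n : P (start (B n)) != 0%E.
  have [mB _ Bpos] := BP n; apply/eqP => PB0; move: Bpos.
  rewrite /Rintegral null_set_integral ?ltxx//; first exact: mstart.
  exact/measurable_EFinP/measurable_funTS.
have mB n : measurable (start (B n)) by have [] := BP n; move=> ? _ _; exact: mstart.
pose Pn n := conditional (mB n) (PB n).
have p0 n : 0 < fine (P (start (B n))).
  by rewrite fine_gt0// lt_neqAle eq_sym PB measure_ge0/= (le_lt_trans (probability_le1 _ (mB n))) ?ltry.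
have solXn n : solution A (Pn n) X.
  have [mBn _ _] := BP n.
  have := solution_conditional_restart A_Cb solX (mB n) (PB n) (lexx 0) mBn.
  rewrite (_ : (fun w => restart 0 (X w)) = X)//.
  by apply/funext => w; exact: restart0.
have mean_n n (f : Om -> R) N : measurable_fun setT f -> (forall w, `|f w| <= N) ->
    (\int[Pn n]_w f w)%R =
    (fine (P (start (B n))))^-1 * (\int[P]_(w in start (B n)) f w)%R.
  move=> mf fN; have := Rintegral_conditional (mB n) (PB n) measurableT mf fN.
  by rewrite setTI.
pose mu_ n : borel_probability R E := law (Pn n) mX0.
have [|f fCb||||Q xQ eQ] := @solution_laws_limit mu_ x (fun n => law (Pn n) mX) G
   (fun=> e) e.
- by move=> n; apply: solution_law_in; split.
- have [cf /bounded_fun_leP[N N0 fN]] := fCb.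
  apply/cvgrPdist_le => r r0.
  have [k /= k0 kr] : exists2 k : R, 0 < k & forall b, mdist x b < k -> `|f x - f b| <= r.
    have /cvgrPdist_le/(_ _ r0)/nbhs_ballP[k /= k0 kr] := cf x.
    by exists k => // b xb; apply: kr; rewrite ballEmdist.
  exists (Num.truncn k^-1) => // n /truncnS_gt_le nk.
  have mfX : measurable_fun setT (fun w => f (X w 0)).
    exact: measurableT_comp (Cb_borel fCb) mX0.
  have ifX (m : probability Om R) : m.-integrable setT (EFin \o (fun w => f (X w 0))).
    exact: (bounded_integrable _ measurableT mfX (fun w => fN _)).
  rewrite Rintegral_law//; last exact: Cb_borel.
  rewrite -(prob_Rintegral_cst (Pn n) (f x)) -RintegralB;
    [|exact: measurableT|exact: prob_integrable_cst|exact: ifX].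
  have mdf : measurable_fun setT (fun w => f x - f (X w 0)).
    exact: measurable_funB.
  have dfN w : `|f x - f (X w 0)| <= N + N.
    by rewrite (le_trans (ler_normB _ _))// lerD.
  have idf D : measurable D -> P.-integrable D (EFin \o (fun w => f x - f (X w 0))).
    by move=> mD; exact: (bounded_integrable _ mD mdf dfN).
  rewrite (mean_n _ _ _ mdf dfN) normrM ger0_norm ?invr_ge0 ?(ltW (p0 n))//.
  rewrite mulrC ler_pdivrMr// (le_trans (le_normr_Rintegral (mB n) (idf _ (mB n))))//.
  rewrite -Rintegral_cst//; apply: le_Rintegral => //.
  + exact/integrable_norm/idf.
  + exact: prob_integrable_cst.
  + move=> w Bw; apply: kr; have [_ Bx _] := BP n.
    by rewrite (lt_trans (Bx _ Bw))// invf_plt ?posrE.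
- exact: GCb.
- move=> n; rewrite Rintegral_law//; last 2 first.
  + exact: Cb_borel.
  + exact: (bounded_integrable _ measurableT mGX (fun w => GM _)).
  rewrite (mean_n _ _ _ mGX (fun w => GM _)) mulrC ler_pdivlMr//.
  have [_ _] := BP n; rewrite RintegralB; [|exact: mB|
    exact: (bounded_integrable _ (mB n) mGX (fun w => GM _))|
    exact: prob_integrable_cst].
  by rewrite Rintegral_cst// subr_gt0 => /ltW.
- exact: cvg_cst.
by have := le_lt_trans (G_point xQ) (lt_le_trans e0 eQ); rewrite ltxx.
Qed.

(** Countably many of the sets given by [local_domination] cover E, and the sum
    over a disjoint refinement of the cover gives the mean over all initial
    positions. *)
Lemma global_domination : (\int[P]_w G (X w))%R <= 0.
Proof.
have [_ /bounded_fun_leP[M M0 GM]] := GCb.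
apply/ler_addgt0Pr => e e0; rewrite add0r.
have mGe : measurable_fun setT (fun w => G (X w) - e).
  exact: measurable_funB.
have GeM w : `|G (X w) - e| <= M + e.
  by rewrite (le_trans (ler_normB _ _))// lerD ?GM// gtr0_norm.
suff : (\int[P]_w (G (X w) - e))%R <= 0.
  rewrite RintegralB; [|exact: measurableT|
    exact: (bounded_integrable _ measurableT mGX (fun w => GM _))|
    exact: prob_integrable_cst].
  by rewrite prob_Rintegral_cst subr_le0.
have [u u_dense] := separable_dense_seq sepE.
pose good (V : set (borel E)) := forall B : set (borel E), measurable B -> B `<=` V ->
    (\int[P]_(w in start B) (G (X w) - e))%R <= 0.
pose ball_ (jk : nat * nat) : set (borel E) :=
  [set b | mdist (u jk.1) (b : E) < jk.2.+1%:R^-1].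
pose V n : set (borel E) := if unpickle n is Some jk then
  if `[< good (ball_ jk) >] then ball_ jk else set0 else set0.
have Vgood n : good (V n).
  have good0 : good set0.
    move=> B _; rewrite subset0 => ->; rewrite (_ : start set0 = set0) ?Rintegral_set0//.
  by rewrite /V; case: unpickle => // jk; case: ifPn => // /asboolP.
have mV n : measurable (V n).
  rewrite /V; case: unpickle => // jk; case: ifPn => // _.
  by apply: open_borel; exact: open_mdist_ball.
have Vcover : \bigcup_n V n = setT.
  apply/seteqP; split => // x _; have [n nP] := local_domination x e0.
  have n2_gt0 : 0 < (n.*2.+1).+1%:R^-1 :> R by rewrite invr_gt0.
  have [j uj] := u_dense x (n.*2.+1).+1%:R^-1 n2_gt0.
  exists (pickle (j, n.*2.+1)) => //; rewrite /V pickleK.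
  suff /asboolT -> : good (ball_ (j, n.*2.+1)) by [].
  move=> B mB Bj; apply: nP => // b /Bj /= ub.
  rewrite (le_lt_trans (metric_triangle _ (u j) _))// metric_sym.
  rewrite (lt_le_trans (ltrD uj ub))//.
  have -> : n.*2.+2%:R = 2 * n.+1%:R :> R by rewrite -natrM mul2n doubleS.
  by rewrite invfM -mulrDl (_ : 2^-1 + 2^-1 = 1 :> R) ?mul1r//; lra.
pose W n := start (seqDU V n).
have mS n : measurable (seqDU V n : set (borel E)) by exact: seqDU_measurable.
have WT : \bigcup_n W n = setT.
  apply/seteqP; split => // w _.
  have : (\bigcup_n seqDU V n) (X w 0) by rewrite -seqDU_bigcup_eq Vcover.
  by move=> [n _ Vn]; exists n.
have tW : trivIset setT W.
  apply/trivIsetP => i j _ _ ij; apply/seteqP; split => // w [wi wj].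
  have /trivIsetP/(_ i j Logic.I Logic.I ij) := @trivIset_seqDU _ V.
  by move=> /seteqP[+ _] => /(_ (X w 0)); apply.
have iGe D : measurable D -> P.-integrable D (EFin \o (fun w => G (X w) - e)).
  by move=> mD; exact: (bounded_integrable _ mD mGe GeM).
rewrite -lee_fin; rewrite /Rintegral fineK; last first.
  by apply: integrable_fin_num => //; exact: (iGe setT measurableT).
have mW n : measurable (W n) by exact: mstart.
rewrite -[X in (\int[_]_(_ in X) _)%E]WT integral_bigcup//; last first.
  by rewrite WT; exact: (iGe setT measurableT).
have := @npeseries_le0 R
  (fun n => \int[P]_(w in W n) (G (X w) - e)%:E)%E xpredT 0%N.
apply => n _ _.
have fin : (\int[P]_(w in W n) (G (X w) - e)%:E)%E \is a fin_num.
  by apply: integrable_fin_num; [exact: mW|exact: iGe].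
rewrite -(fineK fin) lee_fin.
exact: (Vgood n (seqDU V n) (mS n) (@subset_seqDU _ V n)).
Qed.

End LocalDomination.

Lemma domination (G : skorohod E -> R) : Cb R (skorohod E) G ->
  (forall x Q, solution_laws A (point_law x) Q -> (\int[Q]_y G y)%R <= 0) ->
  forall d (Om : measurableType d) (P : probability Om R)
    (X : Om -> borel (skorohod E)), solution A P X -> (\int[P]_w G (X w))%R <= 0.
Proof. by move=> GCb G_point d Om P X; exact: global_domination. Qed.

End Domination.

(** * The upper value *)

Section ShortTimeAverage.
Context {R : realType}.
Local Notation leb := (@lebesgue_measure R).
Implicit Types (a : R -> R) (s e c eta M : R).

Lemma lebesgue_itvcc s e : 0 <= e -> leb `[s, s + e]%classic = e%:E.
Proof.
move=> e0; rewrite lebesgue_measure_itv/= lte_fin ltrDl.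
case: ltP => [_|e0']; first by rewrite -EFinB addrAC subrr add0r.
by congr EFin; apply: le_anti; rewrite e0 e0'.
Qed.

Lemma integrable_bounded_itv a s e M : 0 <= e ->
  measurable_fun [set: measurableTypeR R] a -> (forall t, `|a t| <= M) ->
  leb.-integrable `[s, s + e] (EFin \o a).
Proof.
move=> e0 ma aM; apply: measurable_bounded_integrable.
- exact: measurable_itv.
- by rewrite /= lebesgue_itvcc// ltry.
- exact: measurable_funTS.
- exists M; split; first exact: num_real.
  by move=> N MN t _ /=; rewrite (le_trans (aM t))// ltW.
Qed.

Lemma Rintegral_near_cst a s e c eta M : 0 <= e ->
  measurable_fun [set: measurableTypeR R] a -> (forall t, `|a t| <= M) ->
  (forall t, s <= t <= s + e -> `|a t - c| <= eta) ->
  `|(\int[leb]_(t in `[s, s + e]) a t)%R - c * e| <= eta * e.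
Proof.
move=> e0 ma aM aeta.
have mI : measurable (`[s, s + e]%classic : set (measurableTypeR R)).
  exact: measurable_itv.
have icst k : leb.-integrable `[s, s + e] (EFin \o (fun=> k)).
  exact: (@integrable_bounded_itv (fun=> k) _ _ `|k|).
have cstE k : (\int[leb]_(_ in `[s, s + e]) k)%R = k * e.
  by rewrite Rintegral_cst//= lebesgue_itvcc.
have ia := integrable_bounded_itv s e0 ma aM.
rewrite -!cstE -RintegralB//.
have iac : leb.-integrable `[s, s + e] (EFin \o (fun t => a t - c)).
  apply: (@integrable_bounded_itv _ _ _ (M + `|c|)) => //.
    exact: measurable_funB.
  by move=> t; rewrite (le_trans (ler_normB _ _))// lerD.
rewrite (le_trans (le_normr_Rintegral mI iac))//.
by apply: le_Rintegral => //; exact: integrable_norm.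
Qed.

Lemma right_average_cvg a M : measurable_fun [set: measurableTypeR R] a ->
  (forall t, `|a t| <= M) ->
  (forall eta, 0 < eta -> exists2 d, 0 < d & forall t, 0 <= t < d -> `|a t - a 0| <= eta) ->
  (n.+1%:R * \int[leb]_(t in `[0, n.+1%:R^-1]) a t)%R @[n --> \oo] --> a 0.
Proof.
move=> ma aM a0; apply/cvgrPdist_le => eta eta0.
have [d d0 ad] := a0 _ eta0.
exists (Num.truncn d^-1) => // n /truncnS_gt_le nd /=.
have n0 : 0 < n.+1%:R :> R by [].
have := @Rintegral_near_cst a 0 n.+1%:R^-1 (a 0) eta M; rewrite add0r.
rewrite invr_ge0 (ltW n0) => /(_ isT ma aM) H.
rewrite distrC (_ : _ - a 0 = n.+1%:R *
  ((\int[leb]_(t in `[0%R, n.+1%:R^-1]) a t)%R - a 0 * n.+1%:R^-1)); last first.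
  by rewrite mulrBr mulrCA divff ?mulr1// gt_eqF.
rewrite normrM gtr0_norm// mulrC -ler_pdivlMr//; apply: H => t /andP[t0 tn].
apply: ad; rewrite t0/= (le_lt_trans tn)//.
by rewrite invf_plt ?posrE.
Qed.

Lemma decay_rate_cvg (lam : R) : 0 < lam ->
  n.+1%:R * (1 - expR (- lam * n.+1%:R^-1)) @[n --> \oo] --> lam.
Proof.
move=> lam0.
have lamn n : 0 < lam * n.+1%:R^-1 by rewrite mulr_gt0// invr_gt0.
have squeeze (n : nat) : lam / (1 + lam * n.+1%:R^-1) <=
    n.+1%:R * (1 - expR (- lam * n.+1%:R^-1)) <= lam.
  have n0 : 0 < n.+1%:R :> R by [].
  have e1 := expR_ge1Dx (lam * n.+1%:R^-1).
  have e2 := expR_ge1Dx (- lam * n.+1%:R^-1).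
  apply/andP; split; last first.
    move: e2; set v := expR _; rewrite mulNr -ler_pdivlMl// (mulrC _ lam).
    by rewrite !lerBlDr addrC.
  rewrite -ler_pdivrMl//.
  have l1 : 0 < 1 + lam * n.+1%:R^-1 by rewrite addr_gt0.
  have -> : n.+1%:R^-1 * (lam / (1 + lam * n.+1%:R^-1)) = 1 - (1 + lam * n.+1%:R^-1)^-1.
    apply/eqP; rewrite -subr_eq0; apply/eqP; field.
    by rewrite gt_eqF//= gt_eqF// addrC addr_gt0.
  rewrite lerD2l lerN2 mulNr expRN lef_pV2 ?posrE//; exact: expR_gt0.
apply: (squeeze_cvgr (nearW _ squeeze)).
- rewrite -[X in _ --> X]divr1; apply: cvgM; first exact: cvg_cst.
  apply: cvgV; first exact: oner_neq0.
  rewrite -[X in _ --> X]addr0; apply: cvgD; first exact: cvg_cst.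
  rewrite -[X in _ --> X](mulr0 lam); apply: cvgM; first exact: cvg_cst.
  exact: cvg_harmonic.
- exact: cvg_cst.
Qed.

End ShortTimeAverage.

Section Value.
Context {R : realType} {E : completeMetricType R}.
Variable A : set ((E -> R) * (E -> R)).
Hypothesis sepE : separable E.
Hypothesis existsA : forall mu : borel_probability R E, solution_laws A mu !=set0.
Hypothesis compactA : forall K : set (borel_probability R E), compact K ->
  compact (\bigcup_(mu in K) solution_laws A mu).
Implicit Types (Q : borel_probability R (skorohod E)) (f g h : E -> R).

Lemma Cb_discounted lam h : 0 < lam -> Cb R E h ->
  Cb R (skorohod E) (discounted lam h).
Proof.
move=> lam0 hCb; split; first exact: discounted_continuous.
by have [C C0 hC] := discounted_bounded lam0 hCb; apply/bounded_fun_leP; exists C.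
Qed.

Lemma CbN (T : topologicalType) (f : T -> R) : Cb R T f -> Cb R T (fun x => - f x).
Proof.
move=> [cf /bounded_fun_leP[M M0 fM]]; split.
  by move=> x; apply: cvgN; exact: cf.
by apply/bounded_fun_leP; exists M => // x; rewrite normrN.
Qed.

Lemma CbB (T : topologicalType) (f g : T -> R) : Cb R T f -> Cb R T g ->
  Cb R T (fun x => f x - g x).
Proof.
move=> [cf /bounded_fun_leP[M M0 fM]] [cg /bounded_fun_leP[N N0 gN]]; split.
  by move=> x; apply: cvgB; [exact: cf|exact: cg].
apply/bounded_fun_leP; exists (M + N); first exact: addr_ge0.
by move=> x; rewrite (le_trans (ler_normB _ _))// lerD.
Qed.

Lemma Cb_cst (T : topologicalType) (c : R) : Cb R T (fun=> c).
Proof.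
by split; [move=> x; exact: cvg_cst|apply/bounded_fun_leP; exists `|c|].
Qed.

(** The supremum of the resolvent over the solutions started at x; it would be
    the resolvent of the semigroup if solutions were unique. *)
Definition upper_value lam h (x : E) : R :=
  sup [set r | exists2 Q, solution_laws A (point_law x) Q &
                 r = (\int[Q]_y discounted lam h y)%R].

Lemma upper_valueP lam h x : 0 < lam -> Cb R E h ->
  exists2 Q, solution_laws A (point_law x) Q &
    upper_value lam h x = (\int[Q]_y discounted lam h y)%R.
Proof.
move=> lam0 hCb.
have [Q xQ Qmax] := solution_laws_max sepE compactA (Cb_discounted lam0 hCb)
  (existsA (point_law x)).
exists Q => //; apply/eqP; rewrite eq_le; apply/andP; split.
  apply: ge_sup; first by exists (\int[Q]_y discounted lam h y)%R, Q.
  by move=> _ [Q' xQ' ->]; exact: Qmax.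
apply: sup_ubound; last by exists Q.
by exists (\int[Q]_y discounted lam h y)%R => _ [Q' xQ' ->]; exact: Qmax.
Qed.

Lemma upper_value_ge lam h x Q : 0 < lam -> Cb R E h ->
  solution_laws A (point_law x) Q ->
  (\int[Q]_y discounted lam h y)%R <= upper_value lam h x.
Proof.
move=> lam0 hCb xQ.
have [Q0 xQ0 Qmax] := solution_laws_max sepE compactA (Cb_discounted lam0 hCb)
  (existsA (point_law x)).
apply: sup_ubound; last by exists Q.
by exists (\int[Q0]_y discounted lam h y)%R => _ [Q' xQ' ->]; exact: Qmax.
Qed.

Lemma upper_value_usc lam h : 0 < lam -> Cb R E h ->
  upper_semicontinuous (upper_value lam h).
Proof.
move=> lam0 hCb x a uxa; apply: contrapT => nnear.
have /choice[y yP] : forall n : nat, exists y, mdist x y < n.+1%:R^-1 /\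
    a <= upper_value lam h y.
  move=> n; apply: contrapT => ny; apply: nnear.
  apply/nbhs_ballP; exists n.+1%:R^-1 => /=; first by rewrite invr_gt0.
  move=> y; rewrite ballEmdist/= => xy; rewrite ltNge; apply/negP => ay.
  by apply: ny; exists y.
have /choice[Q_ QP] : forall n, exists Q, solution_laws A (point_law (y n)) Q /\
    upper_value lam h (y n) = (\int[Q]_z discounted lam h z)%R.
  by move=> n; have [Q yQ uQ] := upper_valueP (y n) lam0 hCb; exists Q.
have yx : y n @[n --> \oo] --> x.
  apply/metricType_numDomainType.cvgrPdist_lt => e e0.
  exists (Num.truncn e^-1) => // n /truncnS_gt_le ne /=.
  by rewrite (lt_trans (yP n).1)// invf_plt ?posrE.
have [|||Q xQ aQ] := @solution_laws_limit _ _ _ sepE compactA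
    (fun n => point_law (y n)) x Q_ _ (fun=> a) a (fun n => (QP n).1) _
    (Cb_discounted lam0 hCb).
- move=> f fCb.
  rewrite (_ : (fun n => _) = (fun n => f (y n))); last first.
    by apply/funext => n; exact: point_law_integral.
  have [cf _] := fCb; exact: (cvg_comp y f yx (cf x)).
- by move=> n; rewrite -(QP n).2; exact: (yP n).2.
- exact: cvg_cst.
have := le_lt_trans (le_trans aQ (upper_value_ge lam0 hCb xQ)) uxa.
by rewrite ltxx.
Qed.

Lemma upper_value_bounded lam h : 0 < lam -> Cb R E h ->
  exists2 C, 0 <= C & forall x, `|upper_value lam h x| <= C.
Proof.
move=> lam0 hCb; have [C C0 hC] := discounted_bounded lam0 hCb.
exists C => // x; have [Q _ ->] := upper_valueP x lam0 hCb.
exact: (norm_Rintegral_le Q (Cb_borel (Cb_discounted lam0 hCb)) hC).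
Qed.

Lemma usc_borel (u : E -> R) : upper_semicontinuous u ->
  measurable_fun setT (u : borel E -> R).
Proof.
move=> uu; apply: (measurability _ (measurable_realfun.RGenInftyO.measurableE R)).
move=> _ [_ [a ->] <-]; rewrite setTI; apply: open_borel.
rewrite openE => x /=; rewrite in_itv/= => /uu; apply: filterS => y.
by rewrite /= in_itv.
Qed.

End Value.

(** * The upper value at a touching point *)

Section Viscosity.
Context {R : realType} {E : completeMetricType R}.
Variable A : set ((E -> R) * (E -> R)).
Hypothesis A_Cb : A `<=` Cb R E `*` Cb R E.
Hypothesis sepE : separable E.
Hypothesis existsA : forall mu : borel_probability R E, solution_laws A mu !=set0.
Hypothesis compactA : forall K : set (borel_probability R E), compact K ->
  compact (\bigcup_(mu in K) solution_laws A mu).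
Implicit Types (Q : borel_probability R (skorohod E)) (f g h : E -> R).
Local Notation leb := (@lebesgue_measure R).

Lemma measurable_restart d (Om : measurableType d) (X : Om -> borel (skorohod E))
    (e : R) : 0 <= e ->
  (forall t, 0 <= t -> measurable_fun setT (fun w => X w t : borel E)) ->
  measurable_fun setT (fun w => restart e (X w) : borel (skorohod E)).
Proof.
move=> e0 mX; apply: measurable_path => // t t0.
rewrite (_ : (fun w => _) = (fun w => X w (e + t) : borel E)).
  by apply: mX; rewrite addr_ge0.
by apply/funext => w; rewrite restartE.
Qed.

Lemma domination_restart (G : skorohod E -> R) : Cb R (skorohod E) G ->
  (forall x Q, solution_laws A (point_law x) Q -> (\int[Q]_y G y)%R <= 0) ->
  forall d (Om : measurableType d) (P : probability Om R)
    (X : Om -> borel (skorohod E)), solution A P X ->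
  forall e : R, 0 <= e -> (\int[P]_w G (restart e (X w)))%R <= 0.
Proof.
move=> GCb G_point d Om P X solX e e0.
have [_ /bounded_fun_leP[M M0 GM]] := GCb.
have mX := solution_coord_measurable solX.
have mT : measurable [set w : Om | [set: borel E] (X w e)].
  by rewrite (_ : [set _ | _] = setT)//; apply/seteqP; split.
have TE : [set w : Om | [set: borel E] (X w e)] = setT by apply/seteqP; split.
have PT : P [set w | [set: borel E] (X w e)] != 0%E.
  by rewrite TE probability_setT onee_neq0.
have := domination A_Cb sepE compactA GCb G_point
  (solution_conditional_restart A_Cb solX mT PT e0 measurableT).
rewrite (Rintegral_conditional mT PT measurableT _ (fun w => GM _)); last first.
  exact: measurableT_comp (Cb_borel GCb) (measurable_restart e0 mX).
by rewrite setTI TE probability_setT/= invr1 mul1r.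
Qed.

(** What the viscosity argument uses of a pair of A.  Unlike membership in A, it
    is invariant under a change of sign, which exchanges sub- and
    supersolutions. *)
Definition dynkin_pair f g := [/\ Cb R E f, Cb R E g &
  forall d (Om : measurableType d) (P : probability Om R)
    (X : Om -> borel (skorohod E)), solution A P X -> forall t, 0 <= t ->
    measurable_fun setT (fun w => drift g (X w) t) /\
    (\int[P]_w f (X w t))%R = (\int[P]_w f (X w 0))%R + (\int[P]_w drift g (X w) t)%R].

Lemma dynkin_pair_in f g : A (f, g) -> dynkin_pair f g.
Proof.
move=> Afg; have [fCb gCb] := A_Cb Afg; split=> // d Om P X solX t t0.
have mX := solution_coord_measurable solX.
have [_ /bounded_fun_leP[M M0 fM]] := fCb.
have [_ /bounded_fun_leP[N N0 gN]] := gCb.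
have mI := solution_increment_measurable solX Afg t0.
have mf s : 0 <= s -> measurable_fun setT (fun w => f (X w s)).
  by move=> s0; exact: measurableT_comp (Cb_borel fCb) (mX _ s0).
have dE w : drift g (X w) t = f (X w t) - f (X w 0) - increment f g (X w) t.
  by rewrite /increment opprB addrC subrK.
have md : measurable_fun setT (fun w => drift g (X w) t).
  rewrite (_ : (fun w => _) =
    (fun w => f (X w t) - f (X w 0) - increment f g (X w) t)); last first.
    by apply/funext.
  apply: measurable_funB => //; apply: measurable_funB; exact: mf.
split=> //; have := solution_increment_mean solX Afg t0.
have if_ s : 0 <= s -> P.-integrable setT (EFin \o (fun w => f (X w s))).
  by move=> s0; exact: (bounded_integrable _ measurableT (mf _ s0) (fun w => fM _)).
have id_ : P.-integrable setT (EFin \o (fun w => drift g (X w) t)).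
  exact: (bounded_integrable _ measurableT md (fun w => drift_bounded _ gCb gN t0)).
rewrite /increment RintegralB//; last first.
  have := integrableB measurableT (if_ _ t0) (if_ _ (lexx 0)).
  by apply: eq_integrable.
rewrite RintegralB//; [|exact: if_|exact: if_].
by move/eqP; rewrite subr_eq0 subr_eq addrC => /eqP.
Qed.

Lemma driftN g x (t : R) : Cb R E g -> drift (fun e => - g e) x t = - drift g x t.
Proof.
move=> gCb; rewrite /drift -mulN1r -RintegralZl.
- by apply: eq_Rintegral => s _; rewrite mulN1r.
- exact: measurable_itv.
- exact: integrable_along_path.
Qed.

Lemma RintegralN d (Om : measurableType d) (P : probability Om R) (f : Om -> R) :
  P.-integrable setT (EFin \o f) -> (\int[P]_w (- f w))%R = - (\int[P]_w f w)%R.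
Proof.
move=> fi; rewrite -mulN1r -RintegralZl//.
by apply: eq_Rintegral => w _; rewrite mulN1r.
Qed.

Lemma dynkin_pairN f g : dynkin_pair f g ->
  dynkin_pair (fun e => - f e) (fun e => - g e).
Proof.
move=> [fCb gCb H]; split; [exact: CbN|exact: CbN|move=> d Om P X solX t t0].
have [md E_] := H _ _ _ _ solX _ t0.
have [_ /bounded_fun_leP[M M0 fM]] := fCb.
have [_ /bounded_fun_leP[N N0 gN]] := gCb.
have mX := solution_coord_measurable solX.
have dN : (fun w => drift (fun e => - g e) (X w) t) = (fun w => - drift g (X w) t).
  by apply/funext => w; exact: driftN.
rewrite dN; split; first exact: measurable_funN.
have if_ s : 0 <= s -> P.-integrable setT (EFin \o (fun w => f (X w s))).
  move=> s0; apply: (bounded_integrable _ measurableT _ (fun w => fM _)).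
  exact: measurableT_comp (Cb_borel fCb) (mX _ s0).
rewrite !RintegralN ?E_ ?opprD//; [|exact: if_|exact: if_].
exact: (bounded_integrable _ measurableT md (fun w => drift_bounded _ gCb gN t0)).
Qed.

Lemma path_right_average (a : E -> R) (x : skorohod E) lam : Cb R E a -> 0 <= lam ->
  (n.+1%:R * \int[leb]_(t in `[0, n.+1%:R^-1]) (expR (- lam * t) * a (x t)))%R
    @[n --> \oo] --> a (x 0).
Proof.
move=> [ca /bounded_fun_leP[M M0 aM]] lam0.
pose b (t : R) := expR (- lam * Num.max t 0) * a (x t).
have mb : measurable_fun [set: measurableTypeR R] b.
  apply: measurable_funM; last exact: measurable_along_path.
  apply: measurableT_comp => //; apply: measurable_funM => //.
  exact: measurable_maxr.
have bM t : `|b t| <= M.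
  rewrite /b normrM -[leRHS]mul1r ler_pM// ger0_norm ?expR_ge0//.
  rewrite -expR0 ler_expR mulNr oppr_le0 mulr_ge0//.
  by rewrite le_max lexx orbT.
have -> : (fun n => n.+1%:R * \int[leb]_(t in `[0%R, n.+1%:R^-1])
    (expR (- lam * t) * a (x t)))%R =
   (fun n => n.+1%:R * \int[leb]_(t in `[0%R, n.+1%:R^-1]) b t)%R.
  apply/funext => n; congr (_ * _); apply: eq_Rintegral => t.
  by rewrite inE/= in_itv/= => /andP[t0 _]; rewrite /b max_l.
have b0 : b 0 = a (x 0) by rewrite /b maxxx mulr0 expR0 mul1r.
rewrite -b0; apply: (right_average_cvg mb bM) => eta eta0.
have cb : b t @[t --> 0^'+] --> b 0.
  apply: cvgM.
    apply: cvg_at_right_filter; apply: continuous_comp; last exact: continuous_expR.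
    apply: cvgM; first exact: cvg_cst.
    apply: continuous_max; [exact: cvg_id|exact: cvg_cst].
  apply: (cvg_comp x a); [exact: path_right_cvg|exact: ca].
have /cvgrPdist_le/(_ _ eta0)[d /= d0 H] := cb.
exists d => // t /andP[t0 td]; have [->|tn0] := eqVneq t 0.
  by rewrite subrr normr0 ltW.
have tp : 0 < t by rewrite lt_neqAle eq_sym tn0.
by rewrite distrC; apply: H => //=; rewrite sub0r normrN gtr0_norm.
Qed.

Definition short_discount lam h (e : R) (x : skorohod E) : R :=
  (\int[leb]_(t in `[0%R, e]) (expR (- lam * t) * h (x t)))%R.

Lemma short_discountE lam h e x : 0 < lam -> Cb R E h -> 0 <= e ->
  short_discount lam h e x =
  discounted lam h x - expR (- lam * e) * discounted lam h (restart e x).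
Proof.
move=> lam0 hCb e0; have [ch /bounded_fun_leP[H H0 hH]] := hCb.
rewrite (discounted_restart x lam0 hCb e0) addrK Rintegral_itv_bndo_bndc//.
have mray : measurable (`[0%R, +oo[%classic : set (measurableTypeR R)).
  exact: measurable_itv.
have mIe : measurable (`[0%R, e[%classic : set (measurableTypeR R)).
  exact: measurable_itv.
apply: (integrableS mray mIe); last first.
  exact: (integrable_discount lam0 (measurable_along_path x ch) (fun t => hH _)).
by apply: subset_itvl; rewrite bnd_simp.
Qed.

Lemma short_discount_bounded lam h e x H : 0 <= lam -> continuous h ->
  (forall y, `|h y| <= H) -> 0 <= e -> `|short_discount lam h e x| <= H * e.
Proof.
move=> lam0 ch hH e0; have mh := measurable_along_path x ch.
have := @Rintegral_near_cst _ (fun t => expR (- lam * Num.max t 0) * h (x t))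
  0 e 0 H H e0.
rewrite add0r mul0r subr0.
rewrite (_ : (\int[leb]_(t in `[0%R, e]) _)%R = short_discount lam h e x); last first.
  apply: eq_Rintegral => t; rewrite inE/= in_itv/= => /andP[t0 _].
  by rewrite max_l.
have bH t : `|expR (- lam * Num.max t 0) * h (x t)| <= H.
  rewrite normrM -[leRHS]mul1r ler_pM// ger0_norm ?expR_ge0//.
  rewrite -expR0 ler_expR mulNr oppr_le0 mulr_ge0//.
  by rewrite le_max lexx orbT.
apply => //; last by move=> t _; rewrite subr0.
apply: measurable_funM => //.
apply: measurableT_comp => //; apply: measurable_funM => //.
exact: measurable_maxr.
Qed.

Section MeanShortDiscount.
Context d (Om : measurableType d) (P : probability Om R).
Variable X : Om -> borel (skorohod E).
Hypothesis mX : forall t, 0 <= t -> measurable_fun setT (fun w => X w t : borel E).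

Lemma measurable_discounted_restart lam h e : 0 < lam -> Cb R E h -> 0 <= e ->
  measurable_fun setT (fun w => discounted lam h (restart e (X w))).
Proof.
move=> lam0 hCb e0; apply: measurableT_comp (Cb_borel (Cb_discounted lam0 hCb)) _.
exact: measurable_restart.
Qed.

Lemma measurable_short_discount lam h e : 0 < lam -> Cb R E h -> 0 <= e ->
  measurable_fun setT (fun w => short_discount lam h e (X w)).
Proof.
move=> lam0 hCb e0.
rewrite (_ : (fun w => _) = (fun w => discounted lam h (X w) -
    expR (- lam * e) * discounted lam h (restart e (X w)))); last first.
  by apply/funext => w; exact: short_discountE.
apply: measurable_funB.
  apply: measurableT_comp (Cb_borel (Cb_discounted lam0 hCb)) _.
  exact: measurable_path.
by apply: measurable_funM => //; exact: measurable_discounted_restart.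
Qed.

Lemma mean_short_discountE lam h e : 0 < lam -> Cb R E h -> 0 <= e ->
  (\int[P]_w short_discount lam h e (X w))%R =
  (\int[P]_w discounted lam h (X w))%R -
  expR (- lam * e) * (\int[P]_w discounted lam h (restart e (X w)))%R.
Proof.
move=> lam0 hCb e0.
have FCb := Cb_discounted lam0 hCb; have [_ /bounded_fun_leP[K K0 FK]] := FCb.
have iF : P.-integrable setT (EFin \o (fun w => discounted lam h (X w))).
  apply: (bounded_integrable _ measurableT _ (fun w => FK _)).
  by apply: measurableT_comp (Cb_borel FCb) _; exact: measurable_path.
have iFe : P.-integrable setT
    (EFin \o (fun w => discounted lam h (restart e (X w)))).
  apply: (bounded_integrable _ measurableT _ (fun w => FK _)).
  exact: measurable_discounted_restart.
rewrite -RintegralZl// -RintegralB//; last first.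
  have := integrableZl measurableT (expR (- lam * e)) iFe.
  by apply: eq_integrable.
by apply: eq_Rintegral => w _; exact: short_discountE.
Qed.

Lemma mean_short_discount_cvg lam h : 0 < lam -> Cb R E h ->
  (\int[P]_w (n.+1%:R * short_discount lam h n.+1%:R^-1 (X w)))%R @[n --> \oo]
  --> (\int[P]_w h (X w 0))%R.
Proof.
move=> lam0 hCb; have [ch /bounded_fun_leP[H H0 hH]] := hCb.
apply: (@Rintegral_bounded_cvg _ _ _ P _ _ H).
- move=> n; apply: measurable_funM => //.
  by apply: measurable_short_discount => //; rewrite invr_ge0.
- exact: measurableT_comp (Cb_borel hCb) (mX (lexx 0)).
- by move=> w; exact: path_right_average (ltW lam0).
- move=> n w; rewrite normrM ger0_norm//.
  have n0 : 0 <= n.+1%:R^-1 :> R by rewrite invr_ge0.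
  have := ler_wpM2l (ler0n R n.+1) (short_discount_bounded (X w) (ltW lam0) ch hH n0).
  by rewrite mulrCA divff ?mulr1.
Qed.

End MeanShortDiscount.

(** Dynamic programming over a short time e.  Start a maximizing solution at x0.
    Its mean discounted functional is the part accumulated before e plus the
    discounted mean functional of the restarted path, and the latter is at most
    the mean of f + c at time e, by domination.  Dynkin's formula rewrites this
    mean as f x0 + c, which is the upper value at x0, plus the mean of the
    integral of g.  Dividing by e and letting e tend to 0 gives the
    inequality. *)
Lemma upper_value_touching lam h f g c x0 : 0 < lam -> Cb R E h ->
  dynkin_pair f g ->
  (forall x, upper_value A lam h x <= f x + c) ->
  upper_value A lam h x0 = f x0 + c ->
  lam * upper_value A lam h x0 - g x0 <= h x0.
Proof.
move=> lam0 hCb [fCb gCb fg] u_le u_eq.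
have [Q x0Q uQ] := upper_valueP sepE existsA compactA x0 lam0 hCb.
have FCb := Cb_discounted lam0 hCb.
have [d [Om [P [X [[solX X0] QX]]]]] := x0Q.
have mX := solution_coord_measurable solX.
have mXD := solution_measurable sepE solX.
have [_ /bounded_fun_leP[MF MF0 FM]] := FCb.
have [_ /bounded_fun_leP[M M0 fM]] := fCb.
have [_ /bounded_fun_leP[N N0 gN]] := gCb.
have [_ /bounded_fun_leP[H H0 hH]] := hCb.
set U := upper_value A lam h x0 in u_eq uQ *.
have EF : (\int[P]_w discounted lam h (X w))%R = U.
  by rewrite uQ (Rintegral_pushforward mXD QX (Cb_borel FCb) FM).
have init (a : E -> R) : Cb R E a -> (\int[P]_w a (X w 0))%R = a x0.
  move=> aCb; have [_ /bounded_fun_leP[K K0 aK]] := aCb.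
  rewrite -(point_law_integral x0 aCb).
  have muE (B : set (borel E)) : measurable B ->
      point_law x0 B = pushforward P (fun w => X w 0 : borel E) B.
    by move=> mB; rewrite -X0.
  by rewrite (Rintegral_pushforward (mX 0 (lexx 0)) muE (Cb_borel aCb) aK).
have mF e : 0 <= e ->
    measurable_fun setT (fun w => discounted lam h (restart e (X w))).
  by move=> e0; exact: measurable_discounted_restart.
have mJ e : 0 <= e -> measurable_fun setT (fun w => drift g (X w) e).
  by move=> e0; have [] := fg _ _ _ _ solX _ e0.
pose e_ n : R := n.+1%:R^-1.
have e0 n : 0 <= e_ n by rewrite invr_ge0.
have step n : n.+1%:R * (1 - expR (- lam * e_ n)) * U <=
    (\int[P]_w (n.+1%:R * short_discount lam h (e_ n) (X w)))%R
    + expR (- lam * e_ n) * (\int[P]_w (n.+1%:R * drift g (X w) (e_ n)))%R.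
  have iI : P.-integrable setT
      (EFin \o (fun w => short_discount lam h (e_ n) (X w))).
    apply: (bounded_integrable _ measurableT
      (measurable_short_discount mX lam0 hCb (e0 n))
      (fun w => short_discount_bounded _ (ltW lam0) (proj1 hCb) hH (e0 n))).
  have iJ : P.-integrable setT (EFin \o (fun w => drift g (X w) (e_ n))).
    exact: (bounded_integrable _ measurableT (mJ _ (e0 n))
      (fun w => drift_bounded _ gCb gN (e0 n))).
  have iF : P.-integrable setT (EFin \o
      (fun w => discounted lam h (restart (e_ n) (X w)))).
    exact: (bounded_integrable _ measurableT (mF _ (e0 n)) (fun w => FM _)).
  rewrite !RintegralZl// mean_short_discountE// EF.
  have GCb : Cb R (skorohod E) (fun y => discounted lam h y - (f (y 0) + c)).
    apply: CbB => //; apply: (Cb_initial_value (f := fun e => f e + c)).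
    rewrite (_ : (fun e => _) = (fun e => f e - (- c))).
      by apply: CbB => //; exact: Cb_cst.
    by apply/funext => y; rewrite opprK.
  have [_ dynkin] := fg _ _ _ _ solX _ (e0 n).
  have mfe : measurable_fun setT (fun w => f (X w (e_ n))).
    exact: measurableT_comp (Cb_borel fCb) (mX _ (e0 n)).
  have dom := domination_restart GCb _ solX (e0 n).
  have {dom} : (\int[P]_w discounted lam h (restart (e_ n) (X w)))%R <=
      U + (\int[P]_w drift g (X w) (e_ n))%R.
    rewrite u_eq -(init _ fCb) addrAC -dynkin -subr_le0.
    rewrite -[X in _ - (_ + X)](prob_Rintegral_cst P) -RintegralD;
      [|exact: measurableT
       |exact: (bounded_integrable _ measurableT mfe (fun w => fM _))
       |exact: prob_integrable_cst].
    rewrite -RintegralB; [|exact: measurableT|exact: iF|]; last first.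
      apply: (@bounded_integrable _ _ _ _ _ (M + `|c|)) => //.
        exact: measurable_funD.
      by move=> w; rewrite (le_trans (ler_normD _ _))// lerD.
    have -> : (\int[P]_w (discounted lam h (restart (e_ n) (X w)) -
         (f (X w (e_ n)) + c)))%R = (\int[P]_w (discounted lam h (restart (e_ n) (X w)) -
         (f (restart (e_ n) (X w) 0) + c)))%R.
      by apply: eq_Rintegral => w _; rewrite restartE// addr0.
    apply: dom => x Q' xQ'.
    have iFQ : Q'.-integrable setT (EFin \o discounted lam h).
      exact: Cb_integrable.
    have fcCb : Cb R E (fun e => f e + c).
      rewrite (_ : (fun e => _) = (fun e => f e - (- c))).
        by apply: CbB => //; exact: Cb_cst.
      by apply/funext => y; rewrite opprK.
    rewrite RintegralB//; last by exact: (Cb_integrable Q' (Cb_initial_value fcCb)).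
    rewrite subr_le0 (initial_integral sepE xQ' fcCb) (point_law_integral x fcCb).
    exact: le_trans (upper_value_ge sepE existsA compactA lam0 hCb xQ') (u_le x).
  set FF := (\int[P]_w discounted _ _ _)%R; set JJ := (\int[P]_w drift _ _ _)%R.
  move=> FJ; have v0 : 0 < expR (- lam * e_ n) by exact: expR_gt0.
  have := ler_wpM2l (ltW v0) FJ.
  move: (expR _) {v0} => v vFJ.
  rewrite [leRHS](_ : _ = n.+1%:R * (U - v * FF + v * JJ)); last by ring.
  by rewrite -mulrA ler_pM2l//; lra.
have limL : n.+1%:R * (1 - expR (- lam * e_ n)) * U @[n --> \oo] --> lam * U.
  by apply: cvgM; [exact: decay_rate_cvg|exact: cvg_cst].
have nene n : n.+1%:R * e_ n = 1 by rewrite /e_ divff.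
have limI := mean_short_discount_cvg (P := P) mX lam0 hCb.
rewrite (init _ hCb) in limI.
have limJ : (\int[P]_w (n.+1%:R * drift g (X w) (e_ n)))%R @[n --> \oo] --> g x0.
  rewrite -(init _ gCb); apply: (@Rintegral_bounded_cvg _ _ _ P _ _ N).
  - by move=> n; apply: measurable_funM => //; exact: mJ.
  - exact: measurableT_comp (Cb_borel gCb) (mX _ (lexx 0)).
  - move=> w; have := @path_right_average g (X w) 0 gCb (lexx 0).
    rewrite (_ : (fun n => n.+1%:R * _)%R = (fun n => n.+1%:R * drift g (X w) (e_ n)))//.
    apply/funext => n; congr (_ * _); apply: eq_Rintegral => t _.
    by rewrite oppr0 mul0r expR0 mul1r.
  - move=> n w; rewrite normrM ger0_norm//.
    have := ler_wpM2l (ler0n R n.+1) (@drift_bounded _ _ g (X w) _ _ gCb gN (e0 n)).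
    by rewrite mulrCA nene mulr1.
have limv : expR (- lam * e_ n) @[n --> \oo] --> (1 : R).
  rewrite -expR0; apply: continuous_cvg; first exact: continuous_expR.
  rewrite -[X in _ --> X](mulr0 (- lam)); apply: cvgM; first exact: cvg_cst.
  exact: cvg_harmonic.
rewrite lerBlDr; apply: (ler_cvg_to limL _ (nearW _ step)).
by apply: cvgD => //; rewrite -[X in _ --> X]mul1r; exact: cvgM.
Qed.

End Viscosity.

(** * Consequences of the comparison principle *)

Section Comparison.
Context {R : realType} {E : completeMetricType R}.
Variable A : set ((E -> R) * (E -> R)).
Hypothesis A_Cb : A `<=` Cb R E `*` Cb R E.
Hypothesis sepE : separable E.
Hypothesis existsA : forall mu : borel_probability R E, solution_laws A mu !=set0.
Hypothesis compactA : forall K : set (borel_probability R E), compact K ->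
  compact (\bigcup_(mu in K) solution_laws A mu).
Implicit Types (Q : borel_probability R (skorohod E)) (f g h : E -> R).

Lemma bounded_diff (u f : E -> R) : bounded_fun u -> bounded_fun f ->
  exists2 K, 0 <= K & forall x, `|u x - f x| <= K.
Proof.
move=> /bounded_fun_leP[M M0 uM] /bounded_fun_leP[N N0 fN].
exists (M + N); first exact: addr_ge0.
by move=> x; rewrite (le_trans (ler_normB _ _))// lerD.
Qed.

Lemma upper_value_bounded_measurable lam h : 0 < lam -> Cb R E h ->
  bounded_measurable (upper_value A lam h).
Proof.
move=> lam0 hCb; split.
  by apply: usc_borel; exact: upper_value_usc.
apply/bounded_fun_leP.
exact: (upper_value_bounded sepE existsA compactA lam0 hCb).
Qed.

Lemma upper_value_subsolution lam h : 0 < lam -> Cb R E h ->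
  viscosity_subsolution A lam h (upper_value A lam h).
Proof.
move=> lam0 hCb; have [um ub] := upper_value_bounded_measurable lam0 hCb.
split; [by []|exact: upper_value_usc|move=> f g x0 Afg max_x0].
have [fCb gCb] := A_Cb Afg.
have [K K0 ufK] := bounded_diff ub (proj2 fCb).
apply: (upper_value_touching A_Cb sepE existsA compactA lam0 hCb
  (dynkin_pair_in A_Cb Afg) (c := upper_value A lam h x0 - f x0)); last first.
  by rewrite addrC subrK.
move=> x; rewrite -lerBlDl -max_x0; apply: sup_ubound; last by exists x.
by exists K => _ [y _ <-]; rewrite (le_trans (ler_norm _)).
Qed.

Definition lower_value lam h (x : E) : R := - upper_value A lam (fun e => - h e) x.

Lemma lower_value_supersolution lam h : 0 < lam -> Cb R E h ->
  viscosity_supersolution A lam h (lower_value lam h).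
Proof.
move=> lam0 hCb; have hNCb := CbN hCb.
have [um ub] := upper_value_bounded_measurable lam0 hNCb.
have lb : bounded_fun (lower_value lam h).
  have /bounded_fun_leP[K K0 uK] := ub.
  by apply/bounded_fun_leP; exists K => // x; rewrite normrN.
split.
- by split=> //; exact: measurable_funN.
- move=> x a /=; rewrite lte_fin ltrNr => ua.
  have := upper_value_usc sepE existsA compactA lam0 hNCb ua.
  by move=> ua'; exists [set y | upper_value A lam (fun e => - h e) y < - a] => // y /=;
    rewrite lte_fin ltrNr.
move=> f g x0 Afg min_x0; have [fCb gCb] := A_Cb Afg.
have [K K0 ufK] := bounded_diff lb (proj2 fCb).
pose U := upper_value A lam (fun e => - h e).
have touch : lam * U x0 - - g x0 <= - h x0.
  apply: (upper_value_touching A_Cb sepE existsA compactA lam0 hNCb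
    (dynkin_pairN (dynkin_pair_in A_Cb Afg)) (c := f x0 + U x0)); last first.
    by rewrite /U /=; ring.
  move=> x; have : lower_value lam h x0 - f x0 <= lower_value lam h x - f x.
    rewrite -min_x0; apply: inf_lbound; last by exists x.
    by exists (- K) => _ [y _ <-]; have := ufK y; rewrite ler_norml => /andP[].
  rewrite /lower_value -/(U x0) -/(U x) /=; lra.
by rewrite /lower_value -/(U x0) mulrN; lra.
Qed.

Lemma discountedN lam h x : 0 < lam -> Cb R E h ->
  discounted lam (fun e => - h e) x = - discounted lam h x.
Proof.
move=> lam0 [ch /bounded_fun_leP[M M0 hM]]; rewrite /discounted -[RHS]mulN1r -RintegralZl.
- by apply: eq_Rintegral => t _; rewrite mulrN mulN1r.
- exact: measurable_itv.
- exact: (integrable_discount lam0 (measurable_along_path x ch) (fun t => hM _)).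
Qed.

Lemma lower_value_le lam h x Q : 0 < lam -> Cb R E h ->
  solution_laws A (point_law x) Q ->
  lower_value lam h x <= (\int[Q]_y discounted lam h y)%R.
Proof.
move=> lam0 hCb xQ.
have := upper_value_ge sepE existsA compactA lam0 (CbN hCb) xQ.
rewrite lerNl (_ : (fun y => _) = (fun y => - discounted lam h y)); last first.
  by apply/funext => y; exact: discountedN.
by rewrite RintegralN//; exact: (Cb_integrable Q (Cb_discounted lam0 hCb)).
Qed.

(** Comparison of the upper with the lower value makes them equal, hence
    continuous, and domination applies in both directions. *)
Lemma comparison_discounted lam h : 0 < lam -> comparison_set A lam h ->
  exists2 u, Cb R E u & forall d (Om : measurableType d) (P : probability Om R)
    (X : Om -> borel (skorohod E)), solution A P X ->
  (\int[P]_w discounted lam h (X w))%R = (\int[P]_w u (X w 0))%R.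
Proof.
move=> lam0 [hCb cmp].
have FCb := Cb_discounted lam0 hCb.
have value_eq x : upper_value A lam h x = lower_value lam h x.
  apply/eqP; rewrite eq_le; apply/andP; split.
    by apply: cmp; [exact: upper_value_subsolution|exact: lower_value_supersolution].
  have [Q xQ] := existsA (point_law x).
  apply: le_trans (lower_value_le lam0 hCb xQ) _.
  exact: (upper_value_ge sepE existsA compactA).
pose u := upper_value A lam h.
have uCb : Cb R E u.
  split; last by have [_] := upper_value_bounded_measurable lam0 hCb.
  move=> x; apply/cvgrPdist_lt => e e0.
  have up : \forall y \near x, u y < u x + e.
    by apply: (upper_value_usc sepE existsA compactA lam0 hCb); rewrite ltrDl.
  have low : \forall y \near x, - u y < - u x + e.
    rewrite /u value_eq opprK.
    have := @upper_value_usc _ _ _ sepE existsA compactA _ _ lam0 (CbN hCb) x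
      (upper_value A lam (fun e => - h e) x + e).
    rewrite ltrDl => /(_ e0); apply: filterS => y.
    by rewrite value_eq opprK.
  apply: filterS2 up low => y up low.
  by rewrite ltr_norml; apply/andP; split; lra.
exists u => // d Om P X solX.
have mX := solution_measurable sepE solX.
have mX0 := solution_coord_measurable solX (lexx 0).
have uX0 : P.-integrable setT (EFin \o (fun w => u (X w 0))).
  have [_ /bounded_fun_leP[M M0 uM]] := uCb.
  apply: (bounded_integrable _ measurableT _ (fun w => uM _)).
  exact: measurableT_comp (Cb_borel uCb) mX0.
have FX : P.-integrable setT (EFin \o (fun w => discounted lam h (X w))).
  have [_ /bounded_fun_leP[M M0 FM]] := FCb.
  apply: (bounded_integrable _ measurableT _ (fun w => FM _)).
  exact: measurableT_comp (Cb_borel FCb) mX.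
have uiCb := Cb_initial_value uCb.
apply/eqP; rewrite eq_le -subr_le0 -[in X in _ && X]subr_le0 -!RintegralB//.
apply/andP; split.
- apply: (domination A_Cb sepE compactA (CbB FCb uiCb)) solX => x Q xQ.
  rewrite RintegralB//; [|exact: Cb_integrable|exact: (Cb_integrable Q uiCb)].
  rewrite subr_le0 (initial_integral sepE xQ uCb) (point_law_integral x uCb).
  exact: (upper_value_ge sepE existsA compactA).
- apply: (domination A_Cb sepE compactA (CbB uiCb FCb)) solX => x Q xQ.
  rewrite RintegralB//; [|exact: (Cb_integrable Q uiCb)|exact: Cb_integrable].
  rewrite subr_le0 (initial_integral sepE xQ uCb) (point_law_integral x uCb).
  by rewrite /u value_eq; exact: lower_value_le.
Qed.

Lemma comparison_discounted_unique lam h (mu : borel_probability R E)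
    d1 (Om1 : measurableType d1) (P1 : probability Om1 R)
    (X1 : Om1 -> borel (skorohod E))
    d2 (Om2 : measurableType d2) (P2 : probability Om2 R)
    (X2 : Om2 -> borel (skorohod E)) :
  0 < lam -> comparison_set A lam h ->
  solution_for A P1 X1 mu -> solution_for A P2 X2 mu ->
  (\int[P1]_w discounted lam h (X1 w))%R = (\int[P2]_w discounted lam h (X2 w))%R.
Proof.
move=> lam0 hM [sol1 init1] [sol2 init2].
have [u uCb uE] := comparison_discounted lam0 hM.
have [_ /bounded_fun_leP[M M0 uM]] := uCb.
have initE d (Om : measurableType d) (P : probability Om R)
    (X : Om -> borel (skorohod E)) : solution A P X ->
    (forall B : set (borel E), measurable B -> P [set w | B (X w 0)] = mu B) ->
    (\int[P]_w u (X w 0))%R = (\int[mu]_e u e)%R.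
  move=> solX init.
  have muE (B : set (borel E)) : measurable B ->
      mu B = pushforward P (fun w => X w 0 : borel E) B.
    by move=> mB; rewrite -init.
  by rewrite (Rintegral_pushforward (solution_coord_measurable solX (lexx 0))
    muE (Cb_borel uCb) uM).
by rewrite !uE// !initE.
Qed.

End Comparison.

(** * Position at an exponential time *)

Section ExponentialTime.
Context {R : realType} {E : completeMetricType R}.
Local Notation leb := (@lebesgue_measure R).

Definition exponential_law (lam : R) (lam0 : 0 < lam) :
    probability (measurableTypeR R) R :=
  exponential_distribution_exponential_prob__canonical__probability_measure_Probability lam0.

Lemma Rintegral_exponential_law (lam : R) (lam0 : 0 < lam) (a : R -> R) M :
  measurable_fun [set: measurableTypeR R] a -> (forall t, `|a t| <= M) ->
  (\int[exponential_law lam0]_t a t)%R =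
  lam * (\int[leb]_(t in `[0, +oo[) (expR (- lam * t) * a t))%R.
Proof.
move=> ma aM.
have mray : measurable (`[0, +oo[%classic : set (measurableTypeR R)).
  exact: measurable_itv.
rewrite -RintegralZl//; last exact: (integrable_discount lam0 ma aM).
rewrite /Rintegral (@integral_density _ _ _ leb (exponential_law lam0)
  (exponential_pdf lam)) => //.
- rewrite [in RHS]integral_mkcond; congr fine; apply: eq_integral => t _.
  rewrite patchE /exponential_pdf patchE; case: ifPn => _; last by rewrite mule0.
  by rewrite -EFinM mulrCA (mulrC (a t)).
- exact: (measurable_exponential_pdf lam).
- exact: (bounded_integrable _ measurableT ma aM).
Qed.

(** nu is the law of the process at an independent exponential time.  It turns
    resolvents into integrals with respect to a probability on E, to which the
    separating property applies. *)
Lemma exponential_time_law (lam : R) d (Om : measurableType d)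
    (P : probability Om R) (X : Om -> borel (skorohod E)) : separable E -> 0 < lam ->
  (forall t, 0 <= t -> measurable_fun setT (fun w => X w t : borel E)) ->
  exists nu : borel_probability R E, forall h, Cb R E h ->
    (\int[nu]_e h e)%R = lam * (\int[P]_w discounted lam h (X w))%R.
Proof.
move=> sepE lam0 mX; pose T := exponential_law lam0.
have mZ := measurable_joint mX.
pose Z (z : Om * measurableTypeR R) : borel E := X z.1 z.2.
exists (law (P \x T)%E mZ) => h hCb.
have [ch /bounded_fun_leP[M M0 hM]] := hCb.
have mhZ : measurable_fun setT (fun z => h (Z z)).
  exact: measurableT_comp (Cb_borel hCb) mZ.
have iZ : (P \x T)%E.-integrable setT (EFin \o (fun z => h (Z z))).
  exact: (bounded_integrable _ measurableT mhZ (fun z => hM _)).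
rewrite (Rintegral_law mZ (Cb_borel hCb) iZ).
have FCb := Cb_discounted lam0 hCb.
have [_ /bounded_fun_leP[N N0 FN]] := FCb.
have mF : measurable_fun setT (fun w => discounted lam h (X w)).
  exact: measurableT_comp (Cb_borel FCb) (measurable_path sepE mX).
have iF : P.-integrable setT (EFin \o (fun w => discounted lam h (X w))).
  exact: (bounded_integrable _ measurableT mF (fun w => FN _)).
rewrite -RintegralZl// {1}/Rintegral -(integral12_prod_meas1 iZ) /Rintegral.
congr fine; apply: eq_integral => w _.
have mhX := measurable_along_path (X w) ch.
rewrite -(Rintegral_exponential_law lam0 mhX (fun t => hM _)).
rewrite /Rintegral fineK//; apply: integrable_fin_num => //.
exact: (bounded_integrable _ measurableT mhX (fun t => hM _)).
Qed.

End ExponentialTime.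

(** * Inversion of the Laplace transform *)

Section LaplaceKernel.
Context {R : realType}.
Implicit Types (y z : R) (n N : nat).

Lemma bernoulli_ge y N : 0 <= y -> y <= 1 -> 1 - N%:R * y <= (1 - y) ^+ N.
Proof.
move=> y0 y1; elim: N => [|N IH]; first by rewrite mul0r subr0 expr0.
rewrite exprS.
have := ler_wpM2l (_ : 0 <= 1 - y) IH; rewrite subr_ge0 => /(_ y1).
apply: le_trans; rewrite -natr1; have : 0 <= N%:R * (y * y) by rewrite !mulr_ge0.
by lra.
Qed.

Lemma bernoulli_le y N : 0 <= y -> y <= 1 -> (1 - y) ^+ N * (1 + N%:R * y) <= 1.
Proof.
move=> y0 y1; elim: N => [|N IH]; first by rewrite mul0r addr0 expr0 mulr1.
apply: le_trans IH; rewrite exprSr -mulrA ler_wpM2l//.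
  by rewrite exprn_ge0// subr_ge0.
rewrite -natr1; have : 0 <= N%:R * (y * y) by rewrite !mulr_ge0.
have : 0 <= y * y by rewrite mulr_ge0.
lra.
Qed.

(** Polynomials in z that tend to the indicator of z < 1/2 on [0, 1]. *)
Definition cutoff n z := (1 - z ^+ n) ^+ (2 ^ n).

Lemma cutoff_itv n z : 0 <= z <= 1 -> 0 <= cutoff n z <= 1.
Proof.
move=> /andP[z0 z1]; have zn1 : z ^+ n <= 1 by rewrite exprn_ile1.
rewrite /cutoff exprn_ge0 ?subr_ge0// exprn_ile1// ?subr_ge0//.
by rewrite gerBl exprn_ge0.
Qed.

(** By Bernoulli, the cutoff is at least 1 - (2 z)^n. *)
Lemma cutoff_cvg1 z : 0 <= z -> z < 2^-1 -> cutoff n z @[n --> \oo] --> (1 : R).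
Proof.
move=> z0 zh; have z1 : z <= 1 by apply: ltW (lt_le_trans zh _); lra.
have sq n : 1 - (2 * z) ^+ n <= cutoff n z <= 1.
  have /andP[_ ->] := cutoff_itv n (introT andP (conj z0 z1)); rewrite andbT.
  apply: le_trans (bernoulli_ge _ _ _).
  - by rewrite exprMn natrX.
  - exact: exprn_ge0.
  - by rewrite exprn_ile1.
apply: (squeeze_cvgr (nearW _ sq)); last exact: cvg_cst.
rewrite -[X in _ --> X]subr0; apply: cvgB; first exact: cvg_cst.
apply: cvg_expr; rewrite ger0_norm; last by rewrite mulr_ge0.
lra.
Qed.

(** By Bernoulli, the cutoff is at most 1 / (2 z)^n. *)
Lemma cutoff_cvg0 z : 2^-1 < z -> z <= 1 -> cutoff n z @[n --> \oo] --> (0 : R).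
Proof.
move=> zh z1; have z0 : 0 <= z by apply: ltW (lt_trans _ zh); lra.
have z20 : 0 < 2 * z by lra.
have sq n : 0 <= cutoff n z <= (2 * z)^-1 ^+ n.
  have /andP[-> _] := cutoff_itv n (introT andP (conj z0 z1)); rewrite andTb.
  have zn0 : 0 <= z ^+ n by exact: exprn_ge0.
  have zn1 : z ^+ n <= 1 by rewrite exprn_ile1.
  have := bernoulli_le (2 ^ n) zn0 zn1; rewrite natrX -exprMn => h.
  have c0 : 0 <= cutoff n z by rewrite exprn_ge0// subr_ge0.
  rewrite exprVn -div1r ler_pdivlMr ?exprn_gt0//.
  apply: le_trans h; rewrite -/(cutoff n z) ler_wpM2l// lerDr//.
apply: (squeeze_cvgr (nearW _ sq)); first exact: cvg_cst.
apply: cvg_expr; rewrite ger0_norm; last by rewrite invr_ge0 ltW.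
rewrite invf_lt1//; lra.
Qed.

End LaplaceKernel.

Section WeightedDiscount.
Context {R : realType} {E : completeMetricType R}.
Local Notation leb := (@lebesgue_measure R).
Variable h : E -> R.
Hypothesis hCb : Cb R E h.
Implicit Types (x : skorohod E) (kappa lam : R) (N : nat).

Let ray : set (measurableTypeR R) := `[0%R, +oo[%classic.

Let mray : measurable ray. Proof. exact: measurable_itv. Qed.

(** The decaying exponential, made bounded by freezing it at negative times. *)
Definition clipped kappa (t : R) : R := expR (- kappa * Num.max t 0).

Lemma clipped_itv kappa t : 0 <= kappa -> 0 <= clipped kappa t <= 1.
Proof.
move=> k0; rewrite expR_ge0/= -expR0 ler_expR mulNr oppr_le0 mulr_ge0//.
by rewrite le_max lexx orbT.
Qed.

Lemma measurable_clipped kappa :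
  measurable_fun [set: measurableTypeR R] (clipped kappa).
Proof.
apply: measurableT_comp => //; apply: measurable_funM => //.
exact: measurable_maxr.
Qed.

(** The discounted functional with the additional weight (1 - exp (- kappa t))^N,
    a polynomial in exp (- kappa t); a combination of [discounted] at the rates
    lam + j kappa. *)
Definition weighted kappa N lam x : R :=
  (\int[leb]_(t in ray)
    (expR (- lam * t) * ((1 - clipped kappa t) ^+ N * h (x t))))%R.

Lemma weight_itv kappa N t : 0 <= kappa -> 0 <= (1 - clipped kappa t) ^+ N <= 1.
Proof.
move=> k0; have /andP[c0 c1] := clipped_itv t k0.
by rewrite exprn_ge0 ?subr_ge0//= exprn_ile1// ?subr_ge0// gerBl.
Qed.

Lemma measurable_weight kappa N x : measurable_fun [set: measurableTypeR R]
  (fun t => (1 - clipped kappa t) ^+ N * h (x t)).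
Proof.
apply: measurable_funM; last by apply: measurable_along_path; case: hCb.
apply: measurable_funX; apply: measurable_funB => //; exact: measurable_clipped.
Qed.

Lemma weight_bounded M kappa N x : (forall e, `|h e| <= M) -> 0 <= kappa ->
  forall t, `|(1 - clipped kappa t) ^+ N * h (x t)| <= M.
Proof.
move=> hM k0 t; have /andP[w0 w1] := weight_itv N t k0.
by rewrite normrM -[leRHS]mul1r ler_pM// ger0_norm.
Qed.

Lemma integrable_weighted kappa N lam x : 0 < lam -> 0 <= kappa ->
  leb.-integrable ray (EFin \o
    (fun t => expR (- lam * t) * ((1 - clipped kappa t) ^+ N * h (x t)))).
Proof.
move=> lam0 k0; have [_ /bounded_fun_leP[M M0 hM]] := hCb.
exact: (integrable_discount lam0 (measurable_weight kappa N x) (weight_bounded N x hM k0)).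
Qed.

Lemma weighted0 kappa lam x : weighted kappa 0 lam x = discounted lam h x.
Proof. by apply: eq_Rintegral => t _; rewrite expr0 mul1r. Qed.

Lemma weightedS kappa N lam x : 0 < lam -> 0 <= kappa ->
  weighted kappa N.+1 lam x = weighted kappa N lam x - weighted kappa N (lam + kappa) x.
Proof.
move=> lam0 k0; rewrite /weighted -RintegralB//; last 2 first.
- exact: integrable_weighted.
- by apply: integrable_weighted => //; rewrite ltr_wpDr.
apply: eq_Rintegral => t; rewrite inE /ray/= in_itv/= andbT => t0.
have -> : expR (- (lam + kappa) * t) = expR (- lam * t) * clipped kappa t.
  by rewrite /clipped max_l// -expRD -mulrDl opprD.
by rewrite exprS; ring.
Qed.

Lemma weighted_bounded lam : 0 < lam -> exists2 C, 0 <= C &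
  forall kappa N x, 0 <= kappa -> `|weighted kappa N lam x| <= C.
Proof.
move=> lam0; have [_ /bounded_fun_leP[M M0 hM]] := hCb.
exists (M * \int[leb]_(t in ray) expR (- lam * t))%R.
  by rewrite mulr_ge0// Rintegral_ge0// => t _; exact: expR_ge0.
move=> kappa N x k0; have iw := integrable_weighted N x lam0 k0.
rewrite -RintegralZl//; last exact: integrable_expdecay.
rewrite (le_trans (le_normr_Rintegral mray iw))//.
apply: le_Rintegral => //.
- by have := integrable_norm iw; apply: eq_integrable.
- have := integrableZl mray M (integrable_expdecay lam0).
  by apply: eq_integrable.
- move=> t _; rewrite normrM ger0_norm ?expR_ge0// mulrC ler_wpM2r ?expR_ge0//.
  exact: weight_bounded.
Qed.

(** With z = exp (- (ln 2 / a) t) the weight is [cutoff n z], and z < 1/2 exactly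
    when t > a. *)
Lemma weighted_limit lam x a : 0 < lam -> 0 < a ->
  weighted (ln 2 / a * n%:R) (2 ^ n) lam x @[n --> \oo] -->
  expR (- lam * a) * discounted lam h (restart a x).
Proof.
move=> lam0 a0; have [ch /bounded_fun_leP[M M0 hM]] := hCb.
have eta0 : 0 < ln 2 / a by rewrite divr_gt0// ln_gt0// ltr1n.
set eta := ln 2 / a in eta0 *.
have k0 n : 0 <= eta * n%:R by rewrite mulr_ge0// ltW.
pose f (t : R) := expR (- lam * t) * h (x t).
have mtail : measurable (`[a, +oo[%classic : set (measurableTypeR R)).
  exact: measurable_itv.
have mf : measurable_fun [set: measurableTypeR R] f.
  by apply: measurable_funM; [exact: measurable_expdecay|exact: measurable_along_path].
have -> : expR (- lam * a) * discounted lam h (restart a x) =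
    (\int[leb]_(t in ray) (f \_ `[a, +oo[) t)%R.
  rewrite -(discounted_tail x lam0 hCb (ltW a0)) -Rintegral_mkcondr.
  rewrite (_ : ray `&` _ = `[a, +oo[%classic)//.
  rewrite /ray; apply/seteqP; split => t /=; rewrite !in_itv/= !andbT; first by case.
  by move=> at_; split=> //; rewrite (le_trans (ltW a0)).
apply: (@Rintegral_dominated _ _ _ leb ray _ _ (fun t => M * expR (- lam * t))) => //.
- move=> n; apply: measurable_funTS; apply: measurable_funM.
    exact: measurable_expdecay.
  exact: measurable_weight.
- by apply: measurable_funTS; apply/(measurable_restrictT _ mtail)/measurable_funTS.
- exists [set a]; split => [||t /=].
  + exact: measurable_set1.
  + by apply: countable_lebesgue_measure0; exact: countable1.
  + move=> H; apply: contrapT => ta; apply: H.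
    rewrite /ray/= in_itv/= andbT => t0.
    pose z := expR (- eta * t).
    have cz n : (1 - clipped (eta * n%:R) t) ^+ (2 ^ n) = cutoff n z.
      rewrite /cutoff /clipped max_l// /z -expRM_natl.
      by congr ((1 - expR _) ^+ _); ring.
    have eta_a : expR (- eta * a) = 2^-1.
      by rewrite mulNr /eta divfK ?gt_eqF// expRN lnK// posrE.
    under eq_fun do rewrite cz.
    have z0 : 0 <= z by exact: expR_ge0.
    have z1 : z <= 1.
      by rewrite -expR0 ler_expR mulNr oppr_le0 mulr_ge0// ltW.
    rewrite patchE; case: ifPn.
      rewrite inE/= in_itv/= andbT => at_.
      have {}at_ : a < t by rewrite lt_neqAle at_ andbT eq_sym; apply/eqP.
      have -> : f t = expR (- lam * t) * (1 * h (x t)) by rewrite mul1r.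
      apply: cvgM; first exact: cvg_cst.
      apply: cvgM; last exact: cvg_cst.
      apply: cutoff_cvg1 => //.
      by rewrite -eta_a ltr_expR !mulNr ltrN2 ltr_pM2l.
    rewrite notin_setE/= in_itv/= andbT => /negP; rewrite -ltNge => ta_.
    have zh : 2^-1 < z by rewrite -eta_a ltr_expR !mulNr ltrN2 ltr_pM2l.
    have := cvgM (cvg_cst (expR (- lam * t))) (cvgM (cutoff_cvg0 zh z1) (cvg_cst (h (x t)))).
    by rewrite mul0r mulr0; apply.
- have := integrableZl mray M (integrable_expdecay lam0).
  by apply: eq_integrable.
- move=> n t _; rewrite normrM ger0_norm ?expR_ge0// mulrC ler_wpM2r ?expR_ge0//.
  exact: weight_bounded.
Qed.

Hypothesis sepE : separable E.

Section Mean.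
Context d (Om : measurableType d) (P : probability Om R).
Variable X : Om -> borel (skorohod E).
Hypothesis mX : forall t, 0 <= t -> measurable_fun setT (fun w => X w t : borel E).

Lemma measurable_weighted kappa N lam : 0 < lam -> 0 <= kappa ->
  measurable_fun setT (fun w => weighted kappa N lam (X w)).
Proof.
move=> + k0; elim: N lam => [|N IH] lam lam0.
  rewrite (_ : (fun w => _) = (fun w => discounted lam h (X w))); last first.
    by apply/funext => w; exact: weighted0.
  apply: measurableT_comp (Cb_borel (Cb_discounted lam0 hCb)) _.
  exact: measurable_path.
rewrite (_ : (fun w => _) =
   (fun w => weighted kappa N lam (X w) - weighted kappa N (lam + kappa) (X w))).
  by apply: measurable_funB; apply: IH => //; rewrite ltr_wpDr.
by apply/funext => w; exact: weightedS.
Qed.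

Lemma mean_weightedS kappa N lam : 0 < lam -> 0 <= kappa ->
  (\int[P]_w weighted kappa N.+1 lam (X w))%R =
  (\int[P]_w weighted kappa N lam (X w))%R
  - (\int[P]_w weighted kappa N (lam + kappa) (X w))%R.
Proof.
move=> lam0 k0; have lk0 : 0 < lam + kappa by rewrite ltr_wpDr.
rewrite -RintegralB//.
- by apply: eq_Rintegral => w _; exact: weightedS.
- have [C C0 wC] := weighted_bounded lam0.
  exact: (bounded_integrable _ measurableT (measurable_weighted N lam0 k0)
    (fun w => wC _ _ _ k0)).
- have [C C0 wC] := weighted_bounded lk0.
  exact: (bounded_integrable _ measurableT (measurable_weighted N lk0 k0)
    (fun w => wC _ _ _ k0)).
Qed.

Lemma mean_weighted_limit lam a : 0 < lam -> 0 < a ->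
  (\int[P]_w weighted (ln 2 / a * n%:R) (2 ^ n) lam (X w))%R @[n --> \oo] -->
  expR (- lam * a) * (\int[P]_w discounted lam h (restart a (X w)))%R.
Proof.
move=> lam0 a0.
have [_ /bounded_fun_leP[M M0 FM]] := Cb_discounted lam0 hCb.
have k0 n : 0 <= ln 2 / a * n%:R by rewrite mulr_ge0// divr_ge0 ?ln_ge0 ?ler1n// ltW.
have [C C0 wC] := weighted_bounded lam0.
have mD := measurable_discounted_restart sepE mX lam0 hCb (ltW a0).
rewrite -RintegralZl//.
- apply: (@Rintegral_bounded_cvg _ _ _ P _ _ C).
  + by move=> n; exact: measurable_weighted.
  + exact: measurable_funM.
  + by move=> w; exact: weighted_limit.
  + by move=> n w; exact: wC.
- exact: (bounded_integrable _ measurableT mD (fun w => FM _)).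
Qed.

End Mean.

End WeightedDiscount.

Section Laplace.
Context {R : realType} {E : completeMetricType R}.
Hypothesis sepE : separable E.
Context d1 (Om1 : measurableType d1) (P1 : probability Om1 R)
  (X1 : Om1 -> borel (skorohod E)).
Context d2 (Om2 : measurableType d2) (P2 : probability Om2 R)
  (X2 : Om2 -> borel (skorohod E)).
Hypothesis mX1 : forall t, 0 <= t -> measurable_fun setT (fun w => X1 w t : borel E).
Hypothesis mX2 : forall t, 0 <= t -> measurable_fun setT (fun w => X2 w t : borel E).
Variable h : E -> R.
Hypothesis hCb : Cb R E h.
Hypothesis eq_discounted : forall lam, 0 < lam ->
  (\int[P1]_w discounted lam h (X1 w))%R = (\int[P2]_w discounted lam h (X2 w))%R.

Lemma mean_weighted_eq kappa N lam : 0 < lam -> 0 <= kappa ->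
  (\int[P1]_w weighted h kappa N lam (X1 w))%R =
  (\int[P2]_w weighted h kappa N lam (X2 w))%R.
Proof.
move=> + k0; elim: N lam => [|N IH] lam lam0.
  have W0 d (Om : measurableType d) (P : probability Om R) (X : Om -> skorohod E) :
      (\int[P]_w weighted h kappa 0 lam (X w))%R = (\int[P]_w discounted lam h (X w))%R.
    by apply: eq_Rintegral => w _; exact: weighted0.
  by rewrite !W0 eq_discounted.
rewrite !mean_weightedS// IH// IH//.
by rewrite ltr_wpDr.
Qed.

(** Equality of the resolvents at all rates passes to the integrals of
    exp (- lam t) h (X t) over t > a, as limits of combinations of resolvents. *)
Lemma mean_restart_eq lam a : 0 < lam -> 0 <= a ->
  (\int[P1]_w discounted lam h (restart a (X1 w)))%R =
  (\int[P2]_w discounted lam h (restart a (X2 w)))%R.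
Proof.
move=> lam0; rewrite le_eqVlt => /predU1P[<-|a0].
  have r0 d (Om : measurableType d) (P : probability Om R) (X : Om -> skorohod E) :
      (\int[P]_w discounted lam h (restart 0 (X w)))%R = (\int[P]_w discounted lam h (X w))%R.
    by apply: eq_Rintegral => w _; rewrite restart0.
  by rewrite !r0 eq_discounted.
have := mean_weighted_limit (P := P1) hCb sepE mX1 lam0 a0.
have k0 n : 0 <= ln 2 / a * n%:R by rewrite mulr_ge0// divr_ge0 ?ln_ge0 ?ler1n// ltW.
rewrite (_ : (fun n => _) = (fun n =>
  (\int[P2]_w weighted h (ln 2 / a * n%:R) (2 ^ n) lam (X2 w))%R)); last first.
  by apply/funext => n; exact: mean_weighted_eq.
have L2 := mean_weighted_limit (P := P2) hCb sepE mX2 lam0 a0.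
move=> L1; have e0 : expR (- lam * a) != 0 by rewrite gt_eqF// expR_gt0.
exact: (mulfI e0 (cvg_unique (@Rhausdorff R) L1 L2)).
Qed.

(** The mean of h (X a) is the derivative at a of the integrals over t > a, up to
    sign and discount. *)
Lemma mean_marginal_eq a : 0 <= a ->
  (\int[P1]_w h (X1 w a))%R = (\int[P2]_w h (X2 w a))%R.
Proof.
move=> a0; have l1 : 0 < (1 : R) by [].
have mr d (Om : measurableType d) (X : Om -> borel (skorohod E)) :
    (forall t, 0 <= t -> measurable_fun setT (fun w => X w t : borel E)) ->
    forall t, 0 <= t -> measurable_fun setT (fun w => restart a (X w) t : borel E).
  move=> mX t t0; rewrite (_ : (fun w => _) = (fun w => X w (a + t) : borel E)).
    by apply: mX; rewrite addr_ge0.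
  by apply/funext => w; rewrite restartE.
have L1 := mean_short_discount_cvg (P := P1) sepE (mr _ _ _ mX1) l1 hCb.
have L2 := mean_short_discount_cvg (P := P2) sepE (mr _ _ _ mX2) l1 hCb.
have initE d (Om : measurableType d) (P : probability Om R) (X : Om -> skorohod E) :
    (\int[P]_w h (restart a (X w) 0))%R = (\int[P]_w h (X w a))%R.
  by apply: eq_Rintegral => w _; rewrite restartE// addr0.
have seqE d (Om : measurableType d) (P : probability Om R)
    (X : Om -> borel (skorohod E)) n :
    (forall t, 0 <= t -> measurable_fun setT (fun w => X w t : borel E)) ->
    (\int[P]_w (n.+1%:R * short_discount 1 h n.+1%:R^-1 (restart a (X w))))%R =
    n.+1%:R * ((\int[P]_w discounted 1 h (restart a (X w)))%R -
      expR (- 1 * n.+1%:R^-1) *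
      (\int[P]_w discounted 1 h (restart (a + n.+1%:R^-1) (X w)))%R).
  move=> mX; have n0 : 0 <= n.+1%:R^-1 :> R by rewrite invr_ge0.
  have [ch /bounded_fun_leP[M M0 hM]] := hCb.
  rewrite RintegralZl//; last first.
    apply: (bounded_integrable _ measurableT
      (measurable_short_discount sepE (mr _ _ _ mX) l1 hCb n0)
      (fun w => short_discount_bounded _ (ltW l1) ch hM n0)).
  rewrite (mean_short_discountE sepE P (mr _ _ _ mX) l1 hCb n0).
  congr (_ * (_ - _ * _)); apply: eq_Rintegral => w _.
  by rewrite restart_restart.
rewrite -(initE _ _ P1) -(initE _ _ P2).
apply: (cvg_unique (@Rhausdorff R) L1).
rewrite (_ : (fun n => _) = (fun n => \int[P2]_w (n.+1%:R *
    short_discount 1 h n.+1%:R^-1 (restart a (X2 w))))%R)//.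
apply/funext => n; rewrite !seqE// !mean_restart_eq//.
by rewrite addr_ge0// invr_ge0.
Qed.

End Laplace.

(** * Uniqueness of marginals and of finite-dimensional laws *)

Section MarginalUniqueness.
Context {R : realType} {E : completeMetricType R}.
Variable A : set ((E -> R) * (E -> R)).
Hypothesis A_Cb : A `<=` Cb R E `*` Cb R E.
Hypothesis sepE : separable E.
Hypothesis existsA : forall mu : borel_probability R E, solution_laws A mu !=set0.
Hypothesis compactA : forall K : set (borel_probability R E), compact K ->
  compact (\bigcup_(mu in K) solution_laws A mu).
Hypothesis separatingM : forall lam : R, 0 < lam -> separating (comparison_set A lam).

Lemma discounted_unique (mu : borel_probability R E)
    d1 (Om1 : measurableType d1) (P1 : probability Om1 R)
    (X1 : Om1 -> borel (skorohod E))
    d2 (Om2 : measurableType d2) (P2 : probability Om2 R)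
    (X2 : Om2 -> borel (skorohod E)) lam h :
  solution_for A P1 X1 mu -> solution_for A P2 X2 mu ->
  0 < lam -> Cb R E h ->
  (\int[P1]_w discounted lam h (X1 w))%R = (\int[P2]_w discounted lam h (X2 w))%R.
Proof.
move=> sol1 sol2 lam0 hCb.
have [nu1 nu1E] := exponential_time_law P1 sepE lam0 (solution_coord_measurable (proj1 sol1)).
have [nu2 nu2E] := exponential_time_law P2 sepE lam0 (solution_coord_measurable (proj1 sol2)).
have nu12 : forall B : set (borel E), measurable B -> nu1 B = nu2 B.
  apply: (separatingM lam0) => f fM; have [fCb _] := fM.
  rewrite nu1E// nu2E//; congr (_ * _).
  exact: (comparison_discounted_unique A_Cb sepE existsA compactA lam0 fM sol1 sol2).
have eq_lam : lam * (\int[P1]_w discounted lam h (X1 w))%R =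
       lam * (\int[P2]_w discounted lam h (X2 w))%R.
  rewrite -nu1E// -nu2E// /Rintegral; congr fine.
  by apply: eq_measure_integral => B mB _; exact: nu12.
exact: (mulfI (lt0r_neq0 lam0) eq_lam).
Qed.

Lemma marginal_unique (mu : borel_probability R E)
    d1 (Om1 : measurableType d1) (P1 : probability Om1 R)
    (X1 : Om1 -> borel (skorohod E))
    d2 (Om2 : measurableType d2) (P2 : probability Om2 R)
    (X2 : Om2 -> borel (skorohod E)) :
  solution_for A P1 X1 mu -> solution_for A P2 X2 mu ->
  forall t, 0 <= t -> forall B : set (borel E), measurable B ->
  P1 [set w | B (X1 w t)] = P2 [set w | B (X2 w t)].
Proof.
move=> sol1 sol2 t t0.
have mX1 := solution_coord_measurable (proj1 sol1).
have mX2 := solution_coord_measurable (proj1 sol2).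
pose nu1 : borel_probability R E := law P1 (mX1 t t0).
pose nu2 : borel_probability R E := law P2 (mX2 t t0).
suff : forall B : set (borel E), measurable B -> nu1 B = nu2 B by [].
(* Functions in [Cb] are separating since those of the comparison set at rate 1
   are among them. *)
apply: (separatingM ltr01) => f [fCb _].
have [_ /bounded_fun_leP[M M0 fM]] := fCb.
have lawE d (Om : measurableType d) (P : probability Om R)
    (X : Om -> borel (skorohod E)) (mX : measurable_fun setT (fun w => X w t : borel E)) :
    (\int[law P mX]_e f e)%R = (\int[P]_w f (X w t))%R.
  apply: Rintegral_law; first exact: Cb_borel.
  apply: (bounded_integrable _ measurableT _ (fun w => fM _)).
  exact: measurableT_comp (Cb_borel fCb) mX.
rewrite !lawE; apply: (mean_marginal_eq sepE mX1 mX2 fCb) => // lam lam0.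
exact: (discounted_unique sol1 sol2).
Qed.

End MarginalUniqueness.

Section Cylinders.
Context {R : realType} {E : completeMetricType R}.
Implicit Types (x : skorohod E) (s : seq (R * set (borel E))).

(** Conditions on finitely many positions, listed by time increments: after the
    head condition, the tail bears on the restarted path. *)
Fixpoint cylinder s x : Prop := if s is (e, B) :: s' then
  B (x e) /\ cylinder s' (restart e x) else True.

Fixpoint cylinder_data s : Prop := if s is (e, B) :: s' then
  [/\ 0 <= e, measurable B & cylinder_data s'] else True.

Lemma cylinder_measurable d (Om : measurableType d) (X : Om -> skorohod E) s :
  (forall t, 0 <= t -> measurable_fun setT (fun w => X w t : borel E)) ->
  cylinder_data s -> measurable [set w | cylinder s (X w)].
Proof.
elim: s X => [|[e B] s IH] X mX /=.
  by move=> _; rewrite (_ : [set _ | _] = setT)//; apply/seteqP; split.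
move=> [e0 mB sP]; rewrite (_ : [set _ | _] = [set w | B (X w e)] `&`
  [set w | cylinder s (restart e (X w))])//.
apply: measurableI.
  by rewrite -[X in measurable X]setTI; exact: mX.
apply: IH => // t t0; rewrite (_ : (fun w => _) = (fun w => X w (e + t) : borel E)).
  by apply: mX; rewrite addr_ge0.
by apply/funext => w; rewrite restartE.
Qed.

(** Merging: the list whose first time is later has this time reckoned from the
    first time of the other one. *)
Lemma cylinderI s1 s2 : cylinder_data s1 -> cylinder_data s2 ->
  exists2 s, cylinder_data s & cylinder s = cylinder s1 `&` cylinder s2.
Proof.
have [n] := ubnP (size s1 + size s2); elim: n s1 s2 => // n IH.
move=> [|[e1 B1] s1] [|[e2 B2] s2] sz.
- by exists [::] => //; apply/seteqP; split.
- by move=> _ d2; exists ((e2, B2) :: s2) => //; rewrite setTI.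
- by move=> d1 _; exists ((e1, B1) :: s1) => //; rewrite setIT.
wlog e12 : e1 e2 B1 B2 s1 s2 sz / e1 <= e2.
  move=> H; have [e12|/ltW e21] := leP e1 e2; first exact: H.
  move=> d1 d2; have [|//||s sd sE] := H _ _ B2 B1 s2 s1 _ e21.
  - by rewrite addnC.
  - by [].
  - by exists s => //; rewrite setIC.
move=> /= [e10 mB1 d1] [e20 mB2 d2].
have [||//|s sd sE] := IH s1 ((e2 - e1, B2) :: s2).
- by move: sz; rewrite /= addSn.
- by [].
- by split => //; rewrite subr_ge0.
have rE x : restart_path e1 x (e2 - e1) = x e2.
  by rewrite -[LHS]/(restart e1 x _) restartE ?subr_ge0// addrC subrK.
have rr x : restart (e2 - e1) (restart e1 x) = restart e2 x.
  by rewrite restart_restart ?subr_ge0// addrC subrK.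
exists ((e1, B1) :: s); first by split.
apply/seteqP; split => x /=.
  by rewrite sE /= rE rr => -[Bx [c1 []]].
move=> [[Bx c1] [B2x c2]]; split => //; rewrite sE; split=> //=.
by rewrite rE rr.
Qed.

End Cylinders.

Section FiniteDimensional.
Context {R : realType} {E : completeMetricType R}.
Variable A : set ((E -> R) * (E -> R)).
Hypothesis A_Cb : A `<=` Cb R E `*` Cb R E.
Hypothesis sepE : separable E.
Hypothesis existsA : forall mu : borel_probability R E, solution_laws A mu !=set0.
Hypothesis compactA : forall K : set (borel_probability R E), compact K ->
  compact (\bigcup_(mu in K) solution_laws A mu).
Hypothesis separatingM : forall lam : R, 0 < lam -> separating (comparison_set A lam).

Lemma conditional_solution_for d (Om : measurableType d) (P : probability Om R)
    (X : Om -> borel (skorohod E)) (mu : borel_probability R E) (e : R)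
    (B : set (borel E)) (mC : measurable [set w | B (X w e)])
    (PC : P [set w | B (X w e)] != 0%E) :
  solution A P X -> 0 <= e -> measurable B ->
  (forall D : set (borel E), measurable D -> ((fine (P [set w | B (X w e)]))^-1%:E *
    P [set w | (D `&` B) (X w e)])%E = mu D) ->
  solution_for A (conditional mC PC) (fun w => restart e (X w)) mu.
Proof.
move=> solX e0 mB muE; split.
  exact: (solution_conditional_restart A_Cb solX mC PC e0 mB).
move=> D mD; rewrite -muE//= /conditional; congr (_ * P _)%E.
by apply/seteqP; split => w /=; rewrite -[restart_path e _ 0]/(restart e (X w) 0)
  restartE// addr0.
Qed.

(** Condition both solutions on the head condition and restart them: they remain
    solutions, and their new initial laws agree since the marginals do, so that
    the induction hypothesis applies to the tail. *)
Lemma cylinder_unique s : cylinder_data s -> forall (mu : borel_probability R E)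
    d1 (Om1 : measurableType d1) (P1 : probability Om1 R)
    (X1 : Om1 -> borel (skorohod E))
    d2 (Om2 : measurableType d2) (P2 : probability Om2 R)
    (X2 : Om2 -> borel (skorohod E)),
  solution_for A P1 X1 mu -> solution_for A P2 X2 mu ->
  P1 [set w | cylinder s (X1 w)] = P2 [set w | cylinder s (X2 w)].
Proof.
elim: s => [|[e B] s IH] /=.
  move=> _ mu d1 Om1 P1 X1 d2 Om2 P2 X2 _ _.
  rewrite (_ : [set _ | _] = setT); last by apply/seteqP; split.
  rewrite (_ : [set _ | _] = setT); last by apply/seteqP; split.
  by rewrite !probability_setT.
move=> [e0 mB sd] mu d1 Om1 P1 X1 d2 Om2 P2 X2 sol1 sol2.
have mX1 := solution_coord_measurable (proj1 sol1).
have mX2 := solution_coord_measurable (proj1 sol2).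
have marg (D : set (borel E)) : measurable D ->
    P1 [set w | D (X1 w e)] = P2 [set w | D (X2 w e)].
  exact: (marginal_unique A_Cb sepE existsA compactA separatingM sol1 sol2 e0).
have mC1 : measurable [set w | B (X1 w e)].
  by rewrite -[X in measurable X]setTI; exact: mX1.
have mC2 : measurable [set w | B (X2 w e)].
  by rewrite -[X in measurable X]setTI; exact: mX2.
pose Y1 w := restart e (X1 w); pose Y2 w := restart e (X2 w).
have mY1 : measurable [set w | cylinder s (Y1 w)].
  apply: cylinder_measurable sd => t t0.
  rewrite (_ : (fun w => _) = (fun w => X1 w (e + t) : borel E)).
    by apply: mX1; rewrite addr_ge0.
  by apply/funext => w; rewrite /Y1 restartE.
have mY2 : measurable [set w | cylinder s (Y2 w)].
  apply: cylinder_measurable sd => t t0.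
  rewrite (_ : (fun w => _) = (fun w => X2 w (e + t) : borel E)).
    by apply: mX2; rewrite addr_ge0.
  by apply/funext => w; rewrite /Y2 restartE.
have cylE d (Om : measurableType d) (X : Om -> skorohod E) :
    [set w | B (X w e) /\ cylinder s (restart e (X w))] =
    [set w | cylinder s (restart e (X w))] `&` [set w | B (X w e)].
  by apply/seteqP; split => w /= -[].
rewrite !cylE.
have [PC1|PC1] := eqVneq (P1 [set w | B (X1 w e)]) 0%E.
  have PC2 : P2 [set w | B (X2 w e)] = 0%E by rewrite -marg.
  rewrite (@subset_measure0 _ _ _ P1 _ _ (measurableI _ _ mY1 mC1) mC1 _ PC1)//.
  by rewrite (@subset_measure0 _ _ _ P2 _ _ (measurableI _ _ mY2 mC2) mC2 _ PC2).
have PC2 : P2 [set w | B (X2 w e)] != 0%E by rewrite -marg.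
have mY10 : measurable_fun setT (fun w => Y1 w 0 : borel E).
  rewrite (_ : (fun w => _) = (fun w => X1 w e : borel E)); first exact: mX1.
  by apply/funext => w; rewrite /Y1 restartE// addr0.
pose mu' : borel_probability R E := law (conditional mC1 PC1) mY10.
have mu'E (D : set (borel E)) : mu' D = ((fine (P1 [set w | B (X1 w e)]))^-1%:E *
    P1 [set w | (D `&` B) (X1 w e)])%E.
  rewrite /mu' /= /law /image_measure /pushforward /conditional.
  congr (_ * P1 _)%E; apply/seteqP; split => w /=;
    by rewrite -[restart_path e _ 0]/(restart e (X1 w) 0) restartE// addr0.
have sol1' : solution_for A (conditional mC1 PC1) Y1 mu'.
  apply: conditional_solution_for => //; by case: sol1.
have sol2' : solution_for A (conditional mC2 PC2) Y2 mu'.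
  apply: conditional_solution_for => //; first by case: sol2.
  move=> D mD; rewrite mu'E -marg//; congr (_ * _)%E; apply/esym/marg.
  exact: measurableI.
have := IH sd mu' _ _ _ _ _ _ _ _ sol1' sol2'.
rewrite /= /conditional -marg//.
set p := fine _.
have p0 : p != 0.
  rewrite /p fine_eq0//; exact: fin_num_measure.
move=> /(congr1 (fun z => p%:E * z)%E).
by rewrite !muleA -!EFinM divff// !mul1e.
Qed.

Definition cylinders : set (set (skorohod E)) :=
  [set C | exists2 s, cylinder_data s & C = cylinder s].

Lemma borel_sub_cylinders (B : set (borel (skorohod E))) : measurable B ->
  <<s cylinders >> B.
Proof.
move=> mB; pose T := g_sigma_algebraType cylinders.
have mid : measurable_fun [set: T] (fun x : T => (x : borel (skorohod E))).
  apply: measurable_path => // t t0 _ D mD; rewrite setTI.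
  apply: sub_sigma_algebra; exists [:: (t, D)] => //.
  by apply/seteqP; split => x //= -[].
by have := mid measurableT B mB; rewrite setTI.
Qed.

Lemma solution_law_unique (mu : borel_probability R E)
    d1 (Om1 : measurableType d1) (P1 : probability Om1 R)
    (X1 : Om1 -> borel (skorohod E))
    d2 (Om2 : measurableType d2) (P2 : probability Om2 R)
    (X2 : Om2 -> borel (skorohod E)) :
  solution_for A P1 X1 mu -> solution_for A P2 X2 mu ->
  forall B, measurable B -> pushforward P1 X1 B = pushforward P2 X2 B.
Proof.
move=> sol1 sol2 B mB.
pose T := g_sigma_algebraType cylinders.
have mX d (Om : measurableType d) (P : probability Om R)
    (X : Om -> borel (skorohod E)) : solution A P X ->
    measurable_fun setT (X : Om -> T).
  move=> solX; apply: (@measurability _ _ Om T setT X cylinders) => //.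
  move=> _ [_ [s sd ->] <-]; rewrite setTI.
  exact: cylinder_measurable (solution_coord_measurable solX) sd.
have mX1 := mX _ _ _ _ (proj1 sol1).
have mX2 := mX _ _ _ _ (proj1 sol2).
apply: (@measure_unique _ R T cylinders (fun=> setT) _ _ _ _
  (image_measure P1 mX1) (image_measure P2 mX2)) => //.
- move=> _ _ [s1 d1_ ->] [s2 d2_ ->]; have [s sd sE] := cylinderI d1_ d2_.
  by exists s => //; rewrite sE.
- by move=> _; exists [::] => //; apply/seteqP; split.
- by rewrite bigcup_const//; exists 0%N.
- move=> _ [s sd ->]; exact: (cylinder_unique sd sol1 sol2).
- by move=> _; rewrite /image_measure /pushforward/= preimage_setT probability_setT ltry.
- exact: borel_sub_cylinders.
Qed.

End FiniteDimensional.

Theorem theorem3p7 (R : realType) (E : completeMetricType R)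
    (A : set ((E -> R) * (E -> R)))
    (separableE : separable E)
    (A_Cb : A `<=` Cb R E `*` Cb R E)
    (denseA : Cb R E `<=`
       @closure {family compact, E -> R} (op_domain A))
    (existence : forall mu : borel_probability R E, solution_laws A mu !=set0)
    (compactness : forall K : set (borel_probability R E), compact K ->
       compact (\bigcup_(mu in K) solution_laws A mu))
    (separatingM : forall lam : R, 0 < lam -> separating (comparison_set A lam)) :
  martingale_uniqueness A.
Proof.
move=> mu d1 Om1 P1 X1 d2 Om2 P2 X2.
exact: solution_law_unique.
Qed.
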